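(* Assume in addition (case (A)) that $\mu>0$ on $[0,\zeta]$, and set $$\alpha^{**}=\sqrt{2}\,\frac{(\mu(\zeta))^{3/2}+(\mu(0))^{3/2}}{(\mu(\zeta))^{3/2}-(\mu(0))^{3/2}}.$$ Let $v_{\epsilon,\alpha}$ be a global minimizer. Then, up to the symmetry $\hat v(x)=-v(-x)$ (i.e. after replacing $v_{\epsilon,\alpha}$ by $\hat v_{\epsilon,\alpha}$ for some of the pairs $(\epsilon,\alpha)$ if necessary), the following hold. (i) As $\epsilon\to 0$ and $\alpha\to\alpha_0\in(0,\sqrt 2)$, $v_{\epsilon,\alpha}$ has a unique zero $\bar x_1(\epsilon,\alpha)$, and it converges to $-\xi$. (ii) As $\epsilon\to 0$ and $\alpha\to\alpha_0\in(\sqrt 2,\alpha^{**})$, $v_{\epsilon,\alpha}$ has a unique zero $\bar x_1(\epsilon,\alpha)$, and it converges to $-\zeta$. (iii) As $\epsilon\to 0$ and $\alpha\to\alpha_0\in(\alpha^{**},\infty)$, $v_{\epsilon,\alpha}$ has three zeros $\bar x_1(\epsilon,\alpha)<\bar x_2(\epsilon,\alpha)<\bar x_3(\epsilon,\alpha)$, converging respectively to $-\zeta$, $0$ and $\zeta$. Moreover, setting $l_i=\lim_{\epsilon\to0,\alpha\to\alpha_0}\bar x_i(\epsilon,\alpha)$, we have, in each of the three cases and for each zero $\bar x_i$, $$\lim_{\epsilon\to 0,\alpha\to\alpha_0}v_{\epsilon,\alpha}(\bar x_i(\epsilon,\alpha)+s\epsilon)=(-1)^{i+1}\sqrt{\mu(l_i)}\tanh\big(s\sqrt{\mu(l_i)/2}\big)$$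 for the $C^1_{\mathrm{loc}}(\mathbb R)$ convergence (in the variable $s$), and, for fixed $x_0\in\mathbb R$, also for the $C^1_{\mathrm{loc}}(\mathbb R)$ convergence in $s$: in case (i): $$\lim_{\epsilon\to 0,\alpha\to\alpha_0}v_{\epsilon,\alpha}(x_0+s\epsilon)=\begin{cases}\sqrt{\mu(x_0)}&\text{for }|x_0|<\xi,\\0&\text{for }|x_0|\ge\xi;\end{cases}$$ in case (ii): $$\lim_{\epsilon\to 0,\alpha\to\alpha_0}v_{\epsilon,\alpha}(x_0+s\epsilon)=\begin{cases}-\sqrt{\mu(x_0)}&\text{for }-\xi<x_0<-\zeta,\\ \sqrt{\mu(x_0)}&\text{for }-\zeta<x_0<\xi,\\0&\text{for }|x_0|\ge\xi;\end{cases}$$ in case (iii): $$\lim_{\epsilon\to 0,\alpha\to\alpha_0}v_{\epsilon,\alpha}(x_0+s\epsilon)=\begin{cases}-\sqrt{\mu(x_0)}&\text{for }x_0\in(-\xi,-\zeta)\cup(0,\zeta),\\ \sqrt{\mu(x_0)}&\text{for }x_0\in(-\zeta,0)\cup(\zeta,\xi),\\0&\text{for }|x_0|\ge\xi.\end{cases}$$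
   Context: Standing assumptions: $\mu\in C^1(\mathbb R)\cap L^\infty(\mathbb R)$ is even; there is $\zeta>0$ with $\mu'<0$ on $(\zeta,\infty)$ and $\mu'>0$ on $(0,\zeta)$; $\mu(\xi)=0$ for a unique $\xi>\zeta$; $f=-\mu'/2$, $f\in L^{4/3}(\mathbb R)$, $f$ is differentiable at $0$ and $f'(0)<0$. For $\epsilon>0$ and $\alpha\ge 0$, and $u\in H^1(\mathbb R)$ (real-valued), $$E(u)=\int_{\mathbb R}\Big(\frac{\epsilon}{2}|u'|^2-\frac{1}{2\epsilon}\mu(x)u^2+\frac{1}{4\epsilon}u^4-\alpha f(x)u\Big)dx.$$ A global minimizer is a function $v=v_{\epsilon,\alpha}\in H^1(\mathbb R)$ with $E(v)=\min_{H^1(\mathbb R)}E$. (Such minimizers exist and are classical $C^2$ solutions of $\epsilon^2v''+\mu v-v^3+\epsilon\alpha f=0$.) If $v$ is a global minimizer, so is $\hat v(x)=-v(-x)$. Assertions ''as $\epsilon\to0$ and $\alpha\to\alpha_0$'' on the number of zeros mean: for all $\epsilon>0$ small enough and $\alpha$ close enough to $\alpha_0$. *)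

(* Defs.v *)
From mathcomp Require Export all_boot all_order all_algebra.
From mathcomp Require Export all_classical all_reals all_analysis.
Export Order.TTheory GRing.Theory Num.Theory.
Export numFieldNormedType.Exports.

Set Implicit Arguments.
Unset Strict Implicit.
Unset Printing Implicit Defensive.

Local Open Scope ring_scope.
Local Open Scope classical_set_scope.

Section Definitions.
Context {R : realType}.
Implicit Types (mu u du v g phi : R -> R) (eps alpha : R).

Definition is_C1 g : Prop := (forall x, derivable g x 1) /\ continuous (derive1 g).

Definition Lp (p : \bar R) g : Prop := g \in Lfun (@lebesgue_measure R) p.

Definition test_fun phi : Prop :=
  is_C1 phi /\ compact (closure [set x | phi x != 0]).

(* Weak derivatives are tested against C^1_c; by mollification this is the same
   notion as testing against C^oo_c. *)
Definition weak_derivative u du : Prop :=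
  forall phi, test_fun phi ->
    \int[lebesgue_measure]_x (u x * derive1 phi x)
    = - \int[lebesgue_measure]_x (du x * phi x).

(* u is in H^1(R), with weak derivative du (unique up to a null set). *)
Definition H1_with u du : Prop :=
  [/\ Lp 2%:E u, Lp 2%:E du & weak_derivative u du].

Definition forcing mu : R -> R := fun x => - (derive1 mu x) / 2.

(* For u in H^1(R), with weak derivative du.  In that case, for mu in L^oo and
   forcing mu in L^{4/3}, the integrand is integrable, so that the real-valued
   Lebesgue integral is the genuine one. *)
Definition energy mu eps alpha u du : R :=
  \int[lebesgue_measure]_x
     (eps / 2 * (du x) ^+ 2 - (2 * eps)^-1 * mu x * (u x) ^+ 2
      + (4 * eps)^-1 * (u x) ^+ 4 - alpha * forcing mu x * u x).

(* Elements of H^1(R) are classes of functions modulo null sets; a minimizer,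
   whose pointwise values matter, is given by its continuous representative. *)
Definition global_minimizer mu eps alpha v : Prop :=
  continuous v /\
  exists2 dv, H1_with v dv &
    forall u du, H1_with u du ->
      energy mu eps alpha v dv <= energy mu eps alpha u du.

Definition hat v : R -> R := fun x => - v (- x).

Definition tanh (x : R) : R :=
  (expR x - expR (- x)) / (expR x + expR (- x)).

Definition alpha_ss mu (zeta : R) : R :=
  Num.sqrt 2 * (mu zeta `^ (3 / 2) + mu 0 `^ (3 / 2))
             / (mu zeta `^ (3 / 2) - mu 0 `^ (3 / 2)).

(* The joint limit eps -> 0, eps > 0, and alpha -> alpha0, on pairs
   (eps, alpha); alpha = alpha0 is allowed. *)
Definition regime (alpha0 : R) : set_system (R * R) :=
  filter_prod (0 : R)^'+ (nbhs alpha0).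

Definition cvg_C1loc {T : Type} (F : set_system T) (h : T -> R -> R) g : Prop :=
  [/\ is_C1 g, (\forall t \near F, is_C1 (h t)),
      {family compact, h @ F --> g} &
      {family compact, (fun t => derive1 (h t)) @ F --> derive1 g}].

Definition rescale eps (y : R) v : R -> R := fun s => v (y + s * eps).

Definition kink mu (i : nat) (l : R) : R -> R :=
  fun s => (-1) ^+ i.+1 * (Num.sqrt (mu l) * tanh (s * Num.sqrt (mu l / 2))).

(* The i-th zero x_i(eps, alpha) converges to l, and v_{eps,alpha}, blown up at
   it, converges to the i-th kink. *)
Definition zero_limit mu (alpha0 : R) (v : R -> R -> R -> R) (i : nat)
    (x : R -> R -> R) (l : R) : Prop :=
  x p.1 p.2 @[p --> regime alpha0] --> l /\
  cvg_C1loc (regime alpha0)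
    (fun p => rescale p.1 (x p.1 p.2) (v p.1 p.2)) (kink mu i l).

Definition blowup_limit (alpha0 : R) (v : R -> R -> R -> R) (x0 c : R) : Prop :=
  cvg_C1loc (regime alpha0) (fun p => rescale p.1 x0 (v p.1 p.2)) (cst c).

End Definitions.

(* Main.v *)
(* Write f = -mu'/2, rho = sqrt mu and M = rho^3, so that M' = -3 f rho, and add mu^2 / (4 eps) to the
   integrand of E, which becomes the Modica-Mortola density eps v'^2 / 2 + (v^2 - mu)^2 / (4 eps) - alpha f v.
   A minimizer v is C^2, solves the Euler-Lagrange equation and minimizes the energy among
   competitors with the same values at the ends of an interval.  Moreover f v < 0 is impossible on an
   interval bounded by zeros of v (or by one zero and infinity), since replacing v by -v there would
   lower the energy.

   Fix b < xi with mu(b) small.  Explicit tanh competitors bound the energy on [-b, b] from above by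
   (2/3)(sqrt 2 - alpha) M(y), for any y, and by (2/3)(2(sqrt 2 - alpha) M(zeta) + (sqrt 2 + alpha) M(0)).
   These bounds make H = eps^2 v'^2 / 2 - (mu - v^2)^2 / 4 uniformly small on [-b, b], so all zeros
   there are transversal, and the sign rule leaves only two patterns: one zero, at which v increases,
   or three zeros y1 < y2 < y3 with |y2| < zeta.  Calibrating by (mu v - v^3 / 3) / sqrt 2 on each piece gives
   the lower bounds (2/3)(sqrt 2 - alpha) M(y) and
   (2/3)((sqrt 2 - alpha)(M(y1) + M(y3)) + (sqrt 2 + alpha) M(y2)), up to small errors.  Since M is even,
   with its maximum at zeta and a strict local minimum at 0, comparing the bounds selects the pattern and
   locates the zeros in each of the three ranges of alpha.

   Away from the zeros, where mu > 0, smallness of H forces v to be close to rho or -rho, since otherwise v would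
   reach 0 or become large within distance O(eps).  At a zero, H gives the initial slope and Gronwall's
   lemma compares v with the kink.  Where mu <= 0, a barrier shows that v tends to 0. *)

Require Import Defs.
From mathcomp Require Import ring lra measurable_realfun ess_sup_inf.

Set Implicit Arguments.
Unset Strict Implicit.
Unset Printing Implicit Defensive.

Local Open Scope ring_scope.
Local Open Scope classical_set_scope.

(** * Differential calculus of functions of one real variable *)

Section Calculus.
Context {R : realType}.
Implicit Types (f g F G dF dG : R -> R) (x y a b c d e k p q df dg : R).

(** On a piece where v is close to s rho with s = 1 or s = -1, M' = -3 f rho makes -alpha f v the
    exact derivative alpha s M' / 3. The forcing is thus felt only at transitions: an upward one at
    y costs (2/3)(sqrt 2 - alpha) M(y), a downward one (2/3)(sqrt 2 + alpha) M(y). Upward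
    transitions become profitable at alpha = sqrt 2, and passing from one zero to three adds at best
    (2/3)((sqrt 2 - alpha) M(zeta) + (sqrt 2 + alpha) M(0)), which vanishes exactly at alpha**. The
    obstacle is the edge: rho is not smooth where mu vanishes, so neither competitors nor
    calibration reach xi. Cutting at b with mu(b) < th^2 costs O(th), a tolerance fixed before eps.
    A zero beyond b is invisible to the energy and is located through the signs of v near -xi and
    xi. All thresholds on eps are uniform over the minimizers and over alpha near alpha0, as a joint
    limit requires; filters then enter only at the very end. *)

Lemma sign_norm (s : R) : s ^+ 2 = 1 -> `|s| = 1.
Proof. by move=> ss; apply/eqP; rewrite -(@eqrXn2 _ 2) // ?normr_ge0 // real_normK ?num_real // ss expr1n. Qed.

Lemma is_derive_cst1 (c x : R) : is_derive x 1 (fun _ : R => c) 0.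
Proof. exact: is_derive_cst. Qed.

Lemma is_derive_id1 (x : R) : is_derive x 1 (fun y : R => y) 1.
Proof. exact: is_derive_id. Qed.

Lemma is_derive_add f g x df dg : is_derive x 1 f df -> is_derive x 1 g dg ->
  is_derive x 1 (fun y => f y + g y) (df + dg).
Proof. exact: is_deriveD. Qed.

Lemma is_derive_opp f x df : is_derive x 1 f df ->
  is_derive x 1 (fun y => - f y) (- df).
Proof. exact: is_deriveN. Qed.

Lemma is_derive_mul f g x df dg : is_derive x 1 f df -> is_derive x 1 g dg ->
  is_derive x 1 (fun y => f y * g y) (f x * dg + g x * df).
Proof. exact: is_deriveM. Qed.

Lemma is_derive_exp f n x df : is_derive x 1 f df ->
  is_derive x 1 (fun y => f y ^+ n) (n%:R * f x ^+ n.-1 * df).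
Proof.
move=> H; elim: n => [|n IH].
  by rewrite !mul0r; under eq_fun do rewrite expr0; exact: is_derive_cst1.
under eq_fun do rewrite exprS.
apply: is_derive_eq (is_derive_mul H IH) _ => /=.
by case: n {IH} => [|n]; rewrite /= ?mul0r ?mulr0 ?add0r ?expr0 ?mul1r // -[n.+2%:R]natr1 exprS; ring.
Qed.

Lemma is_derive_comp1 f g x df dg : is_derive (g x) 1 f df -> is_derive x 1 g dg ->
  is_derive x 1 (fun y => f (g y)) (df * dg).
Proof. by move=> hf hg; have := @is_derive1_comp R f g x _ _ hf hg. Qed.

Lemma is_derive_exp1 f x df : is_derive x 1 f df ->
  is_derive x 1 (fun y => expR (f y)) (expR (f x) * df).
Proof. by move=> H; apply: is_derive_comp1; exact: is_derive_expR. Qed.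

Lemma is_derive_inv f x df : f x != 0 -> is_derive x 1 f df ->
  is_derive x 1 (fun y => (f y)^-1) (- (f x) ^- 2 * df).
Proof. exact: is_deriveV. Qed.

Lemma is_derive_cvg f x df : is_derive x 1 f df -> {for x, continuous f}.
Proof. by move=> H; apply/differentiable_continuous/derivable1_diffP. Qed.

Lemma cts_cst c x : continuous_at x (fun _ : R => c).
Proof. exact: cst_continuous. Qed.

Lemma cts_id x : continuous_at x (fun y : R => y).
Proof. exact: is_derive_cvg (is_derive_id1 x). Qed.

Lemma cts_add f g x : continuous_at x f -> continuous_at x g ->
  continuous_at x (fun y => f y + g y).
Proof. exact: continuousD. Qed.

Lemma cts_opp f x : continuous_at x f -> continuous_at x (fun y => - f y).
Proof. exact: continuousN. Qed.

Lemma cts_mul f g x : continuous_at x f -> continuous_at x g ->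
  continuous_at x (fun y => f y * g y).
Proof. exact: continuousM. Qed.

Lemma cts_exp f n x : continuous_at x f -> continuous_at x (fun y => f y ^+ n).
Proof.
move=> cf; elim: n => [|n IH]; first exact: cts_cst.
rewrite (_ : (fun y => f y ^+ n.+1) = (fun y => f y * f y ^+ n)); first exact: cts_mul.
by apply/funext => y; rewrite exprS.
Qed.

Lemma cts_comp f g x : continuous_at x g -> continuous_at (g x) f ->
  continuous_at x (fun y => f (g y)).
Proof. exact: continuous_comp. Qed.

Lemma cts_norm f x : continuous_at x f -> continuous_at x (fun y => `|f y|).
Proof. by move=> cf; apply: cts_comp cf _; exact: norm_continuous. Qed.

Lemma is_derive_derive1 f dF : (forall x, is_derive x 1 f (dF x)) -> derive1 f = dF.
Proof. by move=> H; apply/funext => x; rewrite derive1E; have [_ ->] := H x. Qed.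

Lemma derivable_is_derive f x : derivable f x 1 -> is_derive x 1 f (derive1 f x).
Proof. by move=> H; rewrite derive1E; apply/derivableP. Qed.

Lemma continuous_within f a b : (forall x, a <= x <= b -> {for x, continuous f}) ->
  {within `[a, b], continuous f}.
Proof.
move=> H; apply/continuous_in_subspaceT => x /set_mem /=.
by rewrite in_itv /=; exact: H.
Qed.

Lemma mvt f dF a b : a < b -> (forall x, a <= x <= b -> is_derive x 1 f (dF x)) ->
  exists2 c : R, a < c < b & f b - f a = dF c * (b - a).
Proof.
move=> ab H; have [|x /itvP h||c ci e] := @MVT R f dF a b.
- by [].
- by apply: H; rewrite !h.
- by apply: continuous_within => x hx; exact: is_derive_cvg (H x hx).
by exists c => //; move: ci; rewrite in_itv.
Qed.

Lemma mvt_le f dF a b : a <= b -> (forall x, a <= x <= b -> is_derive x 1 f (dF x)) ->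
  exists2 c : R, a <= c <= b & f b - f a = dF c * (b - a).
Proof.
rewrite le_eqVlt => /predU1P[-> H|ab H]; first by exists b; rewrite ?lexx ?subrr ?mulr0.
by have [c /andP[c1 c2] e] := mvt ab H; exists c => //; rewrite !ltW.
Qed.

Lemma derive_le_le F G dF dG a b : a <= b ->
  (forall x, a <= x <= b -> is_derive x 1 F (dF x)) ->
  (forall x, a <= x <= b -> is_derive x 1 G (dG x)) ->
  (forall x, a <= x <= b -> dF x <= dG x) -> F b - F a <= G b - G a.
Proof.
move=> ab hF hG h.
have [c hc e] : exists2 c : R, a <= c <= b & (G b - F b) - (G a - F a) = (dG c - dF c) * (b - a).
  apply: (@mvt_le (fun x => G x - F x) (fun x => dG x - dF x)) => // x hx.
  by apply: is_derive_add; [exact: hG|apply: is_derive_opp; exact: hF].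
have : 0 <= (dG c - dF c) * (b - a) by apply: mulr_ge0; rewrite subr_ge0 ?h.
by rewrite -e; lra.
Qed.

Lemma derive_cst_le F dF a b k : a <= b ->
  (forall x, a <= x <= b -> is_derive x 1 F (dF x)) ->
  (forall x, a <= x <= b -> dF x <= k) -> F b - F a <= k * (b - a).
Proof.
move=> ab hF h; have [c hc ->] := mvt_le ab hF.
by rewrite ler_wpM2r ?subr_ge0 ?h.
Qed.

Lemma derive_cst_ge F dF a b k : a <= b ->
  (forall x, a <= x <= b -> is_derive x 1 F (dF x)) ->
  (forall x, a <= x <= b -> k <= dF x) -> k * (b - a) <= F b - F a.
Proof.
move=> ab hF h; have [c hc ->] := mvt_le ab hF.
by rewrite ler_wpM2r ?subr_ge0 ?h.
Qed.

Lemma derive_local_max f df x d : 0 < d -> is_derive x 1 f df ->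
  (forall y, `|y - x| < d -> derivable f y 1) ->
  (forall y, `|y - x| < d -> f y <= f x) -> df = 0.
Proof.
move=> d0 hf hd hm.
have := @derive1_at_max R f (x - d) (x + d) x.
have ab : x - d <= x + d by lra.
move=> /(_ ab); case.
- by move=> t; rewrite in_itv /= => /andP[t1 t2]; apply: hd; rewrite ltr_norml; apply/andP; split; lra.
- by rewrite in_itv /=; apply/andP; split; lra.
- by move=> t; rewrite in_itv /= => /andP[t1 t2]; apply: hm; rewrite ltr_norml; apply/andP; split; lra.
by move=> _; case: hf => _ ->.
Qed.

(** Only comparisons with the value at x hold: a derivative at a single point gives no monotonicity
    around it. *)
Lemma derive_pos_near f x df : is_derive x 1 f df -> 0 < df ->
  exists2 d : R, 0 < d & forall y, `|y - x| < d ->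
    (x < y -> f x < f y) /\ (y < x -> f y < f x).
Proof.
move=> [hd he] dp.
have : (fun h => h^-1 *: (f (h + x) - f x)) @ 0^' --> df.
  have := hd; rewrite /derivable => /cvg_ex [l hl].
  have -> : df = l.
    rewrite -he /derive; apply/cvg_lim => //.
  move: hl; apply: cvg_trans; apply: near_eq_cvg; near=> h => /=.
  by rewrite /= [h *: 1]mulr1.
move/cvgrPdist_lt => /(_ _ dp); rewrite near_withinE /= => /nbhs_normP [d /= d0 hd'].
exists d => // y yd.
have K : y != x -> 0 < (y - x)^-1 * (f y - f x).
  move=> yx; have := hd' (y - x); rewrite /= sub0r normrN subr_eq0 subrK => /(_ yd yx).
  by move=> /ltr_normlW; rewrite /GRing.scale /=; lra.
split=> xy.
  have := K; rewrite gt_eqF // pmulr_rgt0 ?invr_gt0 ?subr_gt0 //; exact.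
have := K; rewrite lt_eqF // nmulr_rgt0 ?invr_lt0 ?subr_lt0 //; exact.
Unshelve. all: by end_near. Qed.

Lemma continuous_bounded f a b : continuous f ->
  exists2 M : R, 0 < M & forall x, a <= x <= b -> `|f x| <= M.
Proof.
move=> cf; case: (leP a b) => ab; last first.
  by exists 1 => // x hx; lra.
have [c _ hc] := @EVT_max R (fun x => `|f x|) a b ab (continuous_subspaceT (fun x => continuous_comp (cf x) (@norm_continuous _ R (f x)))).
exists (`|f c| + 1); first by have := normr_ge0 (f c); lra.
by move=> x hx; have := hc x; rewrite in_itv /= hx => /(_ isT); lra.
Qed.

Lemma continuous_near f x e : {for x, continuous f} -> 0 < e ->
  exists2 d : R, 0 < d & forall y, `|y - x| < d -> `|f y - f x| < e.
Proof.
move=> /cvgrPdist_lt cf e0; have /nbhs_normP [d /= d0 hd] := cf _ e0.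
by exists d => // y hy; rewrite distrC; apply: hd; rewrite /= distrC.
Qed.

Lemma first_zero f p q : p < q -> continuous f -> 0 < f p -> f q <= 0 ->
  exists z, [/\ p < z <= q, f z = 0 & forall x, p <= x < z -> 0 < f x].
Proof.
move=> pq cf fp fq.
(* The supremum of the points up to which f has stayed positive is the first zero. *)
pose S := [set x | p <= x /\ forall y, p <= y <= x -> 0 < f y].
have Sp : S p by split=> // y hy; have -> : y = p by lra.
have Sub : ubound S q.
  move=> x [px hx]; rewrite leNgt; apply/negP => qx.
  by have := hx q; rewrite (ltW pq) (ltW qx) => /(_ isT); lra.
have supS : has_sup S by split; [exists p|exists q].
pose z := sup S.
have pz : p <= z by apply: sup_upper_bound.
have zq : z <= q by apply: sup_le_ub => //; exists p.
have pos x : p <= x < z -> 0 < f x.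
  move=> /andP[px xz]; have [s [ps hs] xs] := @sup_adherent R S (z - x) ltac:(lra) supS.
  by apply: hs; rewrite -/z in xs; lra.
have z0 : f z = 0.
  have [fz|fz|//] := ltgtP (f z) 0.
    have [d d0 hd] := continuous_near (cf z) (e := - f z) ltac:(lra).
    have pz' : p < z by rewrite lt_neqAle pz andbT; apply/negP => /eqP e; move: fp fz; rewrite e; lra.
    pose y := Num.max p (z - d / 2).
    have yz : y < z by rewrite /y gt_max pz' /=; lra.
    have py : p <= y by rewrite /y le_max lexx.
    have := pos y; rewrite py yz => /(_ isT).
    have : z - d / 2 <= y by rewrite /y le_max lexx orbT.
    move=> yd; have := hd y; rewrite ltr_norml => /(_ ltac:(lra)).
    by move=> /ltr_normlP [h1 h2]; lra.
  have [d d0 hd] := continuous_near (cf z) fz.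
  have : S (z + d / 2).
    split; first lra.
    move=> y /andP[py yd]; have [yz|yz] := ltP y z; first by apply: pos; lra.
    by have := hd y; rewrite ltr_norml => /(_ ltac:(lra)) /ltr_normlP [h1 h2]; lra.
  by move/(sup_upper_bound supS); rewrite -/z; lra.
exists z; split=> //.
rewrite zq andbT lt_neqAle pz andbT; apply/negP => /eqP e; move: fp; rewrite e; lra.
Qed.

Lemma last_zero f p q : p < q -> continuous f -> 0 < f q -> f p <= 0 ->
  exists z, [/\ p <= z < q, f z = 0 & forall x, z < x <= q -> 0 < f x].
Proof.
move=> pq cf fq fp.
have [||||z [h1 h2 h3]] := @first_zero (fun x => f (- x)) (- q) (- p).
- lra.
- move=> x; apply: (@continuous_comp _ _ _ -%R f); last exact: cf.
  exact: is_derive_cvg (is_derive_opp (is_derive_id1 x)).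
- by rewrite opprK.
- by rewrite opprK.
exists (- z); split=> //; first lra.
by move=> x hx; have := h3 (- x); rewrite opprK; apply; lra.
Qed.

Lemma ivt f p q : p <= q -> continuous f -> f p <= 0 <= f q ->
  exists2 z : R, p <= z <= q & f z = 0.
Proof.
move=> pq cf /andP[h1 h2].
have [||c] := @IVT R f p q 0 pq.
- exact: continuous_subspaceT.
- by rewrite ge_min le_max h1 h2 orbT.
by rewrite in_itv /=; exists c.
Qed.

(** Primitives on the intervals ]-n, n[ are glued; normalising them to vanish at 0 makes any two
    agree on their common domain. *)
Lemma antiderivative g : continuous g -> exists F, forall x, is_derive x 1 F (g x).
Proof.
move=> cg.
have loc n : {F | forall x, - n%:R < x < n%:R -> is_derive x 1 F (g x)}.
  exists (fun x => \int[lebesgue_measure]_(t in `[(- n%:R), x]) g t) => x /andP[h1 h2].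
  have [||||d e] := @continuous_FTC1_closed R g (- n%:R) x n%:R.
  - by [].
  - apply: continuous_compact_integrable; first exact: segment_compact.
    exact: continuous_subspaceT.
  - by [].
  - exact: cg.
  by rewrite -e; exact: derivable_is_derive.
pose F n x := sval (loc n) x - sval (loc n) 0.
have FE n m x : - n%:R < x < n%:R -> (n <= m)%N -> F n x = F m x.
  move=> hx nm; have nm' : n%:R <= m%:R :> R by rewrite ler_nat.
  have D (t : R) : `|t| <= `|x| -> is_derive t (1 : R) (fun y => sval (loc n) y - sval (loc m) y) 0.
    move=> tx; have xn : `|x| < n%:R by rewrite ltr_norml.
    have : `|t| < n%:R by lra.
    rewrite ltr_norml => htn.
    rewrite -(subrr (g t)); apply: is_derive_add; first by apply: (svalP (loc n)).
    by apply: is_derive_opp; apply: (svalP (loc m)); lra.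
  rewrite /F; have [x0|x0] := leP 0 x.
    have [t ht|c _] := @mvt_le (fun y => sval (loc n) y - sval (loc m) y) (fun=> 0) 0 x x0.
      by apply: D; rewrite !ger0_norm //; lra.
    by rewrite mul0r; lra.
  have [t ht|c _] := @mvt_le (fun y => sval (loc n) y - sval (loc m) y) (fun=> 0) x 0 (ltW x0).
    by apply: D; rewrite !ler0_norm //; lra.
  by rewrite mul0r; lra.
(* The margin 1 leaves a neighbourhood of x inside ]-N x, N x[, where all the pieces involved
   agree. *)
pose N x := (Num.trunc (`|x| + 1)).+1.
have NP x : `|x| + 1 < (N x)%:R.
  by have := Num.Theory.truncnS_gt (`|x| + 1).
exists (fun x => F (N x) x) => x.
have H : is_derive x 1 (F (N x).+1) (g x).
  have K : is_derive x 1 (sval (loc (N x).+1) : R -> R) (g x).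
    apply: (svalP (loc _)); rewrite -ltr_norml; have := NP x.
    by rewrite -natr1; lra.
  exact: is_derive_eq (is_derive_add K (is_derive_cst1 (- sval (loc (N x).+1) 0) x)) (addr0 _).
apply: near_eq_is_derive H.
near=> y; rewrite /= (FE (N y) (maxn (N y) (N x).+1)) ?leq_maxl //; last first.
  by rewrite -ltr_norml; have := NP y; lra.
apply: FE; rewrite ?leq_maxr // -ltr_norml.
apply: (@lt_trans _ _ (`|x| + 1)); last by have := NP x; rewrite -natr1; lra.
have : `|y - x| < 1.
  near: y; apply/nbhs_normP; exists 1 => //= y; by rewrite /= distrC.
by have := ler_normD (y - x) x; rewrite subrK; lra.
Unshelve. all: by end_near. Qed.

End Calculus.

(** * Integrals over the line *)

Section Integration.
Context {R : realType}.
Implicit Types (f g h F dF u du phi dphi : R -> R) (a b c d e k p q x y C : R).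
Notation lam := (@lebesgue_measure R).

Definition integ g : Prop := lam.-integrable setT (EFin \o g).
Definition Int g : R := \int[lam]_x g x.
Definition msr g : Prop := measurable_fun setT (g : R -> R).

Lemma integ_msr g : integ g -> msr g.
Proof. by move=> /measurable_int /measurable_EFinP. Qed.

Lemma integ_le g h : msr g -> integ h -> (forall x, `|g x| <= h x) -> integ g.
Proof.
move=> mg ih gh; apply: (le_integrable measurableT _ _ ih).
  exact/measurable_EFinP.
by move=> x _ /=; rewrite lee_fin (le_trans (gh x)) // ler_norm.
Qed.

Lemma integD g h : integ g -> integ h -> integ (fun x => g x + h x).
Proof. by move=> ig ih; have := integrableD measurableT ig ih. Qed.

Lemma integB g h : integ g -> integ h -> integ (fun x => g x - h x).
Proof. by move=> ig ih; have := integrableB measurableT ig ih. Qed.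

Lemma integZ k g : integ g -> integ (fun x => k * g x).
Proof. by move=> ig; have := integrableZl measurableT k ig. Qed.

Lemma integ_norm g : integ g -> integ (fun x => `|g x|).
Proof. by move=> ig; have := integrable_norm ig. Qed.

Lemma IntD g h : integ g -> integ h -> Int (fun x => g x + h x) = Int g + Int h.
Proof. exact: RintegralD. Qed.

Lemma IntB g h : integ g -> integ h -> Int (fun x => g x - h x) = Int g - Int h.
Proof. exact: RintegralB. Qed.

Lemma IntZ k g : integ g -> Int (fun x => k * g x) = k * Int g.
Proof. exact: RintegralZl. Qed.

Lemma Int_le g h : integ g -> integ h -> (forall x, g x <= h x) -> Int g <= Int h.
Proof. by move=> ig ih gh; apply: le_Rintegral. Qed.

Lemma Int_ge0 g : (forall x, 0 <= g x) -> 0 <= Int g.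
Proof. by move=> g0; apply: Rintegral_ge0. Qed.

Lemma Int_norm g : integ g -> `|Int g| <= Int (fun x => `|g x|).
Proof. exact: le_normr_Rintegral. Qed.

Lemma msr_continuous g : continuous g -> msr g.
Proof. exact: continuous_measurable_fun. Qed.

Lemma msr_patch g (D : set R) : measurable D -> measurable_fun D g -> msr (g \_ D).
Proof. by move=> mD mg; apply/(measurable_restrictT g mD). Qed.

(** Half-open intervals ]p, q] are used for all restrictions, so that consecutive pieces tile
    without overlap. *)
Lemma msr_within g p q : (forall x, p <= x <= q -> {for x, continuous g}) ->
  msr (g \_ `]p, q]).
Proof.
move=> cg; apply: msr_patch => //.
apply: (@measurable_funS _ _ _ _ `[p, q]) => //; first exact: subset_itv_oc_cc.
apply: subspace_continuous_measurable_fun => //.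
exact: continuous_within.
Qed.

Lemma integ_bounded g p q C : msr g -> (forall x, `|g x| <= C) ->
  (forall x, ~~ (p < x <= q) -> g x = 0) -> integ g.
Proof.
move=> mg gC g0.
have -> : g = g \_ `]p, q].
  apply/funext => x; rewrite patchE; case: ifPn => //.
  by rewrite notin_setE /= in_itv /= => /negP; exact: g0.
rewrite /integ -restrict_EFin; apply/integrable_restrict => //.
rewrite setTI; apply: measurable_bounded_integrable => //.
- by rewrite -[X in (X < _)%E]/(lebesgue_measure `]p, q]%classic) lebesgue_measure_itv /=; case: ifPn => _; rewrite ?ltry // ltey.
- exact: measurable_funTS.
exists C; split; first exact: num_real.
by move=> M CM x _ /=; rewrite (le_trans (gC x)) // ltW.
Qed.

Lemma Int_patch g (D : set R) : Int (g \_ D) = \int[lam]_(x in D) g x.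
Proof. by rewrite /Int -Rintegral_mkcond. Qed.

Lemma ftc F dF p q : p < q ->
  (forall x, p <= x <= q -> is_derive x 1 F (dF x)) ->
  (forall x, p <= x <= q -> {for x, continuous dF}) ->
  Int (dF \_ `]p, q]) = F q - F p.
Proof.
move=> pq hF cF; rewrite Int_patch.
have cw : {within `[p, q], continuous dF} by exact: continuous_within.
rewrite Rintegral_itv_obnd_cbnd; last first.
  have I : lam.-integrable `[p, q] (EFin \o dF).
    by apply: continuous_compact_integrable => //; exact: segment_compact.
  by apply: integrableS I => //; exact: subset_itv_oc_cc.
rewrite /Rintegral (@continuous_FTC2 _ dF F) //.
- split.
  + by move=> x /itvP h; have [] := hF x; rewrite ?h.
  + by apply: cvg_at_right_filter; apply: (is_derive_cvg (hF p _)); rewrite lexx ltW.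
  + by apply: cvg_at_left_filter; apply: (is_derive_cvg (hF q _)); rewrite lexx ltW.
- move=> x /itvP h; rewrite derive1E; have [] := hF x; by rewrite ?h.
Qed.

Lemma integ_within g p q : (forall x, p <= x <= q -> {for x, continuous g}) ->
  integ (g \_ `]p, q]).
Proof.
move=> cg; rewrite /integ -restrict_EFin; apply/integrable_restrict => //.
rewrite setTI.
have I : lam.-integrable `[p, q] (EFin \o g).
  by apply: continuous_compact_integrable; [exact: segment_compact|exact: continuous_within].
by apply: integrableS I => //; exact: subset_itv_oc_cc.
Qed.

Lemma by_parts u du phi dphi p q : p < q ->
  (forall x, p <= x <= q -> is_derive x 1 u (du x)) ->
  (forall x, p <= x <= q -> {for x, continuous du}) ->
  (forall x, p <= x <= q -> is_derive x 1 phi (dphi x)) ->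
  (forall x, p <= x <= q -> {for x, continuous dphi}) ->
  Int ((fun x => u x * dphi x) \_ `]p, q]) =
  u q * phi q - u p * phi p - Int ((fun x => du x * phi x) \_ `]p, q]).
Proof.
move=> pq hu cu hp cp.
have cu' x : p <= x <= q -> {for x, continuous u} by move=> /hu /is_derive_cvg.
have cp' x : p <= x <= q -> {for x, continuous phi} by move=> /hp /is_derive_cvg.
have c1 x : p <= x <= q -> {for x, continuous (fun x => u x * dphi x)}.
  by move=> hx; apply: continuousM; [exact: cu'|exact: cp].
have c2 x : p <= x <= q -> {for x, continuous (fun x => du x * phi x)}.
  by move=> hx; apply: continuousM; [exact: cu|exact: cp'].
have := @ftc (fun x => u x * phi x) (fun x => u x * dphi x + du x * phi x) p q pq.
rewrite (_ : _ \_ _ = (fun x => ((fun x => u x * dphi x) \_ `]p, q]) x +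
  ((fun x => du x * phi x) \_ `]p, q]) x)); last first.
  by apply/funext => x; rewrite !patchE; case: ifP => _; rewrite ?addr0.
rewrite IntD; [|exact: integ_within|exact: integ_within].
have D1 x : p <= x <= q ->
    is_derive x 1 (fun x => u x * phi x) (u x * dphi x + du x * phi x).
  by move=> hx; rewrite [du x * phi x]mulrC; exact: is_derive_mul (hu x hx) (hp x hx).
have D2 x : p <= x <= q -> {for x, continuous (fun x => u x * dphi x + du x * phi x)}.
  by move=> hx; apply: continuousD; [exact: c1|exact: c2].
by move=> /(_ D1 D2) <-; rewrite addrK.
Qed.

Lemma test_fun_intro phi p q : is_C1 phi ->
  (forall x, ~~ (p <= x <= q) -> phi x = 0) -> test_fun phi.
Proof.
move=> cphi p0; split=> //.
apply: (@subclosed_compact _ _ `[p, q]).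
- exact: closed_closure.
- exact: segment_compact.
have /closure_id -> : closed `[p, q]%classic by exact: itv_closed.
apply: closureS => x /= px; rewrite in_itv /=.
by apply: contraNT px => /p0 ->; rewrite eqxx.
Qed.

Lemma Lp2_integ u : Lp 2%:E u -> integ (fun x => u x ^+ 2).
Proof. exact: Lfun2_integrable_sqr. Qed.

Lemma Lp_msr (p : \bar R) u : Lp p u -> msr u.
Proof. by rewrite /Lp inE => /andP[]; rewrite inE. Qed.

Lemma Lp2_intro u : msr u -> integ (fun x => u x ^+ 2) -> Lp 2%:E u.
Proof.
move=> mu iu; rewrite /Lp inE; apply/andP; split; first by rewrite inE.
rewrite inE /= /finite_norm unlock poweR_lty //.
have /integrableP[_] := iu; apply: le_lt_trans.
apply: ge0_le_integral => //.
- by move=> x _; exact: poweR_ge0.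
- apply/measurable_EFinP.
  by apply/(@measurableT_comp _ _ _ _ _ _ (fun x : R => x `^ 2)%R) => //; exact/measurableT_comp.
- apply: measurableT_comp => //; apply/measurable_EFinP; exact: measurable_funX.
- by move=> t _/=; rewrite lee_fin normrX powR_mulrn.
Qed.

(** By continuity, a value above the essential bound would persist on a ball, which has positive
    measure. *)
Lemma Linf_bounded g : Lp +oo%E g -> continuous g -> exists C, forall x, `|g x| <= C.
Proof.
rewrite /Lp inE => /andP[_]; rewrite inE /= /finite_norm unlock.
(* The L^oo norm is defined by cases on whether the whole space has positive measure; the interval
   [0, 1] settles this. *)
case: ifPn => [_ hfin cg|]; last first.
  have : (lam `[0%R, 1%R]%classic <= lam setT)%E by apply: le_measure; rewrite ?inE.
  rewrite lebesgue_measure_itv /= lte_fin ltr01 oppr0 adde0 => h /negP[].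
  by apply: lt_le_trans h; rewrite lte_fin ltr01.
have [M aeM] : exists M, \forall x \ae lam, `|g x| <= M.
  have [M hM] := @ess_supr_bounded _ _ _ lam (fun x => `|g x|) hfin.
  by exists M.
exists M => x; rewrite leNgt; apply/negP => Mx.
have [d d0 hd] := @continuous_near R (fun y => `|g y|) x (`|g x| - M) (continuous_comp (cg x) (@norm_continuous _ R (g x))) ltac:(lra).
have [A [mA A0 hA]] := aeM.
have : (lam (ball x d) <= lam A)%E.
  apply: le_measure; rewrite ?inE //; first exact: measurable_ball.
  move=> y /= xy; apply: hA => /= yM.
  by have := hd y; rewrite distrC => /(_ xy) /ltr_normlP[]; lra.
rewrite A0 => h.
have := @lebesgue_measure_ball R x d (ltW d0) => hb.
have : (lebesgue_measure (ball x d) <= 0)%E by exact: h.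
by rewrite hb lee_fin leNgt pmulrn_lgt0 // d0.
Qed.

Lemma integ_pow43 g : Lp (4 / 3)%:E g -> integ (fun x => `|g x| `^ (4 / 3)).
Proof. by move=> h; apply: Lfun_integrable h; lra. Qed.

End Integration.

(** * Test functions with prescribed second differences *)

Section Kernel.
Context {R : realType}.
Implicit Types (f g h F dF u du phi dphi : R -> R) (a b c d e k p q x y C : R).

Lemma is_derive_shift1 f k x (df : R) : is_derive (x + k) 1 f df ->
  is_derive x 1 (fun y => f (y + k)) df.
Proof.
move=> H; have D := is_derive_add (is_derive_id1 x) (is_derive_cst1 k x).
by apply: is_derive_eq (@is_derive_comp1 _ f (fun y => y + k) x _ _ H D) _; rewrite addr0 mulr1.
Qed.

Lemma is_derive_sqabs x : is_derive x 1 (fun y : R => y * `|y|) (2 * `|x|).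
Proof.
have D (y : R) : is_derive y 1 (fun z : R => z ^+ 2) (2 * y).
  by have := is_derive_exp 2 (is_derive_id1 y); rewrite /= expr1 mulr1.
have [x0|x0|->] := ltgtP x 0.
- apply: (@near_eq_is_derive R R R (fun z => - z ^+ 2)).
    near=> z; rewrite ltr0_norm ?expr2 ?mulrN //.
    by near: z; exact: lt_nbhsl.
  by rewrite ltr0_norm // mulrN; apply: is_derive_opp.
- apply: (@near_eq_is_derive R R R (fun z => z ^+ 2)).
    near=> z; rewrite gtr0_norm ?expr2 //.
    by near: z; exact: lt_nbhsr.
  by rewrite gtr0_norm.
rewrite normr0 mulr0; apply/is_derive1_caratheodory.
exists (fun z : R => `|z|); split; last by rewrite normr0.
- by move=> z; rewrite normr0 mulr0 subr0 mulrC subr0.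
- exact: norm_continuous.
Unshelve. all: by end_near. Qed.

Lemma is_derive_cubeabs x : is_derive x 1 (fun y : R => y * (y * `|y|)) (3 * (x * `|x|)).
Proof.
apply: is_derive_eq (is_derive_mul (is_derive_id1 x) (is_derive_sqabs x)) _.
ring.
Qed.

(* C^2 mollification of |x|/2 *)
Definition ker2 d x : R := (`|x + d| - 2 * `|x| + `|x - d|) / (2 * d ^+ 2).
Definition ker1 d x : R :=
  ((x + d) * `|x + d| - 2 * (x * `|x|) + (x - d) * `|x - d|) / (4 * d ^+ 2).
Definition ker0 d x : R := ((x + d) * ((x + d) * `|x + d|) - 2 * (x * (x * `|x|))
  + (x - d) * ((x - d) * `|x - d|)) / (12 * d ^+ 2).

Lemma is_derive_ker1 d x : 0 < d -> is_derive x 1 (ker1 d) (ker2 d x).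
Proof.
move=> d0; rewrite /ker1.
apply: is_derive_eq (is_derive_mul (is_derive_add (is_derive_add
  (is_derive_shift1 (is_derive_sqabs (x + d)))
  (is_derive_opp (is_derive_mul (is_derive_cst1 2 x) (is_derive_sqabs x))))
  (is_derive_shift1 (is_derive_sqabs (x - d)))) (is_derive_cst1 _ x)) _.
by rewrite /ker2; field; rewrite gt_eqF.
Qed.

Lemma is_derive_ker0 d x : 0 < d -> is_derive x 1 (ker0 d) (ker1 d x).
Proof.
move=> d0; rewrite /ker0.
apply: is_derive_eq (is_derive_mul (is_derive_add (is_derive_add
  (is_derive_shift1 (is_derive_cubeabs (x + d)))
  (is_derive_opp (is_derive_mul (is_derive_cst1 2 x) (is_derive_cubeabs x))))
  (is_derive_shift1 (is_derive_cubeabs (x - d)))) (is_derive_cst1 _ x)) _.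
by rewrite /ker1; field; rewrite gt_eqF.
Qed.

Lemma continuous_ker2 d : continuous (ker2 d).
Proof.
move=> x; apply: cts_mul; last exact: cts_cst.
have cn k : {for x, continuous (fun y => `|y + k|)}.
  by apply/cts_norm/cts_add; [exact: cts_id|exact: cts_cst].
apply: cts_add; last exact: cn.
apply: cts_add; first exact: cn.
by apply/cts_opp/cts_mul; [exact: cts_cst|apply/cts_norm/cts_id].
Qed.

(** A second difference of the convex function |x|. The kernel is the tent of height 1 / d over
    [-d, d], of integral 1. *)
Lemma ker2_ge0 d x : 0 <= ker2 d x.
Proof.
rewrite /ker2; apply: divr_ge0; last by rewrite mulr_ge0 // sqr_ge0.
have := ler_normD (x + d) (x - d); rewrite (_ : x + d + (x - d) = 2 * x); last by ring.
by rewrite normrM ger0_norm //; lra.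
Qed.

(** Beyond d the mollification is exactly |x| / 2, so suitable combinations of translates cancel and
    become compactly supported. *)
Lemma ker_right d x : 0 < d -> d <= x ->
  [/\ ker2 d x = 0, ker1 d x = 2^-1 & ker0 d x = x / 2].
Proof.
move=> d0 dx; rewrite /ker0 /ker1 /ker2 !ger0_norm; try lra.
by split; field; rewrite gt_eqF.
Qed.

Lemma ker_left d x : 0 < d -> x <= - d ->
  [/\ ker2 d x = 0, ker1 d x = - 2^-1 & ker0 d x = - x / 2].
Proof.
move=> d0 dx; rewrite /ker0 /ker1 /ker2 !ler0_norm; try lra.
by split; field; rewrite gt_eqF.
Qed.

Lemma ker1_mono d x y : 0 < d -> x <= y -> ker1 d x <= ker1 d y.
Proof.
move=> d0 xy; rewrite -subr_ge0 -(mul0r (y - x)).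
by apply: (@derive_cst_ge _ (ker1 d) (ker2 d)) => // z _; [exact: is_derive_ker1|exact: ker2_ge0].
Qed.

Lemma ker1_bound d x : 0 < d -> - 2^-1 <= ker1 d x <= 2^-1.
Proof.
move=> d0; apply/andP; split.
  have [] := @ker_left d (- d - `|x|) d0; first by have := normr_ge0 x; lra.
  by move=> _ <- _; apply: ker1_mono => //; have := ler_norm (- x); rewrite normrN; lra.
have [] := @ker_right d (d + `|x|) d0; first by have := normr_ge0 x; lra.
by move=> _ <- _; apply: ker1_mono => //; have := ler_norm x; lra.
Qed.

Lemma ker2_out d x y : 0 < d -> ~~ (y - d < x <= y + d) -> ker2 d (x - y) = 0.
Proof.
move=> d0; rewrite negb_and -!leNgt -!ltNge => /orP[h|h].
  by have [] := @ker_left d (x - y) d0; first lra.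
by have [] := @ker_right d (x - y) d0; first lra.
Qed.

Lemma continuous_shift f k : continuous f -> continuous (fun x => f (x - k)).
Proof.
move=> cf x; apply: (@cts_comp _ f (fun y => y - k)); last exact: cf.
by apply: cts_add; [exact: cts_id|exact: cts_cst].
Qed.

Lemma integ_ker2 h d y : continuous h -> 0 < d -> integ (fun x => h x * ker2 d (x - y)).
Proof.
move=> ch d0.
have -> : (fun x => h x * ker2 d (x - y)) = (fun x => h x * ker2 d (x - y)) \_ `]y - d, y + d].
  apply/funext => x; rewrite patchE; case: ifPn => //.
  rewrite notin_setE /= in_itv /= => /negP hx; by rewrite ker2_out ?mulr0.
apply: integ_within => x _; apply: continuousM; first exact: ch.
exact/continuous_shift/continuous_ker2.
Qed.

Lemma Int_ker2 d y : 0 < d -> Int (fun x => ker2 d (x - y)) = 1.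
Proof.
move=> d0.
have -> : (fun x => ker2 d (x - y)) = (fun x => ker2 d (x - y)) \_ `]y - d, y + d].
  apply/funext => x; rewrite patchE; case: ifPn => //.
  rewrite notin_setE /= in_itv /= => /negP hx; by rewrite ker2_out.
have -> : Int ((fun x => ker2 d (x - y)) \_ `]y - d, y + d]) =
    ker1 d (y + d - y) - ker1 d (y - d - y).
  have D x : y - d <= x <= y + d -> is_derive x 1 (fun x => ker1 d (x - y)) (ker2 d (x - y)).
    by move=> _; apply: is_derive_shift1; exact: is_derive_ker1.
  apply: (@ftc _ _ _ _ _ _ D); first lra.
  - by move=> x _; exact/continuous_shift/continuous_ker2.
have [|_ -> _] := @ker_right d (y + d - y) d0; first lra.
have [|_ -> _] := @ker_left d (y - d - y) d0; first lra.
by field.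
Qed.

Lemma ker2_avg h d y e : continuous h -> 0 < d ->
  (forall x, `|x - y| <= d -> `|h x - h y| <= e) ->
  `|Int (fun x => h x * ker2 d (x - y)) - h y| <= e.
Proof.
move=> ch d0 hd.
have i1 := @integ_ker2 (fun=> 1) d y (fun x => @cst_continuous _ _ _ x) d0.
have {}i1 : integ (fun x => ker2 d (x - y)).
  by move: i1; rewrite (_ : (fun x => 1 * ker2 d (x - y)) = (fun x => ker2 d (x - y))) //; apply/funext => x; rewrite mul1r.
have -> : h y = Int (fun x => h y * ker2 d (x - y)) by rewrite IntZ // Int_ker2 // mulr1.
rewrite -IntB; [|exact: integ_ker2|exact: integZ].
apply: le_trans (Int_norm _) _.
  by apply: integB; [exact: integ_ker2|exact: integZ].
have -> : e = Int (fun x => e * ker2 d (x - y)) by rewrite IntZ // Int_ker2 // mulr1.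
apply: Int_le.
- by apply/integ_norm/integB; [exact: integ_ker2|exact: integZ].
- exact: integZ.
move=> x; rewrite -mulrBl normrM (ger0_norm (ker2_ge0 _ _)).
have [xy|xy] := leP `|x - y| d; first by rewrite ler_wpM2r ?ker2_ge0 ?hd.
rewrite ker2_out ?mulr0 //; apply/negP => hx; move: xy; rewrite ltNge => /negP; apply.
by rewrite ler_norml; apply/andP; split; lra.
Qed.

Lemma ker2_avg_small h y e : continuous h -> 0 < e -> exists2 d0 : R, 0 < d0 &
  forall d, 0 < d -> d < d0 -> `|Int (fun x => h x * ker2 d (x - y)) - h y| <= e.
Proof.
move=> ch e0; have [d0 d00 hd] := continuous_near (ch y) e0.
exists d0 => // d dp dd; apply: ker2_avg => // x xd.
by rewrite ltW // hd // (le_lt_trans xd).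
Qed.

(** A difference of two translates of [ker1] is a test function with values in [-1, 1] whose
    derivative is a difference of two approximate Dirac masses at a and c. The weak derivative turns
    u a - u c into an integral of du, and |du| <= (du^2 + 1) / 2 on a support of length at most
    3. *)
Lemma weak_osc u du : continuous u -> weak_derivative u du -> msr du ->
  integ (fun x => du x ^+ 2) -> forall a c, a < c -> c <= a + 1 ->
  `|u a - u c| <= (Int (fun x => du x ^+ 2) + 3) / 2.
Proof.
move=> cu wd md idu a c ac ca; apply/ler_addgt0Pr => e e0.
have [d1 d10 h1] := @ker2_avg_small u a (e / 2) cu ltac:(lra).
have [d2 d20 h2] := @ker2_avg_small u c (e / 2) cu ltac:(lra).
pose d := Num.min 1 (Num.min (d1 / 2) (d2 / 2)).
have d0 : 0 < d by rewrite !lt_min; apply/and3P; split; lra.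
have dd1 : d < d1.
  by apply: (@le_lt_trans _ _ (d1 / 2)); [rewrite !ge_min lexx orbT|lra].
have dd2 : d < d2.
  by apply: (@le_lt_trans _ _ (d2 / 2)); [rewrite !ge_min lexx !orbT|lra].
have dl1 : d <= 1 by rewrite ge_min lexx.
have {h1}h1 := h1 d d0 dd1; have {h2}h2 := h2 d d0 dd2.
pose phi x := ker1 d (x - a) - ker1 d (x - c).
pose dphi x := ker2 d (x - a) - ker2 d (x - c).
have Dphi x : is_derive x 1 phi (dphi x).
  by apply: is_derive_add; [|apply: is_derive_opp]; apply: is_derive_shift1; exact: is_derive_ker1.
have cphi : continuous phi by move=> x; exact: is_derive_cvg (Dphi x).
have phi0 x : ~~ (a - d < x <= c + d) -> phi x = 0.
  rewrite negb_and -!leNgt -!ltNge => /orP[h|h]; rewrite /phi.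
    have [|_ -> _] := @ker_left d (x - a) d0; first lra.
    by have [|_ -> _] := @ker_left d (x - c) d0; [lra|rewrite subrr].
  have [|_ -> _] := @ker_right d (x - a) d0; first lra.
  by have [|_ -> _] := @ker_right d (x - c) d0; [lra|rewrite subrr].
have tphi : test_fun phi.
  apply: (@test_fun_intro _ phi (a - d) (c + d)).
    split; first by move=> x; have [] := Dphi x.
    rewrite (is_derive_derive1 Dphi) => x.
    by apply: cts_add; [|apply: cts_opp]; exact/continuous_shift/continuous_ker2.
  by move=> x hx; apply: phi0; apply: contra hx => /andP[h3 h4]; apply/andP; split; lra.
have := wd _ tphi; rewrite (is_derive_derive1 Dphi) -/(Int _) -/(Int _).
have -> : (fun x => u x * dphi x) = (fun x => u x * ker2 d (x - a) - u x * ker2 d (x - c)).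
  by apply/funext => x; rewrite mulrBr.
rewrite IntB; [|exact: integ_ker2|exact: integ_ker2].
have phib x : `|phi x| <= 1.
  have /andP[b1 b2] := ker1_bound (x - a) d0; have /andP[b3 b4] := ker1_bound (x - c) d0.
  by rewrite /phi ler_norml; apply/andP; split; lra.
pose one := (fun _ : R => 1 : R) \_ `]a - d, c + d].
have ione : integ one by apply: integ_within => x _; exact: cst_continuous.
have Ione : Int one = c - a + 2 * d.
  have -> : Int one = (c + d) - (a - d).
    by apply: (@ftc _ (fun x => x)); [lra|move=> x _; exact: cts_cst].
  by ring.
have bound x : `|du x * phi x| <= 2^-1 * (du x ^+ 2 + one x).
  rewrite /one patchE; case: ifPn => [_|].
    rewrite normrM; apply: (@le_trans _ _ `|du x|); first by rewrite ler_piMr.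
    have := sqr_ge0 (`|du x| - 1); rewrite -(real_normK (num_real (du x))).
    by rewrite sqrrB1; lra.
  rewrite notin_setE /= in_itv /= => /negP /phi0 ->; rewrite mulr0 normr0.
  by apply: mulr_ge0 => //; apply: addr_ge0; [exact: sqr_ge0|exact: lexx].
have ib : integ (fun x => 2^-1 * (du x ^+ 2 + one x)) by apply: integZ; exact: integD.
have idp : integ (fun x => du x * phi x).
  apply: integ_le ib bound; apply: measurable_funM => //; exact: msr_continuous.
have B : `|Int (fun x => du x * phi x)| <= (Int (fun x => du x ^+ 2) + 3) / 2.
  apply: le_trans (Int_norm idp) _.
  apply: (@le_trans _ _ (Int (fun x => 2^-1 * (du x ^+ 2 + one x)))).
    by apply: Int_le => //; exact: integ_norm.
  rewrite IntZ; last exact: integD.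
  by rewrite IntD // Ione; lra.
move: h1 h2 B; set A1 := Int _; set A2 := Int _; set A3 := Int (fun x => _ * phi x).
move=> /ler_normlP[h1 h1'] /ler_normlP[h2 h2'] /ler_normlP[h3 h3'] E.
by rewrite ler_norml; apply/andP; split; lra.
Qed.

(** A large value at a would, by the oscillation bound, keep |u| above 1 + I on ]a, a + 1], and the
    integral of u^2 would exceed I. *)
Lemma weak_bounded u du : continuous u -> weak_derivative u du -> msr du ->
  integ (fun x => u x ^+ 2) -> integ (fun x => du x ^+ 2) ->
  exists C, forall x, `|u x| <= C.
Proof.
move=> cu wd md iu idu.
have osc := weak_osc cu wd md idu; set D := (_ / 2) in osc.
pose I := Int (fun x => u x ^+ 2).
have I0 : 0 <= I by apply: Int_ge0 => x; exact: sqr_ge0.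
exists (D + 1 + I) => a; rewrite leNgt; apply/negP => ha.
pose g := (fun _ : R => 1 + I) \_ `]a, a + 1].
have ig : integ g by apply: integ_within => x _; exact: cst_continuous.
have : Int g <= I.
  apply: Int_le => // x; rewrite /g patchE; case: ifPn => [|_]; last exact: sqr_ge0.
  rewrite inE /= in_itv /= => /andP[ax xa].
  have := osc a x ax xa; have := ler_normD (u a - u x) (u x); rewrite subrK => t1 t2.
  by rewrite -(real_normK (num_real (u x))); nra.
have -> : Int g = (1 + I) * (a + 1) - (1 + I) * a.
  apply: (@ftc _ (fun x => (1 + I) * x)); first lra.
  - move=> x _; apply: is_derive_eq (is_derive_mul (is_derive_cst1 _ x) (is_derive_id1 x)) _.
    by rewrite mulr1 mulr0 addr0.
  - by move=> x _; exact: cst_continuous.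
lra.
Qed.

(** A second-order du Bois-Reymond lemma: testing against a mollified three-point second difference
    shows that any three points of the graph are aligned. *)
Lemma affine_of_weak h : continuous h ->
  (forall phi dphi ddphi, (forall x, is_derive x 1 phi (dphi x)) ->
     (forall x, is_derive x 1 dphi (ddphi x : R)) -> continuous ddphi ->
     (exists p q, forall x, ~~ (p <= x <= q) -> phi x = 0 /\ dphi x = 0) ->
     Int (fun x => h x * ddphi x) = 0) ->
  exists m b, forall x, h x = m * x + b.
Proof.
move=> ch H.
have T a y c : a < y -> y < c -> (c - y) * h a + (y - a) * h c = (c - a) * h y.
  move=> ay yc; apply/eqP; rewrite -subr_eq0 -normr_le0.
  apply/ler_addgt0Pr => e0 e00; rewrite add0r.
  (* The three weights c - y, c - a and y - a add up to 2 (c - a). *)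
  pose e := e0 / (2 * (c - a)).
  have ep : 0 < e by rewrite divr_gt0 //; lra.
  have [d1 d10 h1] := ker2_avg_small a ch ep.
  have [d2 d20 h2] := ker2_avg_small y ch ep.
  have [d3 d30 h3] := ker2_avg_small c ch ep.
  pose d := Num.min (d1 / 2) (Num.min (d2 / 2) (d3 / 2)).
  have d0 : 0 < d by rewrite !lt_min; apply/and3P; split; lra.
  have dd1 : d < d1 by apply: (@le_lt_trans _ _ (d1 / 2)); [rewrite !ge_min lexx|lra].
  have dd2 : d < d2 by apply: (@le_lt_trans _ _ (d2 / 2)); [rewrite !ge_min lexx !orbT|lra].
  have dd3 : d < d3 by apply: (@le_lt_trans _ _ (d3 / 2)); [rewrite !ge_min lexx !orbT|lra].
  have {h1}h1 := h1 d d0 dd1; have {h2}h2 := h2 d d0 dd2; have {h3}h3 := h3 d d0 dd3.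
  (* These weights annihilate affine functions, so the combination of translates of [ker0] vanishes
     on both sides of the support. *)
  pose cmb (k : R -> R) (x : R) : R := (c - y) * k (x - a) - (c - a) * k (x - y) + (y - a) * k (x - c).
  have Dc (k dk : R -> R) (x : R) : (forall x : R, is_derive x 1 k (dk x)) -> is_derive x 1 (cmb k) (cmb dk x).
    move=> hk; have S z : is_derive x 1 (fun x => k (x - z)) (dk (x - z)) by exact: is_derive_shift1.
    apply: is_derive_eq (is_derive_add (is_derive_add
      (is_derive_mul (is_derive_cst1 (c - y) x) (S a))
      (is_derive_opp (is_derive_mul (is_derive_cst1 (c - a) x) (S y))))
      (is_derive_mul (is_derive_cst1 (y - a) x) (S c))) _.
    by rewrite /cmb /=; ring.
  have := H (cmb (ker0 d)) (cmb (ker1 d)) (cmb (ker2 d)).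
  move=> /(_ (fun x => Dc _ _ x (fun x => is_derive_ker0 x d0))).
  move=> /(_ (fun x => Dc _ _ x (fun x => is_derive_ker1 x d0))).
  have cc : continuous (cmb (ker2 d)).
    move=> x; rewrite /cmb.
    have S z w : {for x, continuous (fun x => w * ker2 d (x - z))}.
      apply: cts_mul; first exact: cts_cst.
      exact/continuous_shift/continuous_ker2.
    by apply: cts_add; [apply: cts_add; [|apply: cts_opp]|]; exact: S.
  have cs : exists p q : R, forall x, ~~ (p <= x <= q) -> cmb (ker0 d) x = 0 /\ cmb (ker1 d) x = 0.
    exists (a - d), (c + d) => x; rewrite negb_and -!ltNge /cmb => /orP[hx|hx].
      have [|_ -> ->] := @ker_left d (x - a) d0; first lra.
      have [|_ -> ->] := @ker_left d (x - y) d0; first lra.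
      have [|_ -> ->] := @ker_left d (x - c) d0; first lra.
      by split; field.
    have [|_ -> ->] := @ker_right d (x - a) d0; first lra.
    have [|_ -> ->] := @ker_right d (x - y) d0; first lra.
    have [|_ -> ->] := @ker_right d (x - c) d0; first lra.
    by split; field.
  move=> /(_ cc cs).
  have -> : (fun x => h x * cmb (ker2 d) x) = (fun x =>
     ((c - y) * (h x * ker2 d (x - a)) - (c - a) * (h x * ker2 d (x - y))) +
      (y - a) * (h x * ker2 d (x - c))).
    by apply/funext => x; rewrite /cmb; ring.
  have I z : integ (fun x => h x * ker2 d (x - z)) by exact: integ_ker2.
  rewrite IntD; [|by apply: integB; exact: integZ|exact: integZ].
  rewrite IntB; [|exact: integZ|exact: integZ].
  rewrite !IntZ //.
  move: h1 h2 h3; set A1 := Int _; set A2 := Int _; set A3 := Int _.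
  move=> /ler_normlP[h1 h1'] /ler_normlP[h2 h2'] /ler_normlP[h3 h3'] E.
  have e0E : e0 = 2 * (c - a) * e by rewrite /e; field; lra.
  have p1 : 0 <= c - y by lra.
  have p2 : 0 <= c - a by lra.
  have p3 : 0 <= y - a by lra.
  have := ler_wpM2l p1 h1; have := ler_wpM2l p1 h1'.
  have := ler_wpM2l p2 h2; have := ler_wpM2l p2 h2'.
  have := ler_wpM2l p3 h3; have := ler_wpM2l p3 h3'.
  clear - E e0E; move=> *; rewrite ler_norml; apply/andP; split; lra.
exists (h 1 - h 0), (h 0) => x.
have [x0|x0] := ltP x 0; first by have := T x 0 1 x0 ltr01; lra.
have [->|xn0] := eqVneq x 0; first lra.
have {x0}x0 : 0 < x by rewrite lt_neqAle eq_sym xn0.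
have [x1|x1|->] := ltgtP x 1; last lra.
  by have := T 0 x 1 x0 x1; lra.
by have := T 0 1 x ltr01 x1; lra.
Qed.

End Kernel.

(** * Test functions with explicit support, and H^1 functions *)

Section TestFunctions.
Context {R : realType}.
Implicit Types (f g h F dF u du phi dphi : R -> R) (a b c d e k p q x y t C : R).
Notation lam := (@lebesgue_measure R).

(** A test function together with its derivative and an explicit interval carrying both, which is
    what integration by parts consumes. *)
Definition tst phi dphi : Prop :=
  [/\ forall x, is_derive x 1 phi (dphi x), continuous dphi &
   exists p q, forall x, ~~ (p < x <= q) -> phi x = 0 /\ dphi x = 0].

Lemma tst_test phi dphi : tst phi dphi -> test_fun phi /\ derive1 phi = dphi.
Proof.
move=> [D c [p [q h]]]; have E := is_derive_derive1 D; split=> //.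
apply: (@test_fun_intro _ phi p q).
  by split; [move=> x; have [] := D x|rewrite E].
by move=> x hx; have [] := h x _ => //; apply: contra hx => /andP[h1 h2]; rewrite (ltW h1).
Qed.

Lemma test_tst phi : test_fun phi -> tst phi (derive1 phi).
Proof.
move=> [[d c] K]; have D x := derivable_is_derive (d x); split=> //.
have [M [_ hM]] := compact_bounded K.
have hM' x : M + 1 < `|x| -> phi x = 0.
  move=> Mx; apply/eqP; apply: contraT => px.
  have cx : closure [set x | phi x != 0] x by apply: subset_closure.
  by have := hM (M + 1) ltac:(lra) x cx; rewrite /= leNgt Mx.
exists (- (M + 2)), (M + 2) => x hx.
have Mx : M + 2 <= `|x|.
  move: hx; rewrite negb_and -leNgt -ltNge => /orP[h|h].
    by rewrite ler_normr; apply/orP; right; lra.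
  by rewrite ler_normr; apply/orP; left; lra.
split; first by apply: hM'; lra.
have D0 : is_derive x (1:R) (fun _ : R => 0 : R) (derive1 phi x).
  apply: near_eq_is_derive (D x); apply/nbhs_normP; exists 1 => //= y; rewrite /= => xy.
  by apply: hM'; have := ler_normD (x - y) y; rewrite subrK; lra.
by have [_ <-] := D0; have [_ ->] := is_derive_cst1 0 x.
Qed.

Lemma integ_cs g p q : continuous g -> (forall x, ~~ (p < x <= q) -> g x = 0) -> integ g.
Proof.
move=> cg g0; have -> : g = g \_ `]p, q].
  apply/funext => x; rewrite patchE; case: ifPn => //.
  by rewrite notin_setE /= in_itv /= => /negP; exact: g0.
by apply: integ_within => x _; exact: cg.
Qed.

Lemma tst_continuous phi dphi : tst phi dphi -> continuous phi.
Proof. by move=> [D _ _] x; exact: is_derive_cvg (D x). Qed.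

Lemma integ_mul u h : msr u -> msr h -> integ (fun x => u x ^+ 2) ->
  integ (fun x => h x ^+ 2) -> integ (fun x => u x * h x).
Proof.
move=> mu mh iu ih.
apply: (@integ_le _ _ (fun x => 2^-1 * (u x ^+ 2 + h x ^+ 2))).
- exact: measurable_funM.
- exact/integZ/integD.
move=> x; rewrite normrM; have := sqr_ge0 (`|u x| - `|h x|).
by rewrite sqrrB !real_normK ?num_real //; lra.
Qed.

Lemma tst_integ phi dphi : tst phi dphi ->
  [/\ msr phi, msr dphi, integ (fun x => phi x ^+ 2) & integ (fun x => dphi x ^+ 2)].
Proof.
move=> T; have cp := tst_continuous T; have [D c [p [q h]]] := T.
split; [exact: msr_continuous|exact: msr_continuous| |].
  apply: (@integ_cs _ p q) => [x|x /h [-> _]]; last by rewrite expr0n.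
  exact/cts_exp/cp.
apply: (@integ_cs _ p q) => [x|x /h [_ ->]]; last by rewrite expr0n.
exact/cts_exp/c.
Qed.

Definition wk u du : Prop := forall phi dphi, tst phi dphi ->
  Int (fun x => u x * dphi x) = - Int (fun x => du x * phi x).

Lemma wkP u du : weak_derivative u du <-> wk u du.
Proof.
split=> [H phi dphi /tst_test[T <-]|H phi /test_tst T]; first exact: H T.
exact: H T.
Qed.

Lemma H1_withP u du : H1_with u du <->
  [/\ msr u, msr du, integ (fun x => u x ^+ 2), integ (fun x => du x ^+ 2) & wk u du].
Proof.
split=> [[h1 h2 /wkP w]|[m1 m2 i1 i2 /wkP w]].
  by split=> //; [exact: Lp_msr h1|exact: Lp_msr h2|exact: Lp2_integ|exact: Lp2_integ].
by split=> //; exact: Lp2_intro.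
Qed.

Lemma integ_sqrD u h : msr u -> msr h -> integ (fun x => u x ^+ 2) ->
  integ (fun x => h x ^+ 2) -> integ (fun x => (u x + h x) ^+ 2).
Proof.
move=> mu mh iu ih.
have -> : (fun x => (u x + h x) ^+ 2) =
  (fun x => (u x ^+ 2 + h x ^+ 2) + 2 * (u x * h x)).
  by apply/funext => x; ring.
by apply: integD; [exact: integD|apply: integZ; exact: integ_mul].
Qed.

Lemma H1_withD u du h dh : H1_with u du -> H1_with h dh ->
  H1_with (fun x => u x + h x) (fun x => du x + dh x).
Proof.
move=> /H1_withP[m1 m2 i1 i2 w] /H1_withP[m1' m2' i1' i2' w']; apply/H1_withP; split.
- exact: measurable_funD.
- exact: measurable_funD.
- exact: integ_sqrD.
- exact: integ_sqrD.
move=> phi dphi T; have [mp mdp ip idp] := tst_integ T.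
under eq_fun do rewrite mulrDl.
under [in RHS]eq_fun do rewrite mulrDl.
rewrite IntD; [|exact: integ_mul|exact: integ_mul].
rewrite IntD; [|exact: integ_mul|exact: integ_mul].
by rewrite (w _ _ T) (w' _ _ T) opprD.
Qed.

Lemma by_parts_tst u du phi dphi : (forall x, is_derive x 1 u (du x)) ->
  continuous du -> tst phi dphi ->
  Int (fun x => u x * dphi x) = - Int (fun x => du x * phi x).
Proof.
move=> D c [Dp cp [p [q h]]].
pose q' := Num.max q (p + 1).
have pq : p < q' by rewrite lt_max; apply/orP; right; lra.
have h' x : ~~ (p < x <= q') -> phi x = 0 /\ dphi x = 0.
  move=> hx; apply: h; apply: contra hx => /andP[-> xq] /=.
  by rewrite le_max xq.
have E g : (forall x, ~~ (p < x <= q') -> g x = 0) -> g = g \_ `]p, q'].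
  move=> g0; apply/funext => x; rewrite patchE; case: ifPn => //.
  by rewrite notin_setE /= in_itv /= => /negP; exact: g0.
rewrite (E (fun x => u x * dphi x)); last by move=> x /h' [_ ->]; rewrite mulr0.
rewrite (E (fun x => du x * phi x)); last by move=> x /h' [-> _]; rewrite mulr0.
rewrite (@by_parts _ u du phi dphi p q' pq (fun x _ => D x) (fun x _ => c x) (fun x _ => Dp x) (fun x _ => cp x)).
have [-> _] := h' p ltac:(by rewrite ltxx).
(* The point q' belongs to the half-open interval ]p, q'], so this value is obtained by continuity
   from the right. *)
have -> : phi q' = 0.
  have cphi : continuous phi by move=> x; exact: is_derive_cvg (Dp x).
  apply/eqP; rewrite -normr_le0 leNgt; apply/negP => hq.
  have [d d0 hd] := continuous_near (cphi q') hq.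
  have := hd (q' + d / 2).
  rewrite (proj1 (h' (q' + d / 2) _)) ?negb_and -?leNgt -?ltNge; last by apply/orP; right; lra.
  rewrite sub0r normrN ltxx => H; suff : false by [].
  by apply: H; rewrite gtr0_norm; lra.
by rewrite !mulr0 subrr add0r.
Qed.

End TestFunctions.

(** * First variation and regularity of minimizers *)

Section EulerLagrange.
Context {R : realType}.
Implicit Types (f g h F dF u du phi dphi v dv : R -> R) (a b c d e k p q x y t C : R).
Notation lam := (@lebesgue_measure R).
Variables (mu : R -> R) (eps alpha : R).
Hypotheses (mu_C1 : is_C1 mu) (mu_Loo : Lp +oo%E mu) (f_L43 : Lp (4 / 3)%:E (forcing mu)).
Hypothesis eps_gt0 : 0 < eps.
Let f := forcing mu.

Lemma continuous_mu : continuous mu.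
Proof. by have [d _] := mu_C1 => x; exact: is_derive_cvg (derivable_is_derive (d x)). Qed.

Lemma continuous_forcing : continuous f.
Proof.
have [_ c] := mu_C1 => x; apply: cts_mul; last exact: cts_cst.
exact/cts_opp/c.
Qed.

Definition edens u du x : R :=
  eps / 2 * (du x) ^+ 2 - (2 * eps)^-1 * mu x * (u x) ^+ 2
      + (4 * eps)^-1 * (u x) ^+ 4 - alpha * f x * u x.

(** The exponents 4/3 and 4 are conjugate, which pairs an L^{4/3} forcing with u^4. Sharp constants
    are given up by simply comparing a with b^3. *)
Lemma young43 a b : 0 <= a -> 0 <= b -> a * b <= a `^ (4 / 3) + b ^+ 4.
Proof.
move=> a0 b0; have [ba|ab] := leP (b ^+ 3) a.
  have bE : b <= a `^ 3^-1.
    have -> : b = (b ^+ 3) `^ 3^-1.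
      by rewrite -powR_mulrn // -powRrM mulfV // powRr1.
    by apply: ge0_ler_powR; rewrite ?nnegrE ?exprn_ge0.
  have -> : a `^ (4 / 3) = a * a `^ 3^-1.
    rewrite (_ : 4 / 3 = 1 + 3^-1); last by field.
    by rewrite powRD ?powRr1 //; apply/implyP => /eqP; lra.
  by apply: (@le_trans _ _ (a * a `^ 3^-1)); [rewrite ler_wpM2l|rewrite lerDl exprn_ge0].
apply: (@le_trans _ _ (b ^+ 3 * b)); first by rewrite ler_wpM2r // ltW.
by rewrite -exprSr lerDr powR_ge0.
Qed.

Lemma integ_exp4 u C : msr u -> integ (fun x => u x ^+ 2) -> (forall x, `|u x| <= C) ->
  integ (fun x => u x ^+ 4).
Proof.
move=> mu_ iu uC; apply: (@integ_le _ _ (fun x => C ^+ 2 * u x ^+ 2)).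
- exact: measurable_funX.
- exact: integZ.
move=> x; rewrite ger0_norm ?exprn_even_ge0 //.
rewrite (_ : 4%N = (2 + 2)%N) // exprD ler_wpM2r ?sqr_ge0 //.
by rewrite -(real_normK (num_real (u x))) lerXn2r ?nnegrE // (le_trans (normr_ge0 _) (uC x)).
Qed.

Lemma integ_f u C : msr u -> integ (fun x => u x ^+ 2) -> (forall x, `|u x| <= C) ->
  integ (fun x => f x * u x).
Proof.
move=> mu_ iu uC; have i4 := integ_exp4 mu_ iu uC.
apply: (@integ_le _ _ (fun x => `|f x| `^ (4 / 3) + u x ^+ 4)).
- by apply: measurable_funM => //; apply: msr_continuous; exact: continuous_forcing.
- by apply: integD => //; exact: integ_pow43.
move=> x; rewrite normrM; apply: le_trans (young43 _ _) _ => //.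
by rewrite lerD2l -normrX ger0_norm ?exprn_even_ge0.
Qed.

Lemma integ_mu u : msr u -> integ (fun x => u x ^+ 2) -> integ (fun x => mu x * u x ^+ 2).
Proof.
move=> mu_ iu; have [C hC] := Linf_bounded mu_Loo continuous_mu.
apply: (@integ_le _ _ (fun x => C * u x ^+ 2)).
- apply: measurable_funM; last exact: measurable_funX.
  by apply: msr_continuous; exact: continuous_mu.
- exact: integZ.
by move=> x; rewrite normrM (ger0_norm (sqr_ge0 _)) ler_wpM2r ?sqr_ge0.
Qed.

Lemma integ_edens u du C : msr u -> integ (fun x => u x ^+ 2) ->
  integ (fun x => du x ^+ 2) -> (forall x, `|u x| <= C) -> integ (edens u du).
Proof.
move=> mu_ iu idu uC; rewrite /edens.
apply: integB; last first.
  by under eq_fun do rewrite -mulrA; apply: integZ; exact: integ_f uC.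
apply: integD; last by apply: integZ; exact: integ_exp4 uC.
apply: integB; first exact: integZ.
by under eq_fun do rewrite -mulrA; apply: integZ; exact: integ_mu.
Qed.

(** The choice t = - A / (2 M), with M above the sum of the absolute values, makes the linear term
    dominate: the polynomial is then at most - A^2 / (4 M) - t^2. *)
Lemma quartic_ge0 A B C D : (forall t, 0 <= t * A + t ^+ 2 * B + t ^+ 3 * C + t ^+ 4 * D) -> A = 0.
Proof.
move=> H; pose M := `|A| + `|B| + `|C| + `|D| + 1.
have M0 : 1 <= M by rewrite /M; have := normr_ge0 A; have := normr_ge0 B; have := normr_ge0 C; have := normr_ge0 D; lra.
pose t := - A / (2 * M).
have tM : t * M = - A / 2 by rewrite /t; field; lra.
have t1 : `|t| <= 1.
  rewrite /t normrM normrN normfV (ger0_norm (_ : 0 <= 2 * M)); last lra.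
  rewrite ler_pdivrMr; last lra.
  by rewrite /M; have := normr_ge0 A; have := normr_ge0 B; have := normr_ge0 C; have := normr_ge0 D; lra.
have B1 : t ^+ 2 * B <= t ^+ 2 * `|B| by rewrite ler_wpM2l ?sqr_ge0 ?ler_norm.
have tn : `|t| ^+ 2 = t ^+ 2 by rewrite real_normK ?num_real.
have C1 : t ^+ 3 * C <= t ^+ 2 * `|C|.
  apply: le_trans (ler_norm _) _; rewrite normrM normrX exprSr tn.
  by rewrite ler_wpM2r // ler_piMr ?sqr_ge0.
have D1 : t ^+ 4 * D <= t ^+ 2 * `|D|.
  apply: le_trans (ler_norm _) _; rewrite normrM normrX (_ : 4%N = (2 + 2)%N) // exprD tn.
  by rewrite ler_wpM2r // ler_piMr ?sqr_ge0 // -tn exprn_ile1.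
have := H t => Ht.
have S : 0 <= t * A + t ^+ 2 * (M - 1).
  have := mulr_ge0 (sqr_ge0 t) (normr_ge0 A).
  by rewrite /M; move: Ht B1 C1 D1; lra.
have E : t * A + t ^+ 2 * (M - 1) = - (A ^+ 2 / (4 * M)) - t ^+ 2.
  by rewrite /t; field; lra.
have P : 0 <= A ^+ 2 / (4 * M) by rewrite divr_ge0 ?sqr_ge0 //; lra.
have t20 : t ^+ 2 = 0 by have := sqr_ge0 t; rewrite E in S; lra.
have : t = 0 by apply/eqP; rewrite -sqrf_eq0 t20.
by move=> t0; move: tM; rewrite t0; lra.
Qed.

Variables (v dv : R -> R).
Hypothesis v_cont : continuous v.
Hypothesis v_H1 : H1_with v dv.
Hypothesis v_min : forall u du, H1_with u du ->
  energy mu eps alpha v dv <= energy mu eps alpha u du.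

Lemma v_bounded : exists C, forall x, `|v x| <= C.
Proof. by have /H1_withP[m1 m2 i1 i2 /wkP w] := v_H1; exact: weak_bounded w _ _ _. Qed.

Lemma v_integ : integ (edens v dv).
Proof.
by have /H1_withP[m1 m2 i1 i2 w] := v_H1; have [C hC] := v_bounded; exact: integ_edens hC.
Qed.

(** The right-hand side of the Euler-Lagrange equation written as eps v'' = [nonlin]. *)
Definition nonlin x : R := (v x ^+ 3 - mu x * v x) / eps - alpha * f x.

Lemma continuous_nonlin : continuous nonlin.
Proof.
move=> x; apply: cts_add; last first.
  by apply/cts_opp/cts_mul; [exact: cts_cst|exact: continuous_forcing].
apply: cts_mul; last exact: cts_cst.
apply: cts_add; first exact/cts_exp/v_cont.
by apply/cts_opp/cts_mul; [exact: continuous_mu|exact: v_cont].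
Qed.

(** The energy along v + t phi is a polynomial of degree four in t, so its linear coefficient
    vanishes by [quartic_ge0], without differentiating under the integral. *)
Lemma first_variation phi dphi : tst phi dphi ->
  eps * Int (fun x => dv x * dphi x) + Int (fun x => nonlin x * phi x) = 0.
Proof.
move=> T; have [mp mdp ip idp] := tst_integ T.
have /H1_withP[m1 m2 i1 i2 w] := v_H1.
have cp := tst_continuous T; have [D c [p [q h]]] := T.
have h0 x : ~~ (p < x <= q) -> phi x = 0 by move=> /h [].
pose a x := eps * (dv x * dphi x) + nonlin x * phi x.
pose b x := eps / 2 * dphi x ^+ 2 - (2 * eps)^-1 * mu x * phi x ^+ 2
  + 3 / (2 * eps) * v x ^+ 2 * phi x ^+ 2.
pose cc x := eps^-1 * v x * phi x ^+ 3.
pose d x := (4 * eps)^-1 * phi x ^+ 4.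
have inl : integ (fun x => nonlin x * phi x).
  apply: (@integ_cs _ _ p q) => [x|x /h0 ->]; last by rewrite mulr0.
  by apply: cts_mul; [exact: continuous_nonlin|exact: cp].
have ia : integ a by apply: integD => //; apply: integZ; exact: integ_mul.
have ib : integ b.
  apply: integD; [apply: integB|]; first exact: integZ.
    apply: (@integ_cs _ _ p q) => [x|x /h0 ->]; last by rewrite expr0n mulr0.
    apply: cts_mul; [apply: cts_mul|exact/cts_exp/cp]; [exact: cts_cst|exact: continuous_mu].
  apply: (@integ_cs _ _ p q) => [x|x /h0 ->]; last by rewrite expr0n mulr0.
  apply: cts_mul; [apply: cts_mul|exact/cts_exp/cp]; [exact: cts_cst|exact/cts_exp/v_cont].
have ic : integ cc.
  apply: (@integ_cs _ _ p q) => [x|x /h0]; last by rewrite /cc => ->; rewrite expr0n mulr0.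
  apply: cts_mul; [apply: cts_mul|exact/cts_exp/cp]; [exact: cts_cst|exact/v_cont].
have id : integ d.
  apply: (@integ_cs _ _ p q) => [x|x /h0]; last by rewrite /d => ->; rewrite expr0n mulr0.
  apply: cts_mul; [exact: cts_cst|exact/cts_exp/cp].
have : Int a = 0; last by rewrite /a IntD ?IntZ //; [exact: integ_mul|apply: integZ; exact: integ_mul].
apply: (@quartic_ge0 _ (Int b) (Int cc) (Int d)) => t.
have Ht : H1_with (fun x => t * phi x) (fun x => t * dphi x).
  apply/H1_withP; split.
  - exact: measurable_funM.
  - exact: measurable_funM.
  - by under eq_fun do rewrite exprMn; exact: integZ.
  - by under eq_fun do rewrite exprMn; exact: integZ.
  have Dt x : is_derive x 1 (fun x => t * phi x) (t * dphi x).
    apply: is_derive_eq (is_derive_mul (is_derive_cst1 t x) (D x)) _.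
    by rewrite mulr0 addr0.
  have ct : continuous (fun x => t * dphi x).
    by move=> x; apply: cts_mul; [exact: cts_cst|exact: c].
  by move=> psi dpsi; exact: by_parts_tst Dt ct.
have := v_min (H1_withD v_H1 Ht).
have -> : energy mu eps alpha (fun x => v x + t * phi x) (fun x => dv x + t * dphi x) =
  Int (fun x => edens v dv x + (t * a x + t ^+ 2 * b x + t ^+ 3 * cc x + t ^+ 4 * d x)).
  congr Rintegral; apply/funext => x; rewrite /edens /a /b /cc /d /nonlin -/f; field.
  by rewrite gt_eqF.
have j1 := integZ t ia; have j2 := integZ (t ^+ 2) ib.
have j3 := integZ (t ^+ 3) ic; have j4 := integZ (t ^+ 4) id.
have j12 := integD j1 j2; have j123 := integD j12 j3.
rewrite (IntD v_integ (integD j123 j4)) (IntD j123 j4) (IntD j12 j3) (IntD j1 j2).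
have -> : energy mu eps alpha v dv = Int (edens v dv) by [].
rewrite (IntZ t ia) (IntZ _ ib) (IntZ _ ic) (IntZ _ id).
by set X := Int (edens v dv); lra.
Qed.

(* eps v differs from a second antiderivative of nonlin by an affine function. *)
Lemma v_regular : exists dv1, (forall x, is_derive x 1 v (dv1 x)) /\
  forall x, is_derive x 1 dv1 ((v x ^+ 3 - mu x * v x - eps * alpha * f x) / eps ^+ 2).
Proof.
have [G hG] := antiderivative continuous_nonlin.
have cG : continuous G by move=> x; exact: is_derive_cvg (hG x).
have [W hW] := antiderivative cG.
have cW : continuous W by move=> x; exact: is_derive_cvg (hW x).
have /H1_withP[m1 m2 i1 i2 w] := v_H1.
have [||m [b hmb]] := @affine_of_weak _ (fun x => eps * v x - W x).
- move=> x; apply: cts_add; last exact/cts_opp/cW.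
  by apply: cts_mul; [exact: cts_cst|exact: v_cont].
- move=> phi dphi ddphi D1 D2 c [p [q h]].
  have h' x : ~~ (p - 1 < x <= q) -> phi x = 0 /\ dphi x = 0.
    move=> hx; apply: h; apply: contra hx => /andP[h1 ->]; rewrite andbT; lra.
  have dd0 x : ~~ (p - 2 < x <= q + 1) -> ddphi x = 0.
    move=> hx.
    have D0 : is_derive x (1:R) (fun _ : R => 0 : R) (ddphi x).
      apply: near_eq_is_derive (D2 x); apply/nbhs_normP; exists 1 => //= y; rewrite /= => xy.
      apply: (proj2 (h _ _)); apply: contra hx => /andP[h1 h2].
      by move: xy; rewrite ltr_norml => /andP[h3 h4]; apply/andP; split; lra.
    by have [_ <-] := D0; have [_ ->] := is_derive_cst1 0 x.
  have cd : continuous dphi by move=> x; exact: is_derive_cvg (D2 x).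
  have T1 : tst phi dphi by split=> //; exists (p - 1), q.
  have T2 : tst dphi ddphi.
    split=> //; exists (p - 2), (q + 1) => x hx; split; last exact: dd0.
    apply: (proj2 (h' _ _)); apply: contra hx => /andP[h1 h2]; apply/andP; split; lra.
  have E := first_variation T1.
  have E1 := by_parts_tst hG continuous_nonlin T1.
  have E2 := by_parts_tst hW cG T2.
  have E3 := w _ _ T2.
  have [mp mdp ip idp] := tst_integ T1; have [mp' mdp' ip' idp'] := tst_integ T2.
  have -> : (fun x => (eps * v x - W x) * ddphi x) =
     (fun x => eps * (v x * ddphi x) - W x * ddphi x).
    by apply/funext => x; ring.
  rewrite IntB; first last.
  + apply: (@integ_cs _ _ (p - 2) (q + 1)) => [x|x /dd0 ->]; last by rewrite mulr0.
    by apply: cts_mul; [exact: cW|exact: c].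
  + by apply: integZ; exact: integ_mul.
  rewrite IntZ; last exact: integ_mul.
  by rewrite E3 E2 E1; move: E; rewrite -/f; lra.
exists (fun x => (G x + m) / eps).
have vE x : v x = eps^-1 * (W x + m * x + b).
  have -> : W x + m * x + b = eps * v x by have := hmb x; lra.
  by rewrite mulKf // gt_eqF.
split=> x.
  rewrite (_ : v = fun x => eps^-1 * (W x + m * x + b)); last exact/funext.
  apply: is_derive_eq (is_derive_mul (is_derive_cst1 _ x) (is_derive_add (is_derive_add (hW x)
    (is_derive_mul (is_derive_cst1 m x) (is_derive_id1 x))) (is_derive_cst1 b x))) _.
  by field; rewrite gt_eqF.
apply: is_derive_eq (is_derive_mul (is_derive_add (hG x) (is_derive_cst1 m x)) (is_derive_cst1 eps^-1 x)) _.
by rewrite /nonlin; field; rewrite gt_eqF.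
Qed.

End EulerLagrange.

(** * From global to local minimality *)

Section LocalMinimizer.
Context {R : realType} (mu f : R -> R).
Implicit Types (w dw F dF v dv : R -> R) (p q x c e P Q X : R).

(* differs from the integrand of the energy by mu^2 / (4 eps) *)
Definition dens (eps alpha : R) w dw x : R :=
  eps / 2 * dw x ^+ 2 + (4 * eps)^-1 * (w x ^+ 2 - mu x) ^+ 2 - alpha * f x * w x.

(* A piecewise C^1 path from (p, P) to (q, Q) of energy at most e. *)
Inductive joins (eps alpha : R) : R -> R -> R -> R -> R -> Prop :=
| joins_piece p q w dw F dF e : p < q ->
    (forall x, p <= x <= q -> is_derive x 1 w (dw x)) ->
    (forall x, p <= x <= q -> continuous_at x dw) ->
    (forall x, p <= x <= q -> is_derive x 1 F (dF x)) ->
    (forall x, p <= x <= q -> dens eps alpha w dw x <= dF x) ->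
    F q - F p <= e -> joins eps alpha p (w p) q (w q) e
| joins_cat p P c X q Q e1 e2 :
    joins eps alpha p P c X e1 -> joins eps alpha c X q Q e2 ->
    joins eps alpha p P q Q (e1 + e2).

(** All that later sections retain of a global minimizer. No integral occurs: the energy on an
    interval is an increment of a primitive of [dens]. The last three clauses come from comparing v
    with its negative on an interval or a half-line ending at zeros. *)
Record local_minimizer (eps alpha : R) v dv : Prop := LocalMinimizer {
  lm_d : forall x, is_derive x 1 v (dv x);
  lm_dd : forall x, is_derive x 1 dv
    ((v x ^+ 3 - mu x * v x - eps * alpha * f x) / eps ^+ 2);
  lm_min : forall p q e F, joins eps alpha p (v p) q (v q) e ->
    (forall x, is_derive x 1 F (dens eps alpha v dv x)) -> F q - F p <= e;
  lm_flip : forall p q, p < q -> v p = 0 -> v q = 0 ->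
    ~ (forall x, p < x < q -> f x * v x < 0);
  lm_flipl : forall q, v q = 0 -> ~ (forall x, x < q -> f x * v x < 0);
  lm_flipr : forall p, v p = 0 -> ~ (forall x, p < x -> f x * v x < 0)
}.

End LocalMinimizer.

(** * Cutting and pasting: interval competitors and sign reversal *)

Section Bridge.
Context {R : realType}.
Implicit Types (f g h F dF u du phi dphi v dv w dw : R -> R).
Implicit Types (a b c d e k p q x y t C P Q X : R).
Notation lam := (@lebesgue_measure R).
Variables (mu : R -> R) (eps alpha : R).
Hypotheses (mu_C1 : is_C1 mu) (mu_Loo : Lp +oo%E mu) (f_L43 : Lp (4 / 3)%:E (forcing mu)).
Hypotheses (eps_gt0 : 0 < eps) (alpha_gt0 : 0 < alpha).
Let f := forcing mu.
Let cmu : continuous mu := continuous_mu mu_C1.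
Let cf : continuous f := continuous_forcing mu_C1.
Local Notation dn := (dens mu f eps alpha).
Local Notation jn := (joins mu f eps alpha).
Local Notation ed := (edens mu eps alpha).

Lemma dens_cts w dw x : continuous_at x w -> continuous_at x dw -> continuous_at x (dn w dw).
Proof.
move=> cw cdw; apply: cts_add; last first.
  apply/cts_opp/cts_mul => //; apply: cts_mul; [exact: cts_cst|exact: cf].
apply: cts_add; first by apply: cts_mul; [exact: cts_cst|exact: cts_exp].
apply: cts_mul; first exact: cts_cst.
apply: cts_exp; apply: cts_add; first exact: cts_exp.
by apply: cts_opp; exact: cmu.
Qed.

Lemma antiderivative_itv g p q : p < q -> (forall x, p <= x <= q -> continuous_at x g) ->
  exists F, forall x, p <= x <= q -> is_derive x 1 F (g x).
Proof.
move=> pq cg.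
(* The projection onto [p, q], written with absolute values so that its continuity is immediate. *)
pose cl x := (p + q + `|x - p| - `|x - q|) / 2.
have clb x : p <= cl x <= q.
  rewrite /cl; have [h1|h1] := leP 0 (x - p); have [h2|h2] := leP 0 (x - q);
  by rewrite ?(ger0_norm h1) ?(ltr0_norm h1) ?(ger0_norm h2) ?(ltr0_norm h2); apply/andP; split; lra.
have cle x : p <= x <= q -> cl x = x.
  by move=> hx; rewrite /cl ger0_norm ?ler0_norm; lra.
have ccl : continuous cl.
  move=> x; apply: cts_mul; last exact: cts_cst.
  apply: cts_add; first apply: cts_add; first exact: cts_cst.
    by apply/cts_norm/cts_add; [exact: cts_id|exact: cts_cst].
  by apply/cts_opp/cts_norm/cts_add; [exact: cts_id|exact: cts_cst].
have [F hF] := @antiderivative _ (fun x => g (cl x)) (fun x => cts_comp (ccl x) (cg _ (clb x))).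
by exists F => x hx; have := hF x; rewrite cle.
Qed.

(** A path extended by 0 outside ]p, q] jumps at both ends. The boundary terms record the jumps, and
    they cancel in the difference of two paths with the same end values, which is therefore in
    H^1. *)
Definition adm p P q Q w dw : Prop :=
  [/\ p < q, msr w, msr dw,
     exists C, forall x, `|w x| <= C /\ `|dw x| <= C &
     (forall x, ~~ (p < x <= q) -> w x = 0 /\ dw x = 0) /\
     forall phi dphi, tst phi dphi ->
       Int (fun x => w x * dphi x) = Q * phi q - P * phi p - Int (fun x => dw x * phi x)].

Lemma patch_mul g h (D : set R) : (fun x => (g \_ D) x * h x) = (fun x => g x * h x) \_ D.
Proof. by apply/funext => x; rewrite !patchE; case: ifP => // _; exact: mul0r. Qed.

Lemma patch_out g p q x : ~~ (p < x <= q) -> (g \_ `]p, q]) x = 0.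
Proof. by move=> h; rewrite patchE ifF //; apply/negbTE; rewrite notin_setE /= in_itv /=; apply/negP. Qed.

Lemma patch_in g p q x : p < x <= q -> (g \_ `]p, q]) x = g x.
Proof. by move=> h; rewrite patchE ifT // inE /= in_itv. Qed.

Lemma bounded_patch g p q : (forall x, p <= x <= q -> continuous_at x g) ->
  exists2 C, 0 <= C & forall x, `|(g \_ `]p, q]) x| <= C.
Proof.
move=> cg; have [pq|qp] := ltP p q; last first.
  by exists 0 => // x; rewrite patch_out ?normr0 //; apply/negP => ?; lra.
have cn : {within `[p, q], continuous (fun x => `|g x|)}.
  by apply: continuous_within => x hx; apply: cts_norm; exact: cg.
have [c _ hc] := @EVT_max R (fun x => `|g x|) p q (ltW pq) cn.
exists `|g c| => // x; have [hx|hx] := boolP (p < x <= q).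
  by rewrite patch_in // hc // in_itv /=; case/andP: hx => /ltW -> ->.
by rewrite patch_out // normr0.
Qed.

Lemma adm_piece p q w dw : p < q ->
  (forall x, p <= x <= q -> is_derive x 1 w (dw x)) ->
  (forall x, p <= x <= q -> continuous_at x dw) ->
  adm p (w p) q (w q) (w \_ `]p, q]) (dw \_ `]p, q]).
Proof.
move=> pq D c; have cw x : p <= x <= q -> continuous_at x w by move=> /D /is_derive_cvg.
split=> //; [exact: msr_within|exact: msr_within| |split].
- have [C1 C10 h1] := bounded_patch cw; have [C2 C20 h2] := bounded_patch c.
  by exists (C1 + C2) => x; have := h1 x; have := h2 x; split; lra.
- by move=> x hx; rewrite !patch_out.
move=> phi dphi [Dp cp _].
rewrite !patch_mul; apply: by_parts => // x _; exact: cp.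
Qed.

Lemma adm_cat p P c X q Q w1 dw1 w2 dw2 :
  adm p P c X w1 dw1 -> adm c X q Q w2 dw2 ->
  adm p P q Q (fun x => w1 x + w2 x) (fun x => dw1 x + dw2 x).
Proof.
move=> [pc m1 m1' [C1 h1] [z1 E1]] [cq m2 m2' [C2 h2] [z2 E2]]; split.
- exact: lt_trans cq.
- exact: measurable_funD.
- exact: measurable_funD.
- exists (C1 + C2) => x; have [a1 a2] := h1 x; have [b1 b2] := h2 x.
  by split; (apply: le_trans (ler_normD _ _) _; exact: lerD).
have I g r s C phi : msr g -> (forall x, `|g x| <= C) -> (forall x, ~~ (r < x <= s) -> g x = 0) ->
    continuous phi -> integ (fun x => g x * phi x).
  move=> mg gC g0 cphi; have [M M0 hM] := continuous_bounded r s cphi.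
  apply: (@integ_bounded _ _ r s (C * M)).
  - by apply: measurable_funM => //; exact: msr_continuous.
  - move=> x; have [hx|hx] := boolP (r < x <= s); last first.
      by rewrite g0 // mul0r normr0 mulr_ge0 ?(le_trans _ (gC x)) // ltW.
    by rewrite normrM ler_pM // hM //; case/andP: hx => /ltW -> ->.
  - by move=> x /g0 ->; rewrite mul0r.
split.
  move=> x hx.
  have [-> ->] := z1 x ltac:(by apply: contra hx => /andP[h3 h4]; apply/andP; split; lra).
  have [-> ->] := z2 x ltac:(by apply: contra hx => /andP[h3 h4]; apply/andP; split; lra).
  by rewrite addr0.
move=> phi dphi T; have cphi := tst_continuous T; have [_ cdphi _] := T.
under eq_fun do rewrite mulrDl.
under [in RHS]eq_fun do rewrite mulrDl.
rewrite IntD; first last.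
- exact: (I _ _ _ _ _ m2 (fun x => proj1 (h2 x)) (fun x hx => proj1 (z2 x hx))).
- exact: (I _ _ _ _ _ m1 (fun x => proj1 (h1 x)) (fun x hx => proj1 (z1 x hx))).
rewrite IntD; first last.
- exact: (I _ _ _ _ _ m2' (fun x => proj2 (h2 x)) (fun x hx => proj2 (z2 x hx))).
- exact: (I _ _ _ _ _ m1' (fun x => proj2 (h1 x)) (fun x hx => proj2 (z1 x hx))).
by rewrite (E1 _ _ T) (E2 _ _ T); ring.
Qed.

(** By induction on the path; thanks to the half-open supports, the density of a concatenation is
    the sum of the two densities. *)
Lemma joins_adm p P q Q e : jn p P q Q e -> exists w dw,
  [/\ adm p P q Q w dw, integ ((dn w dw) \_ `]p, q]) & Int ((dn w dw) \_ `]p, q]) <= e].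
Proof.
elim=> {p P q Q e} [p q w dw F dF e pq D c DF le Fe|p P c X q Q e1 e2 _ [w1 [dw1 [a1 i1 l1]]] _ [w2 [dw2 [a2 i2 l2]]]].
  exists (w \_ `]p, q]), (dw \_ `]p, q]).
  have -> : dn (w \_ `]p, q]) (dw \_ `]p, q]) \_ `]p, q] = dn w dw \_ `]p, q].
    apply/funext => x; rewrite !patchE; case: ifPn => // hx.
    by rewrite /dens !patchE hx.
  have cd x : p <= x <= q -> continuous_at x (dn w dw).
    by move=> hx; apply: dens_cts; [exact: is_derive_cvg (D x hx)|exact: c].
  split; [exact: adm_piece|exact: integ_within|].
  have [G hG] := antiderivative_itv pq cd.
  rewrite (ftc pq hG cd); apply: le_trans Fe.
  by apply: derive_le_le hG DF le; exact: ltW.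
exists (fun x => w1 x + w2 x), (fun x => dw1 x + dw2 x).
have [pc _ _ _ [z1 _]] := a1; have [cq _ _ _ [z2 _]] := a2.
have E : dn (fun x => w1 x + w2 x) (fun x => dw1 x + dw2 x) \_ `]p, q] =
  (fun x => (dn w1 dw1 \_ `]p, c]) x + (dn w2 dw2 \_ `]c, q]) x).
  apply/funext => x; have [hx|hx] := boolP (p < x <= q); last first.
    by rewrite !patch_out ?addr0 //; apply: contra hx => /andP[h3 h4]; apply/andP; split; lra.
  rewrite (patch_in _ hx); have [xc|cx] := leP x c.
    have h2 : ~~ (c < x <= q) by apply/negP => ?; lra.
    rewrite patch_in; last lra.
    by rewrite (patch_out _ h2) addr0 /dens; have [-> ->] := z2 x h2; rewrite !addr0.
  have h1 : ~~ (p < x <= c) by apply/negP => ?; lra.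
  rewrite (patch_out _ h1) patch_in; last lra.
  by rewrite add0r /dens; have [-> ->] := z1 x h1; rewrite !add0r.
rewrite E; split; [exact: adm_cat a1 a2|exact: integD|].
by rewrite IntD //; exact: lerD.
Qed.


Variables (v dv v1 : R -> R).
Hypothesis v_cont : continuous v.
Hypothesis v_H1 : H1_with v dv.
Hypothesis v_min : forall u du, H1_with u du ->
  energy mu eps alpha v dv <= energy mu eps alpha u du.
Hypothesis Dv : forall x, is_derive x 1 v (v1 x).
Hypothesis Dv1 : forall x, is_derive x 1 v1
  ((v x ^+ 3 - mu x * v x - eps * alpha * f x) / eps ^+ 2).

Let v1_cont : continuous v1.
Proof. by move=> x; exact: is_derive_cvg (Dv1 x). Qed.

Let v2_cont : continuous (fun x => (v x ^+ 3 - mu x * v x - eps * alpha * f x) / eps ^+ 2).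
Proof.
move=> x; apply: cts_mul; last exact: cts_cst.
apply: cts_add; last by apply/cts_opp/cts_mul; [exact: cts_cst|exact: cf].
apply: cts_add; first exact/cts_exp/v_cont.
by apply/cts_opp/cts_mul; [exact: cmu|exact: v_cont].
Qed.

(** With a cutoff chi equal to 1 on [-n, n], the test function v1 chi gives the same integral
    against dv and against v1, since both are weak derivatives of v. Expanding the nonnegative
    integral of (dv - v1)^2 chi then bounds that of v1^2 chi. *)
Lemma v1_local_L2 (n : nat) : Int ((fun x => v1 x ^+ 2) \_ `](- n%:R), n%:R]) <= Int (fun x => dv x ^+ 2).
Proof.
have /H1_withP[m1 m2 i1 i2 w] := v_H1.
pose N : R := n%:R + 1.
pose chi x := ker1 1 (x + N) - ker1 1 (x - N).
pose dchi x := ker2 1 (x + N) - ker2 1 (x - N).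
have Dchi x : is_derive x 1 chi (dchi x).
  by apply: is_derive_add; [|apply: is_derive_opp]; apply: is_derive_shift1; exact: is_derive_ker1.
have cdchi : continuous dchi.
  move=> x; apply: cts_add; last exact/cts_opp/continuous_shift/continuous_ker2.
  by have := @continuous_shift _ (ker2 1) (- N) (@continuous_ker2 _ 1) x; under eq_fun do rewrite opprK.
have cchi : continuous chi by move=> x; exact: is_derive_cvg (Dchi x).
have n0 : 0 <= n%:R :> R by [].
have chi0 x : ~~ (- (N + 1) < x <= N + 1) -> chi x = 0 /\ dchi x = 0.
  rewrite negb_and -leNgt -ltNge /chi /dchi => /orP[h|h].
    have [|-> -> _] := @ker_left _ 1 (x + N) ltr01; first lra.
    by have [|-> -> _] := @ker_left _ 1 (x - N) ltr01; [rewrite /N in h *; lra|rewrite !subrr].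
  have [|-> -> _] := @ker_right _ 1 (x + N) ltr01; first by rewrite /N in h *; lra.
  by have [|-> -> _] := @ker_right _ 1 (x - N) ltr01; [lra|rewrite !subrr].
have chi1 x : - n%:R <= x <= n%:R -> chi x = 1.
  move=> /andP[h1 h2]; rewrite /chi.
  have [|_ -> _] := @ker_right _ 1 (x + N) ltr01; first by rewrite /N; lra.
  by have [|_ -> _] := @ker_left _ 1 (x - N) ltr01; rewrite /N; lra.
have chi_ge0 x : 0 <= chi x.
  by rewrite subr_ge0; apply: ker1_mono => //; rewrite /N; lra.
have chi_le1 x : chi x <= 1.
  have /andP[b1 b2] := ker1_bound (x + N) (@ltr01 R); have /andP[b3 b4] := ker1_bound (x - N) (@ltr01 R).
  by rewrite /chi; lra.
pose phi x := v1 x * chi x.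
pose v2 x := (v x ^+ 3 - mu x * v x - eps * alpha * f x) / eps ^+ 2.
have T : tst phi (fun x => v1 x * dchi x + chi x * v2 x).
  split.
  - by move=> x; exact: is_derive_mul (Dv1 x) (Dchi x).
  - move=> x; apply: cts_add; apply: cts_mul; [exact: v1_cont|exact: cdchi|exact: cchi|exact: v2_cont].
  - exists (- (N + 1)), (N + 1) => x /chi0 [e1 e2]; rewrite /phi e1 e2; split; ring.
have [mp mdp ip idp] := tst_integ T.
have E1 := w _ _ T; have E2 := by_parts_tst Dv v1_cont T.
have E : Int (fun x => dv x * phi x) = Int (fun x => v1 x * phi x).
  by apply: oppr_inj; rewrite -E1 -E2.
have mchi : msr chi by exact: msr_continuous.
have j1 : integ (fun x => dv x ^+ 2 * chi x).
  apply: (integ_le _ i2) => [|x].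
    by apply: measurable_funM => //; exact: measurable_funX.
  rewrite normrM (ger0_norm (sqr_ge0 _)) (ger0_norm (chi_ge0 x)).
  by rewrite ler_piMr ?sqr_ge0.
have j2 : integ (fun x => dv x * phi x) by exact: integ_mul.
have j3 : integ (fun x => v1 x * phi x).
  apply: (@integ_cs _ _ (- (N + 1)) (N + 1)) => [x|x /chi0 [e1 _]]; last by rewrite /phi e1 !mulr0.
  by apply: cts_mul; [exact: v1_cont|apply: cts_mul; [exact: v1_cont|exact: cchi]].
have P : 0 <= Int (fun x => (dv x ^+ 2 * chi x - 2 * (dv x * phi x)) + v1 x * phi x).
  apply: Int_ge0 => x; rewrite /phi.
  rewrite (_ : _ + _ = (dv x - v1 x) ^+ 2 * chi x); last by ring.
  by rewrite mulr_ge0 ?sqr_ge0.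
move: P; rewrite IntD //; last by apply: integB => //; exact: integZ.
rewrite IntB //; last exact: integZ.
rewrite IntZ // E => P.
have L1 : Int (fun x => dv x ^+ 2 * chi x) <= Int (fun x => dv x ^+ 2).
  by apply: Int_le => // x; rewrite ler_piMr ?sqr_ge0.
have L2 : Int ((fun x => v1 x ^+ 2) \_ `](- n%:R), n%:R]) <= Int (fun x => v1 x * phi x).
  apply: Int_le => //.
    by apply: integ_within => x _; exact/cts_exp/v1_cont.
  move=> x; have [hx|hx] := boolP (- n%:R < x <= n%:R).
    by rewrite patch_in // /phi chi1 ?mulr1 ?expr2 //; case/andP: hx => /ltW -> ->.
  by rewrite patch_out // /phi mulrA -expr2 mulr_ge0 ?sqr_ge0.
lra.
Qed.

Lemma v1_L2 : integ (fun x => v1 x ^+ 2) /\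
  Int (fun x => v1 x ^+ 2) <= Int (fun x => dv x ^+ 2).
Proof.
set I := Int (fun x => dv x ^+ 2).
pose F (n : nat) : set R := `](- n%:R), n%:R]%classic.
have mv : msr (fun x => v1 x ^+ 2) by apply: msr_continuous => x; exact/cts_exp/v1_cont.
have UF : \bigcup_i F i = setT.
  apply/seteqP; split=> // x _; exists (Num.trunc `|x|).+1 => //.
  have := Num.Theory.truncnS_gt `|x|; rewrite ltr_norml /F /= in_itv /= => /andP[-> h].
  by rewrite ltW.
have B n : (\int[lam]_(x in F n) (v1 x ^+ 2)%:E <= I%:E)%E.
  have J : integ ((fun x => v1 x ^+ 2) \_ (F n)) by apply: integ_within => x _; exact/cts_exp/v1_cont.
  have := v1_local_L2 n; rewrite -/I -lee_fin /Int /Rintegral fineK; last exact: integrable_fin_num J.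
  rewrite [in X in _ -> X]integral_mkcond; set A := integral _ _ _; set B := integral _ _ _.
  suff -> : A = B by [].
  by apply: eq_integral => x _; rewrite !patchE; case: ifP.
have C : (\int[lam]_(x in F i) (v1 x ^+ 2)%:E @[i --> \oo] --> \int[lam]_(x in \bigcup_i F i) (v1 x ^+ 2)%:E)%E.
  apply: ge0_nondecreasing_set_cvg_integral.
  - move=> n m nm; apply/subsetPset => x; rewrite /F /= !in_itv /= => /andP[h1 h2].
    have : n%:R <= m%:R :> R by rewrite ler_nat.
    by move=> h; apply/andP; split; lra.
  - by move=> i; rewrite /F.
  - by move=> i; apply/measurable_EFinP; exact: measurable_funTS.
  - by move=> i x _; rewrite lee_fin sqr_ge0.
have L : (\int[lam]_x (v1 x ^+ 2)%:E <= I%:E)%E.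
  rewrite -UF -(cvg_lim _ C) //; apply: lime_le; first by apply/cvg_ex; eexists; exact: C.
  by near=> n; exact: B.
have J : integ (fun x => v1 x ^+ 2).
  apply/integrableP; split; first exact/measurable_EFinP.
  under eq_integral do rewrite /= ger0_norm ?sqr_ge0 //.
  by apply: le_lt_trans L _; rewrite ltry.
split=> //; rewrite -lee_fin /Int /Rintegral fineK //; exact: integrable_fin_num J.
Unshelve. all: by end_near. Qed.

Let v_b := v_bounded v_cont v_H1.

(** The classical derivative has no larger L^2 norm than dv, so the pair (v, v1) has no larger
    energy and inherits minimality. *)
Lemma v1_min : H1_with v v1 /\
  (integ (ed v v1) /\ forall u du, H1_with u du -> Int (ed v v1) <= Int (ed u du)).
Proof.
have /H1_withP[m1 m2 i1 i2 w] := v_H1; have [j le] := v1_L2.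
have H : H1_with v v1.
  apply/H1_withP; split=> //; first exact: msr_continuous.
  by move=> phi dphi; exact: by_parts_tst Dv v1_cont.
have [C hC] := v_b.
have J1 := integ_edens eps alpha mu_C1 mu_Loo f_L43 m1 i1 j hC.
have J2 := integ_edens eps alpha mu_C1 mu_Loo f_L43 m1 i1 i2 hC.
split=> //; split; first exact: J1.
move=> u du /v_min; apply: le_trans.
have -> : energy mu eps alpha v dv = Int (ed v dv) by [].
rewrite -subr_ge0 -(IntB J2 J1).
have -> : (fun x => ed v dv x - ed v v1 x) = (fun x => eps / 2 * (dv x ^+ 2 - v1 x ^+ 2)).
  by apply/funext => x; rewrite /edens; ring.
rewrite IntZ; last exact: integB.
rewrite IntB //; apply: mulr_ge0; last by rewrite subr_ge0.
by rewrite divr_ge0 // ltW.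
Qed.

(** The global competitor is v + h, where h is the path minus v on ]p, q] and 0 elsewhere. The term
    mu^2 / (4 eps) that distinguishes [dens] from the energy density cancels, since only a
    difference on ]p, q] enters. *)
Lemma v_lm_min p q e F : jn p (v p) q (v q) e ->
  (forall x, is_derive x 1 F (dn v v1 x)) -> F q - F p <= e.
Proof.
move=> /joins_adm [w [dw [[pq mw mdw [C hC] [z W]] iw le]]] DF.
have [H [J mn]] := v1_min; have /H1_withP[m1 m2 i1 i2 _] := H.
have cv x : p <= x <= q -> continuous_at x v by move=> _; exact: v_cont.
have cv1 x : p <= x <= q -> continuous_at x v1 by move=> _; exact: v1_cont.
have [_ mp mp1 [C' hC'] [z' W']] := adm_piece pq (fun x _ => Dv x) cv1.
pose h x := w x - (v \_ `]p, q]) x.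
pose dh x := dw x - (v1 \_ `]p, q]) x.
have hb x : `|h x| <= C + C' /\ `|dh x| <= C + C'.
  have [a1 a2] := hC x; have [b1 b2] := hC' x.
  by split; (apply: le_trans (ler_normB _ _) _; exact: lerD).
have h0 x : ~~ (p < x <= q) -> h x = 0 /\ dh x = 0.
  by move=> hx; rewrite /h /dh; have [-> ->] := z x hx; have [-> ->] := z' x hx; rewrite subrr.
have ib g D : msr g -> (forall x, `|g x| <= D) -> (forall x, ~~ (p < x <= q) -> g x = 0) -> integ (fun x => g x ^+ 2).
  move=> mg gD g0; apply: (@integ_bounded _ _ p q (D ^+ 2)).
  - exact: measurable_funX.
  - move=> x; rewrite normrX lerXn2r ?nnegrE //; exact: le_trans (gD x).
  - by move=> x /g0 ->; rewrite expr0n.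
have Hh : H1_with h dh.
  apply/H1_withP; split.
  - exact: measurable_funB.
  - exact: measurable_funB.
  - apply: (@ib h (C + C')); [exact: measurable_funB|by move=> x; have [] := hb x|by move=> x /h0 []].
  - apply: (@ib dh (C + C')); [exact: measurable_funB|by move=> x; have [] := hb x|by move=> x /h0 []].
  move=> phi dphi T; have [tp tdp tip tidp] := tst_integ T.
  have i g D : msr g -> (forall x, `|g x| <= D) -> (forall x, ~~ (p < x <= q) -> g x = 0) -> integ (fun x => g x ^+ 2).
    exact: ib.
  under eq_fun do rewrite mulrBl; under [in RHS]eq_fun do rewrite mulrBl.
  have iv : integ (fun x => (v \_ `]p, q]) x ^+ 2).
    by apply: ib mp (fun x => proj1 (hC' x)) (fun x hx => proj1 (z' x hx)).
  have iv1 : integ (fun x => (v1 \_ `]p, q]) x ^+ 2).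
    by apply: ib mp1 (fun x => proj2 (hC' x)) (fun x hx => proj2 (z' x hx)).
  have iww : integ (fun x => w x ^+ 2).
    by apply: ib mw (fun x => proj1 (hC x)) (fun x hx => proj1 (z x hx)).
  have idw : integ (fun x => dw x ^+ 2).
    by apply: ib mdw (fun x => proj2 (hC x)) (fun x hx => proj2 (z x hx)).
  rewrite IntB; [|exact: integ_mul|exact: integ_mul].
  rewrite IntB; [|exact: integ_mul|exact: integ_mul].
  by rewrite (W _ _ T) (W' _ _ T); ring.
have := mn _ _ (H1_withD H Hh).
have cd x : p <= x <= q -> continuous_at x (dn v v1).
  by move=> hx; apply: dens_cts; [exact: cv|exact: cv1].
have E : ed (fun x => v x + h x) (fun x => v1 x + dh x) =
   (fun x => ed v v1 x + ((dn w dw \_ `]p, q]) x - (dn v v1 \_ `]p, q]) x)).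
  apply/funext => x; have [hx|hx] := boolP (p < x <= q); last first.
    by rewrite !patch_out // subrr addr0 /edens; have [-> ->] := h0 x hx; rewrite !addr0.
  by rewrite !patch_in // /edens /dens /h /dh !patch_in // -/f; field; rewrite gt_eqF.
have i3 : integ (dn v v1 \_ `]p, q]) by exact: integ_within.
rewrite E IntD //; last exact: integB.
rewrite (IntB iw i3) (ftc pq (fun x _ => DF x) cd).
by move: le; lra.
Qed.

(** Adding -2 v on D replaces v by -v there. Every even term of the energy is unchanged, so
    minimality leaves exactly 2 alpha times the integral of f v over D. The hypothesis on D says
    that the cut produces no boundary term. *)
Lemma flip_ge0 (D : set R) : measurable D ->
  (forall phi dphi, tst phi dphi -> Int ((fun x => v x * dphi x) \_ D) =
     - Int ((fun x => v1 x * phi x) \_ D)) ->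
  integ ((fun x => f x * v x) \_ D) /\ 0 <= Int ((fun x => f x * v x) \_ D).
Proof.
move=> mD W; have [H [J mn]] := v1_min; have /H1_withP[m1 m2 i1 i2 _] := H.
have [C hC] := v_b.
have ip g : integ g -> integ (g \_ D).
  move=> ig; apply: (integ_le _ (integ_norm ig)).
    by apply: msr_patch => //; apply: measurable_funTS; exact: integ_msr.
  by move=> x; rewrite patchE; case: ifP => // _; rewrite normr0.
have mp g : msr g -> msr (g \_ D) by move=> mg; apply: msr_patch => //; exact: measurable_funTS.
pose h x := - 2 * (v \_ D) x; pose dh x := - 2 * (v1 \_ D) x.
have sq g : (fun x => (- 2 * (g \_ D) x) ^+ 2) = (fun x => 4 * (((fun x => g x ^+ 2) \_ D) x)).
  apply/funext => x; rewrite !patchE; case: ifP => _; [by ring|].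
  by rewrite (_ : point = 0 :> R) // !mulr0 expr0n.
have ifv := integ_f mu_C1 f_L43 m1 i1 hC.
have Hh : H1_with h dh.
  apply/H1_withP; split.
  - by apply: measurable_funM => //; exact: mp.
  - by apply: measurable_funM => //; exact: mp.
  - by rewrite sq; apply/integZ/ip.
  - by rewrite sq; apply/integZ/ip.
  move=> phi dphi T; have [tp tdp tip tidp] := tst_integ T.
  have Eh (g k : R -> R) : (fun x => - 2 * (g \_ D) x * k x) = (fun x => - 2 * ((fun x => g x * k x) \_ D) x).
    by apply/funext => x; rewrite -patch_mul mulrA.
  rewrite Eh Eh IntZ; last by apply/ip/integ_mul.
  rewrite IntZ; last by apply/ip/integ_mul.
  by rewrite (W _ _ T) mulrN.
split; first exact: ip.
have := mn _ _ (H1_withD H Hh).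
have -> : ed (fun x => v x + h x) (fun x => v1 x + dh x) =
   (fun x => ed v v1 x + (2 * alpha) * ((fun x => f x * v x) \_ D) x).
  apply/funext => x; rewrite /edens /h /dh !patchE -/f; case: ifP => _; first by ring.
  by rewrite (_ : point = 0 :> R) // !mulr0 !addr0.
rewrite IntD //; last by apply/integZ/ip.
rewrite IntZ; last exact: ip.
by rewrite lerDl pmulr_rge0 // mulr_gt0.
Qed.

(** Strict negativity at one point spreads, by continuity, to a negative integral. *)
Lemma flip_contra (D : set R) x0 d : 0 < d -> measurable D ->
  (forall phi dphi, tst phi dphi -> Int ((fun x => v x * dphi x) \_ D) =
     - Int ((fun x => v1 x * phi x) \_ D)) ->
  (forall x, D x -> f x * v x <= 0) -> f x0 * v x0 < 0 ->
  (forall x, `|x - x0| <= d -> D x) -> False.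
Proof.
move=> d0 mD W le lt hD; have [J P] := flip_ge0 mD W.
pose m := - (f x0 * v x0) / 2; have m0 : 0 < m by rewrite /m; lra.
have cfv : continuous_at x0 (fun x => f x * v x) by apply: cts_mul; [exact: cf|exact: v_cont].
have [r r0 hr] := continuous_near cfv m0.
pose s := Num.min d (r / 2).
have s0 : 0 < s by rewrite lt_min d0; lra.
have sd : s <= d by rewrite ge_min lexx.
have sr : s < r by apply: (@le_lt_trans _ _ (r / 2)); [rewrite ge_min lexx orbT|lra].
pose g : R -> R := (fun=> - m) \_ `]x0 - s, x0 + s].
have ig : integ g by apply: integ_within => x _; exact: cts_cst.
have L : Int ((fun x => f x * v x) \_ D) <= Int g.
  apply: Int_le => // x; have [hx|hx] := boolP (x0 - s < x <= x0 + s); last first.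
    by rewrite /g patch_out // patchE; case: ifP => [/set_mem /le|].
  rewrite /g patch_in //; have xs : `|x - x0| <= s by rewrite ler_norml; apply/andP; split; lra.
  rewrite patchE ifT; last by rewrite inE; apply: hD; lra.
  by have := hr x ltac:(lra) => /ltr_normlP[h1 h2]; rewrite /m in h1 h2 *; lra.
have E : Int g = - m * (x0 + s) - (- m * (x0 - s)).
  have D0 x : x0 - s <= x <= x0 + s -> is_derive x 1 (fun x => - m * x) (- m).
    move=> _; apply: is_derive_eq (is_derive_mul (is_derive_cst1 (- m) x) (is_derive_id1 x)) _.
    by rewrite mulr1 mulr0 addr0.
  by apply: (ftc _ D0) => [|x _]; [lra|exact: cts_cst].
have : 0 < m * s by exact: mulr_gt0.
by move: P L; rewrite E; lra.
Qed.


Lemma v_lm_flip p q : p < q -> v p = 0 -> v q = 0 ->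
  ~ (forall x, p < x < q -> f x * v x < 0).
Proof.
move=> pq vp vq H.
apply: (@flip_contra `]p, q] ((p + q) / 2) ((q - p) / 4)) => //.
- lra.
- move=> phi dphi [Dp cp _].
  rewrite (by_parts pq (fun x _ => Dv x) (fun x _ => @v1_cont x) (fun x _ => Dp x) (fun x _ => cp x)).
  by rewrite vp vq !mul0r subrr sub0r.
- move=> x; rewrite /= in_itv /= => /andP[px]; rewrite le_eqVlt => /predU1P[->|xq].
    by rewrite vq mulr0.
  by rewrite ltW // H // px.
- by apply: H; lra.
- by move=> x; rewrite ler_norml /= in_itv /= => h; lra.
Qed.

Lemma v_lm_flipl q : v q = 0 -> ~ (forall x, x < q -> f x * v x < 0).
Proof.
move=> vq H.
apply: (@flip_contra `]-oo, q] (q - 1) (1 / 2)) => //.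
- move=> phi dphi T; have [Dp cp [p0 [q0 h]]] := T.
  (* To the left of the support of the test function: the half-line can be cut to ]p, q], and the
     boundary term at p vanishes. *)
  pose p := Num.min p0 q - 1.
  have p1 : p < p0 by apply: (@lt_le_trans _ _ (Num.min p0 q)); [rewrite /p; lra|rewrite ge_min lexx].
  have pq : p < q by apply: (@lt_le_trans _ _ (Num.min p0 q)); [rewrite /p; lra|rewrite ge_min lexx orbT].
  have h' x : x <= p -> phi x = 0 /\ dphi x = 0 by move=> xp; apply: h; apply/negP; lra.
  have E g : (forall x, x <= p -> g x = 0) -> g \_ `]-oo, q] = g \_ `]p, q].
    move=> g0; apply/funext => x; have [hx|hx] := boolP (p < x <= q).
      by rewrite patch_in // patchE ifT // inE /= in_itv /=; case/andP: hx.
    rewrite patch_out // patchE; case: ifP => //; rewrite inE /= in_itv /= => xq.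
    by apply: g0; rewrite leNgt; apply: contra hx => ->.
  rewrite E; last by move=> x /h' [_ ->]; rewrite mulr0.
  rewrite E; last by move=> x /h' [-> _]; rewrite mulr0.
  rewrite (by_parts pq (fun x _ => Dv x) (fun x _ => @v1_cont x) (fun x _ => Dp x) (fun x _ => cp x)).
  by have [-> _] := h' p (lexx _); rewrite vq !mul0r mulr0 subrr sub0r.
- move=> x; rewrite /= in_itv /=; rewrite le_eqVlt => /predU1P[->|xq].
    by rewrite vq mulr0.
  by rewrite ltW // H.
- by apply: H; lra.
- by move=> x; rewrite ler_norml /= in_itv /= => h; lra.
Qed.

Lemma v_lm_flipr p : v p = 0 -> ~ (forall x, p < x -> f x * v x < 0).
Proof.
move=> vp H.
apply: (@flip_contra `]p, +oo[ (p + 1) (1 / 2)) => //.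
- move=> phi dphi T; have [Dp cp [p0 [q0 h]]] := T.
  pose q := Num.max q0 p + 1.
  have q1 : q0 < q by apply: (@le_lt_trans _ _ (Num.max q0 p)); [rewrite le_max lexx|rewrite /q; lra].
  have pq : p < q by apply: (@le_lt_trans _ _ (Num.max q0 p)); [rewrite le_max lexx orbT|rewrite /q; lra].
  have h' x : q <= x -> phi x = 0 /\ dphi x = 0 by move=> xp; apply: h; apply/negP; lra.
  have E g : (forall x, q <= x -> g x = 0) -> g \_ `]p, +oo[ = g \_ `]p, q].
    move=> g0; apply/funext => x; have [hx|hx] := boolP (p < x <= q).
      by rewrite patch_in // patchE ifT // inE /= in_itv /=; case/andP: hx => ->.
    rewrite patch_out // patchE; case: ifP => //; rewrite inE /= in_itv /= andbT => px.
    by apply: g0; rewrite leNgt; apply: contra hx => xq; rewrite px ltW.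
  rewrite E; last by move=> x /h' [_ ->]; rewrite mulr0.
  rewrite E; last by move=> x /h' [-> _]; rewrite mulr0.
  rewrite (by_parts pq (fun x _ => Dv x) (fun x _ => @v1_cont x) (fun x _ => Dp x) (fun x _ => cp x)).
  by have [-> _] := h' q (lexx _); rewrite vp !mul0r mulr0 subrr sub0r.
- move=> x; rewrite /= in_itv /= andbT => px.
  by rewrite ltW // H.
- by apply: H; lra.
- by move=> x; rewrite ler_norml /= in_itv /= => h; apply/andP; split => //; lra.
Qed.

End Bridge.

Lemma global_minimizer_local {R : realType} (mu : R -> R) (eps alpha : R) (v : R -> R) :
  is_C1 mu -> Lp +oo%E mu -> Lp (4 / 3)%:E (forcing mu) -> 0 < eps -> 0 < alpha ->
  global_minimizer mu eps alpha v ->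
  local_minimizer mu (forcing mu) eps alpha v (derive1 v).
Proof.
move=> mu_C1 mu_Loo f_L43 e0 a0 [cv [dv H mn]].
have [v1 [D1 D2]] := v_regular mu_C1 mu_Loo f_L43 e0 cv H mn.
rewrite (is_derive_derive1 D1); split=> //.
- by move=> p q e F J DF; exact (v_lm_min mu_C1 mu_Loo f_L43 e0 cv H mn D1 D2 J DF).
- exact: (v_lm_flip mu_C1 mu_Loo f_L43 e0 a0 cv H mn D1 D2).
- exact: (v_lm_flipl mu_C1 mu_Loo f_L43 e0 a0 cv H mn D1 D2).
- exact: (v_lm_flipr mu_C1 mu_Loo f_L43 e0 a0 cv H mn D1 D2).
Qed.

(** * Symmetry and barriers *)

Section Reflection.
Context {R : realType} (mu f : R -> R).
Implicit Types (w dw F dF v dv : R -> R) (p q x c e P Q X eps alpha : R).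
Hypotheses (mu_even : forall x, mu (- x) = mu x) (f_odd : forall x, f (- x) = - f x).

Lemma is_derive_reflect F x d : is_derive (- x) 1 F d -> is_derive x 1 (fun y => F (- y)) (- d).
Proof.
move=> H; apply: is_derive_eq (@is_derive_comp1 _ F (fun y => - y) x _ _ H (is_derive_opp (is_derive_id1 x))) _.
by rewrite mulrN1.
Qed.

Lemma is_derive_hat F x d : is_derive (- x) 1 F d -> is_derive x 1 (hat F) d.
Proof. by move=> H; rewrite -[d]opprK; apply: is_derive_opp; exact: is_derive_reflect. Qed.

Lemma cts_reflect F x : continuous_at (- x) F -> continuous_at x (fun y => F (- y)).
Proof. by move=> H; apply: cts_comp H; apply: cts_opp; exact: cts_id. Qed.

Lemma dens_hat eps alpha v dv x :
  dens mu f eps alpha (hat v) (fun y => dv (- y)) x = dens mu f eps alpha v dv (- x).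
Proof. by rewrite /dens /hat mu_even f_odd sqrrN; ring. Qed.

Lemma joins_hat eps alpha p P q Q e :
  joins mu f eps alpha p P q Q e -> joins mu f eps alpha (- q) (- Q) (- p) (- P) e.
Proof.
elim=> {p P q Q e} [p q w dw F dF e pq D c DF le Fe|p P c X q Q e1 e2 _ h1 _ h2]; last first.
  by rewrite addrC; exact: joins_cat h2 h1.
have H := @joins_piece R mu f eps alpha (- q) (- p) (hat w) (fun x => dw (- x)) (hat F) (fun x => dF (- x)) e.
have E G z : hat G (- z) = - G z by rewrite /hat opprK.
move: H; rewrite !E; apply.
- lra.
- by move=> x hx; apply: is_derive_hat; apply: D; lra.
- by move=> x hx; apply: cts_reflect; apply: c; lra.
- by move=> x hx; apply: is_derive_hat; apply: DF; lra.
- by move=> x hx; rewrite dens_hat; apply: le; lra.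
- lra.
Qed.

(** Every statement below about the left side of the line transfers to the right side through this
    symmetry. *)
Lemma local_minimizer_hat eps alpha v dv : local_minimizer mu f eps alpha v dv ->
  local_minimizer mu f eps alpha (hat v) (fun x => dv (- x)).
Proof.
move=> [D1 D2 mn fl fll flr].
have fh x : f x * hat v x = f (- x) * v (- x) by rewrite /hat f_odd mulrN mulNr.
split.
- by move=> x; apply: is_derive_hat.
- move=> x; have := is_derive_reflect (D2 (- x)).
  rewrite mu_even f_odd (_ : - (_ / _) = (hat v x ^+ 3 - mu x * hat v x - eps * alpha * f x) / eps ^+ 2) //.
  by rewrite /hat; ring.
- move=> p q e F /joins_hat; have E G z : - hat G z = G (- z) by rewrite /hat opprK.
  rewrite !E => J DF.
  have DH x : is_derive x 1 (hat F) (dens mu f eps alpha v dv x).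
    by apply: is_derive_hat; have := DF (- x); rewrite dens_hat opprK.
  by have := mn _ _ e (hat F) J DH; rewrite /hat !opprK; lra.
- move=> p q pq /eqP; rewrite oppr_eq0 => /eqP vp /eqP; rewrite oppr_eq0 => /eqP vq H.
  apply: (fl (- q) (- p)) => //; first lra.
  by move=> x hx; have := H (- x); rewrite fh opprK; apply; lra.
- move=> q /eqP; rewrite oppr_eq0 => /eqP vq H.
  by apply: (flr (- q)) => // x hx; have := H (- x); rewrite fh opprK; apply; lra.
- move=> p /eqP; rewrite oppr_eq0 => /eqP vp H.
  by apply: (fll (- p)) => // x hx; have := H (- x); rewrite fh opprK; apply; lra.
Qed.

End Reflection.

(** * Barriers and local bounds *)

Section Barrier.
Context {R : realType}.
Implicit Types (g v dv F dF mu f : R -> R) (p q x y c d e m r eta eps alpha a L : R).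

Lemma max_second g dg x d2 d : 0 < d ->
  (forall y, `|y - x| < d -> is_derive y 1 g (dg y : R)) -> is_derive x 1 dg d2 ->
  (forall y, `|y - x| < d -> g y <= g x) -> d2 <= 0.
Proof.
move=> d0 Dg D2 mx; rewrite leNgt; apply/negP => h.
have xx : `|x - x| < d by rewrite subrr normr0.
have g0 : dg x = 0.
  by apply: (derive_local_max d0 (Dg x xx)) => // y /Dg [].
have [r r0 hr] := derive_pos_near D2 h.
pose s := Num.min d r / 2.
have s0 : 0 < s by rewrite divr_gt0 // lt_min d0.
have m1 : Num.min d r <= d by rewrite ge_min lexx.
have m2 : Num.min d r <= r by rewrite ge_min lexx orbT.
have sd : s < d by rewrite /s; lra.
have sr : s < r by rewrite /s; lra.
have [c /andP[c1 c2] E] := @mvt _ g dg x (x + s) ltac:(lra)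
   (fun y hy => Dg y ltac:(by rewrite ger0_norm; lra)).
have [+ _] := hr c ltac:(by rewrite ger0_norm; lra).
move=> /(_ c1); rewrite g0 => dc.
have := mx (x + s); rewrite addrC addKr gtr0_norm // => /(_ sd).
have : 0 < dg c * (x + s - x) by rewrite mulr_gt0 //; lra.
by rewrite -E addrC; lra.
Qed.

(** Beyond a + B the function w^3 - m w increases because a^2 > m; at a + B it already dominates eta
    a, which absorbs the forcing, plus B^3, which absorbs the second derivative of the barrier. *)
Lemma supersolution_ineq (a B m eta w : R) : 0 < a -> 0 < B -> 0 < eta ->
  a ^+ 2 = m + eta -> a + B < w -> eta * a + B ^+ 3 < w ^+ 3 - m * w.
Proof.
move=> a0 B0 et0 aE hw; have w0 : 0 < w by lra.
have T2 : (a + B) ^+ 3 - m * (a + B) < w ^+ 3 - m * w.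
  have -> : w ^+ 3 - m * w = (a + B) ^+ 3 - m * (a + B) +
    (w - (a + B)) * (w ^+ 2 + w * (a + B) + (a + B) ^+ 2 - m) by ring.
  rewrite ltrDl; apply: mulr_gt0; first lra.
  have q1 : 0 < w ^+ 2 by rewrite exprn_gt0.
  have q2 : 0 < w * (a + B) by rewrite mulr_gt0 //; lra.
  have q3 : 0 < a * B by rewrite mulr_gt0.
  have q4 : 0 <= B ^+ 2 by exact: sqr_ge0.
  by move: aE q1 q2 q3 q4 et0; clear; rewrite sqrrD; lra.
have T3 : eta * a + B ^+ 3 <= (a + B) ^+ 3 - m * (a + B).
  have -> : (a + B) ^+ 3 - m * (a + B) = (a + B) * ((a ^+ 2 - m) + 2 * a * B + B ^+ 2) by ring.
  rewrite aE (_ : m + eta - m = eta); last by ring.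
  have q1 : 0 < eta * B by rewrite mulr_gt0.
  have q2 : 0 < a * (a * B) by rewrite !mulr_gt0.
  have q3 : 0 < a * B ^+ 2 by rewrite mulr_gt0 // exprn_gt0.
  rewrite [X in _ <= X](_ : _ = eta * a + B ^+ 3 + (eta * B + 2 * (a * (a * B)) + 3 * (a * B ^+ 2))); last by ring.
  by move: q1 q2 q3; clear; lra.
by move: T2 T3; clear; lra.
Qed.

(* W = a + 3 eps r / (r^2 - (y - x)^2) is a supersolution that blows up at
   distance r from x. *)
Lemma barrier_up mu v dv g eps x r m eta a : 0 < eps -> 0 < r -> 0 <= m -> 0 < eta ->
  0 < a -> a ^+ 2 = m + eta ->
  (forall y, is_derive y 1 v (dv y)) ->
  (forall y, is_derive y 1 dv ((v y ^+ 3 - mu y * v y - g y) / eps ^+ 2)) ->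
  (forall y, `|y - x| <= r -> mu y <= m) ->
  (forall y, `|y - x| <= r -> g y <= eta * a) ->
  v x <= a + 3 * eps / r.
Proof.
move=> e0 r0 m0 et0 a0 aE D1 D2 mu_m ga; rewrite leNgt; apply/negP => vx.
have cv : continuous v by move=> y; exact: is_derive_cvg (D1 y).
have [N N0 hN] := continuous_bounded (x - r) (x + r) cv.
(* At distance t from the ends of the ball, D = t (2 r - t) is so small that the barrier exceeds the
   bound N on v; the maximum of v - W is therefore interior. *)
pose t := Num.min (r / 2) (eps / (N + 1)).
have N1 : 0 < N + 1 by move: N0; clear; lra.
have t0 : 0 < t by rewrite lt_min !divr_gt0.
have tr : t <= r / 2 by rewrite ge_min lexx.
have tN : t * (N + 1) <= eps.
  by rewrite -ler_pdivlMr // ge_min lexx orbT.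
pose D y := r ^+ 2 - (y - x) ^+ 2.
pose W y := a + 3 * eps * r / D y.
pose W1 y := 3 * eps * r * (2 * (y - x)) / D y ^+ 2.
pose W2 y := 3 * eps * r * (2 / D y ^+ 2 + 8 * (y - x) ^+ 2 / D y ^+ 3).
have Dpos y : `|y - x| < r -> 0 < D y.
  move=> yr; rewrite /D subr_gt0 -(real_normK (num_real (y - x))).
  by rewrite ltrXn2r // nnegrE // ltW.
have DD y : is_derive y 1 D (- (2 * (y - x))).
  have := is_derive_add (is_derive_cst1 (r ^+ 2) y) (is_derive_opp (is_derive_exp 2
    (is_derive_add (is_derive_id1 y) (is_derive_cst1 (- x) y)))).
  by move=> H; apply: is_derive_eq H _; rewrite /= expr1; ring.
have DW y : `|y - x| < r -> is_derive y 1 W (W1 y).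
  move=> /Dpos Dy; have Dn : D y != 0 by rewrite gt_eqF.
  have := is_derive_add (is_derive_cst1 a y) (is_derive_mul (is_derive_cst1 (3 * eps * r) y)
    (is_derive_inv Dn (DD y))).
  by move=> H; apply: is_derive_eq H _; rewrite /W1; field; rewrite gt_eqF.
have DW1 y : `|y - x| < r -> is_derive y 1 W1 (W2 y).
  move=> /Dpos Dy; have Dn : D y ^+ 2 != 0 by rewrite expf_neq0 // gt_eqF.
  have := is_derive_mul (is_derive_mul (is_derive_cst1 (3 * eps * r) y)
    (is_derive_mul (is_derive_cst1 2 y) (is_derive_add (is_derive_id1 y) (is_derive_cst1 (- x) y))))
    (@is_derive_inv _ (fun z => D z ^+ 2) y _ Dn (is_derive_exp 2 (DD y))).
  by move=> H; apply: is_derive_eq H _; rewrite /W2 /= expr1; field; rewrite gt_eqF.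
pose l := x - (r - t); pose u := x + (r - t).
have lu : l <= u by rewrite /l /u; move: tr t0; clear; lra.
have inr y : l <= y <= u -> `|y - x| < r.
  by rewrite /l /u ltr_norml; move: t0; clear; move=> ? /andP[? ?]; apply/andP; split; lra.
have cphi : {within `[l, u], continuous (fun y => v y - W y)}.
  apply: continuous_within => y /inr hy; apply: cts_add; first exact: cv.
  by apply: cts_opp; exact: is_derive_cvg (DW y hy).
have [z] := EVT_max lu cphi; rewrite in_itv /= => zlu zmax.
have Wx : W x = a + 3 * eps / r by rewrite /W /D subrr expr0n subr0; field; rewrite gt_eqF.
have zpos : 0 < v z - W z.
  have xlu : l <= x <= u by rewrite /l /u; move: tr t0; clear; lra.
  have := zmax x; rewrite in_itv /= => /(_ xlu).
  by rewrite Wx; move: vx; clear; lra.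
have bd y : D y = t * (2 * r - t) -> `|y - x| <= r -> v y - W y < 0.
  move=> Dy yr; have vN : v y <= N.
    by have := hN y; rewrite -ler_distl => /(_ yr) /ler_normlP[].
  suff : N + 1 <= 3 * eps * r / D y by rewrite /W; move: vN a0; clear; lra.
  have rt : 0 <= 2 * r - t by move: tr t0; clear; lra.
  have P : 0 < t * (2 * r - t) by rewrite mulr_gt0 //; move: tr t0; clear; lra.
  rewrite Dy ler_pdivlMr // (_ : (N + 1) * (t * (2 * r - t)) = (t * (N + 1)) * (2 * r - t)); last by ring.
  apply: (@le_trans _ _ (eps * (2 * r - t))); first by rewrite ler_wpM2r.
  rewrite (_ : 3 * eps * r = eps * (3 * r)); last by ring.
  by rewrite ler_wpM2l ?(ltW e0) //; move: t0 r0; clear; lra.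
have zl : l < z.
  rewrite lt_neqAle; case/andP: zlu => -> _; rewrite andbT; apply/negP => /eqP lz.
  have := @bd z; rewrite -lz /l /D => H.
  have : v (x - (r - t)) - W (x - (r - t)) < 0.
    by apply: H; [ring|rewrite ler_norml; move: tr t0; clear; move=> *; apply/andP; split; lra].
  by move: zpos; rewrite -lz /l; clear; lra.
have zu : z < u.
  rewrite lt_neqAle; case/andP: zlu => _ ->; rewrite andbT; apply/negP => /eqP lz.
  have := @bd z; rewrite lz /u /D => H.
  have : v (x + (r - t)) - W (x + (r - t)) < 0.
    by apply: H; [ring|rewrite ler_norml; move: tr t0; clear; move=> *; apply/andP; split; lra].
  by move: zpos; rewrite lz /u; clear; lra.
pose d := Num.min (z - l) (u - z).
have d0 : 0 < d by rewrite lt_min !subr_gt0 zl zu.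
have dl : d <= z - l by rewrite ge_min lexx.
have du : d <= u - z by rewrite ge_min lexx orbT.
have ind y : `|y - z| < d -> l <= y <= u.
  by rewrite ltr_norml; move: dl du; clear; move=> ? ? /andP[? ?]; apply/andP; split; lra.
have zr := inr z zlu.
have Dz := Dpos z zr.
have key : (v z ^+ 3 - mu z * v z - g z) / eps ^+ 2 - W2 z <= 0.
  have E1 y : `|y - z| < d -> is_derive y 1 (fun y => v y - W y) (dv y - W1 y).
    by move=> /ind /inr hy; exact: is_derive_add (D1 y) (is_derive_opp (DW y hy)).
  have E2 : is_derive z 1 (fun y => dv y - W1 y)
      ((v z ^+ 3 - mu z * v z - g z) / eps ^+ 2 - W2 z).
    exact: is_derive_add (D2 z) (is_derive_opp (DW1 z zr)).
  apply: (max_second d0 E1 E2).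
  by move=> y /ind hy; apply: zmax; rewrite in_itv.
pose B := 3 * eps * r / D z.
have B0 : 0 < B by rewrite divr_gt0 // !mulr_gt0.
have WE : W z = a + B by [].
(* The factor 3 in W is chosen for this inequality: after simplification it reads 2 D + 8 (z - x)^2
   <= 9 r^2. *)
have W2E : eps ^+ 2 * W2 z <= B ^+ 3.
  have -> : B ^+ 3 = (3 * eps * r) * (9 * eps ^+ 2 * r ^+ 2) / D z ^+ 3.
    by rewrite /B; field; rewrite gt_eqF.
  have -> : eps ^+ 2 * W2 z = (3 * eps * r) * (eps ^+ 2 * (2 * D z + 8 * (z - x) ^+ 2)) / D z ^+ 3.
    by rewrite /W2; field; rewrite gt_eqF.
  rewrite ler_pM2r ?invr_gt0 ?exprn_gt0 // ler_pM2l ?mulr_gt0 //.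
  rewrite (_ : 9 * eps ^+ 2 * r ^+ 2 = eps ^+ 2 * (9 * r ^+ 2)); last by ring.
  rewrite ler_wpM2l ?sqr_ge0 //; move: Dz; rewrite /D; have := sqr_ge0 r; clear; lra.
have S1 : v z ^+ 3 - mu z * v z - g z <= eps ^+ 2 * W2 z.
  by rewrite [leRHS]mulrC -ler_pdivrMr ?exprn_gt0 // -subr_le0.
have mz : mu z <= m by apply: mu_m; exact: ltW.
have gz : g z <= eta * a by apply: ga; exact: ltW.
have vz : a + B < v z by move: zpos; rewrite WE; clear; lra.
have vz0 : 0 < v z by move: vz a0 B0; clear; lra.
have T1 : mu z * v z <= m * v z by rewrite ler_wpM2r // ltW.
have := supersolution_ineq a0 B0 et0 aE vz.
by move: T1 S1 W2E gz; clear; lra.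
Qed.

Context (mu f : R -> R).
Hypotheses (Dmu : forall x, is_derive x 1 mu (- 2 * f x)) (cf : continuous f).
Let cmu : continuous mu.
Proof. by move=> x; exact: is_derive_cvg (Dmu x). Qed.

Lemma barrier eps alpha v dv x r m eta a B : local_minimizer mu f eps alpha v dv ->
  0 < eps -> 0 < r -> 0 <= m -> 0 < eta -> 0 < a -> a ^+ 2 = m + eta ->
  (forall y, `|y - x| <= r -> mu y <= m) -> (forall y, `|y - x| <= r -> `|f y| <= B) ->
  0 <= alpha -> eps * alpha * B <= eta * a -> `|v x| <= a + 3 * eps / r.
Proof.
move=> [D1 D2 _ _ _ _] e0 r0 m0 et0 a0 aE hm hf al0 hB.
have ea : 0 <= eps * alpha by rewrite mulr_ge0 // ltW.
rewrite ler_norml; apply/andP; split.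
  rewrite lerNl; apply: (@barrier_up mu (fun y => - v y) (fun y => - dv y)
    (fun y => - (eps * alpha * f y)) eps x r m eta a) => //.
  - move=> y; apply: is_derive_eq (is_derive_opp (D2 y)) _; ring.
  - move=> y hy; apply: le_trans hB; rewrite -mulrN ler_wpM2l //.
    by rewrite (le_trans _ (hf y hy)) // -normrN ler_norm.
apply: (@barrier_up mu v dv (fun y => eps * alpha * f y) eps x r m eta a) => //.
move=> y hy; apply: le_trans hB; rewrite ler_wpM2l //.
by rewrite (le_trans _ (hf y hy)) // ler_norm.
Qed.

Lemma bound_on L Lam : 0 <= Lam -> exists2 K, 0 < K & forall eps alpha v dv x,
  local_minimizer mu f eps alpha v dv -> 0 < eps -> eps <= 1 -> 0 <= alpha -> alpha <= Lam ->
  `|x| <= L -> `|v x| <= K.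
Proof.
move=> L0; have [M M0 hM] := continuous_bounded (- (L + 1)) (L + 1) cmu.
have [B B0 hB] := continuous_bounded (- (L + 1)) (L + 1) cf.
(* Since a >= 1, this eta absorbs the forcing: eps alpha B <= Lam B <= eta a. *)
pose eta := 1 + Lam * B.
have et1 : 1 <= eta by rewrite lerDl mulr_ge0 // ltW.
pose a := Num.sqrt (M + eta).
have aE : a ^+ 2 = M + eta by rewrite sqr_sqrtr //; lra.
have a1 : 1 <= a by rewrite -sqrtr1 ler_sqrt //; lra.
exists (a + 3); first lra.
move=> eps alpha v dv x lm e0 e1 al0 alL xL.
have E : 3 = 3 * 1 / 1 :> R by lra.
apply: (@le_trans _ _ (a + 3 * eps / 1)); last by rewrite divr1; lra.
have inL y : `|y - x| <= 1 -> - (L + 1) <= y <= L + 1.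
  rewrite ler_norml => /andP[h1 h2]; move: xL; rewrite ler_norml => /andP[h3 h4].
  by apply/andP; split; lra.
apply: (@barrier eps alpha v dv x 1 M eta a B) => //; try lra.
- by move=> y /inL /hM; move=> /(le_trans (ler_norm _)).
- by move=> y /inL /hB.
have q1 : eps * alpha * B <= Lam * B.
  rewrite ler_wpM2r ?(ltW B0) // (le_trans _ alL) // ler_piMl //.
have : eta * 1 <= eta * a by rewrite ler_wpM2l //; lra.
by rewrite /eta in et1 *; lra.
Qed.

Lemma small_near x0 th Lam : 0 <= Lam -> 0 < th -> mu x0 < th ^+ 2 ->
  exists d eps0, [/\ 0 < d, 0 < eps0 & forall eps alpha v dv x,
  local_minimizer mu f eps alpha v dv -> 0 < eps -> eps <= eps0 -> 0 <= alpha -> alpha <= Lam ->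
  `|x - x0| <= d -> `|v x| <= th].
Proof.
move=> L0 th0 hmu.
pose m0 := Num.max (mu x0) 0.
have m00 : 0 <= m0 by rewrite le_max lexx orbT.
have mum : mu x0 <= m0 by rewrite le_max lexx.
have m0t : m0 < th ^+ 2 by rewrite gt_max hmu exprn_gt0.
(* m lies strictly between max(mu x0, 0) and th^2, and eta is half of the remaining gap, so that a <
   th. Below, eps0 makes 3 eps / r, with r = d / 4, fit into th - a. *)
pose m := (m0 + th ^+ 2) / 2; pose eta := (th ^+ 2 - m) / 2.
have et0 : 0 < eta by rewrite /eta /m; lra.
have mm : m0 < m by rewrite /m; lra.
have mt : m < th ^+ 2 by rewrite /m; lra.
have [d d0 hd] := continuous_near (@cmu x0) (e := m - mu x0) ltac:(lra).
have [B B0 hB] := continuous_bounded (x0 - d) (x0 + d) cf.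
pose a := Num.sqrt (m + eta).
have aE : a ^+ 2 = m + eta by rewrite sqr_sqrtr //; lra.
have a0 : 0 < a by rewrite sqrtr_gt0; lra.
have ath : a < th.
  by rewrite -(@ltr_pXn2r _ 2) // ?nnegrE ?(ltW a0) ?(ltW th0) // aE /eta; move: mt; clear; lra.
pose eps0 := Num.min (d * (th - a) / 12) (eta * a / ((Lam + 1) * B)).
have LB : 0 < (Lam + 1) * B by rewrite mulr_gt0 //; lra.
have ep0 : 0 < eps0.
  rewrite lt_min; apply/andP; split; first by rewrite divr_gt0 // mulr_gt0 //; lra.
  by rewrite divr_gt0 // mulr_gt0.
exists (d / 4), eps0; split=> //; first lra.
move=> eps alpha v dv x lm e0 ee al0 alL xx.
have e1 : eps <= d * (th - a) / 12 by apply: le_trans ee _; rewrite ge_min lexx.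
have e2 : eps * ((Lam + 1) * B) <= eta * a.
  by rewrite -ler_pdivlMr //; apply: le_trans ee _; rewrite ge_min lexx orbT.
have inb y : `|y - x| <= d / 4 -> `|y - x0| < d.
  by move=> h; have := ler_normD (y - x) (x - x0); rewrite addrA subrK; lra.
apply: (@le_trans _ _ (a + 3 * eps / (d / 4))).
  apply: (@barrier eps alpha v dv x (d / 4) m eta a B) => //; [exact: divr_gt0|exact: ltW (le_lt_trans m00 mm)| | |].
  - by move=> y /inb /hd /ltr_normlP[]; lra.
  - by move=> y /inb h; apply: hB; move: h; rewrite ltr_norml => /andP[]; lra.
  - apply: le_trans e2; rewrite -mulrA ler_wpM2l ?(ltW e0) // ler_wpM2r ?(ltW B0) //; lra.
have -> : 3 * eps / (d / 4) = 12 * eps / d by field; rewrite gt_eqF.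
have : 12 * eps / d <= th - a.
  by rewrite ler_pdivrMr //; lra.
lra.
Qed.

End Barrier.

(** * Competitors and upper bounds *)

Section Tanh.
Context {R : realType}.
Implicit Types (x y : R).

Lemma tanh_den_gt0 x : 0 < expR x + expR (- x).
Proof. by rewrite addr_gt0 ?expR_gt0. Qed.

Lemma is_derive_tanh x : is_derive x 1 (@tanh R) (1 - tanh x ^+ 2).
Proof.
have D1 : is_derive x 1 (fun y : R => expR y) (expR x) by exact: is_derive_expR.
have D2 : is_derive x 1 (fun y : R => expR (- y)) (- expR (- x)).
  apply: is_derive_eq (is_derive_exp1 (is_derive_opp (is_derive_id1 x))) _; ring.
have den := tanh_den_gt0 x; have dn : expR x + expR (- x) != 0 by rewrite gt_eqF.
have := is_derive_mul (is_derive_add D1 (is_derive_opp D2))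
  (@is_derive_inv _ (fun y => expR y + expR (- y)) x _ dn (is_derive_add D1 D2)).
by move=> H; apply: is_derive_eq H _; rewrite /tanh; field.
Qed.

Lemma tanh0 : tanh (0 : R) = 0.
Proof. by rewrite /tanh oppr0 subrr mul0r. Qed.

Lemma tanhN x : tanh (- x) = - tanh x.
Proof. by rewrite /tanh opprK -mulNr opprB [expR x + _]addrC. Qed.

Lemma tanh_bound x : -1 < tanh x < 1.
Proof.
have e1 := expR_gt0 x; have e2 := expR_gt0 (- x); have d := tanh_den_gt0 x.
by rewrite /tanh ltr_pdivlMr // ltr_pdivrMr // mulN1r mul1r; apply/andP; split; lra.
Qed.

Lemma tanh_ge0 x : 0 <= x -> 0 <= tanh x.
Proof.
move=> x0; rewrite /tanh divr_ge0 ?(ltW (tanh_den_gt0 x)) // subr_ge0 ler_expR; lra.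
Qed.

End Tanh.

Record potential {R : realType} (mu f : R -> R) : Prop := Potential {
  pot_d : forall x : R, is_derive x (1 : R) mu (- 2 * f x);
  pot_cf : continuous f;
  pot_even : forall x : R, mu (- x) = mu x;
  pot_odd : forall x : R, f (- x) = - f x
}.

Lemma pot_cmu {R : realType} (mu f : R -> R) : potential mu f -> continuous mu.
Proof. by move=> p x; exact: is_derive_cvg (pot_d p x). Qed.

Section Competitors.
Context {R : realType} (mu f : R -> R).
Implicit Types (w dw F dF v dv : R -> R) (p q x y c e X Y eps alpha Lam ra rb B sg th b : R).
Hypothesis std : potential mu f.

Definition rho x : R := Num.sqrt (mu x).
Notation s2 := (Num.sqrt (2 : R)).

Lemma s2E : s2 ^+ 2 = 2. Proof. by rewrite sqr_sqrtr. Qed.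
Lemma s2_gt1 : 1 < s2. Proof. by rewrite -[X in X < _]sqrtr1 ltr_sqrt // ltr1n. Qed.

Lemma s2_le2 : s2 <= 2.
Proof.
have s1 := s2_gt1; have := s2E; rewrite expr2.
have : s2 * 1 <= s2 * s2 by rewrite ler_pM2l ?ltW //; lra.
by rewrite mulr1; clear - std; lra.
Qed.

Lemma s2V : s2 = 2 / s2.
Proof.
have s1 := s2_gt1.
by apply: (@mulIf _ s2); rewrite ?divfK -?expr2 ?s2E // gt_eqF //; lra.
Qed.

Lemma rho_sqr x : 0 <= mu x -> rho x ^+ 2 = mu x.
Proof. by move=> h; rewrite sqr_sqrtr. Qed.

Lemma rho_gt0 x : 0 < mu x -> 0 < rho x.
Proof. by move=> h; rewrite sqrtr_gt0. Qed.

Lemma rho_even x : rho (- x) = rho x.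
Proof. by rewrite /rho (pot_even std). Qed.

Lemma continuous_rho : continuous rho.
Proof. by move=> x; apply: (cts_comp (@pot_cmu _ _ _ std x)); exact: sqrt_continuous. Qed.

Lemma is_derive_rho x : 0 < mu x -> is_derive x 1 rho (- f x / rho x).
Proof.
move=> h; have := @is_derive_comp1 _ Num.sqrt mu x _ _ (is_derive1_sqrt h) (pot_d std x).
move=> H; apply: is_derive_eq H _; rewrite -/(rho x); field.
by rewrite gt_eqF // rho_gt0.
Qed.

(** In the variable P a transition has the same width eps wherever it is centred, although rho
    varies. *)
Definition is_len (P : R -> R) : Prop := forall x, is_derive x 1 P (rho x / s2).

Lemma len_exists : exists P, is_len P.
Proof.
have := @antiderivative _ (fun x => rho x / s2) => H; apply: H => x.
by apply: cts_mul; [exact: continuous_rho|exact: cts_cst].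
Qed.

Lemma len_mono (P : R -> R) x y : is_len P -> x <= y -> P x <= P y.
Proof.
move=> lP xy; rewrite -subr_ge0 -(mul0r (y - x)).
apply: (derive_cst_ge xy (fun z _ => lP z)) => z _.
by rewrite divr_ge0 ?sqrtr_ge0.
Qed.

Lemma len_odd (P : R -> R) x y : is_len P -> P (- x) - P (- y) = P y - P x.
Proof.
move=> lP.
have D (z : R) : is_derive z (1 : R) (fun z => P z + P (- z)) (0 : R).
  have := is_derive_add (lP z) (is_derive_reflect (lP (- z))).
  by move=> H; apply: is_derive_eq H _; rewrite rho_even subrr.
have := is_derive_0_is_cst x y D; lra.
Qed.

(* The exact transition profile sigma rho tanh((P - P y)/eps), P' = rho / sqrt 2, solves
   eps t' = rho (1 - t^2) / sqrt 2; its energy is a total derivative up to O(eps). *)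
Lemma half_transition (P : R -> R) eps alpha Lam y q sg ra rb B : is_len P -> 0 < eps -> 0 <= alpha -> alpha <= Lam ->
  y < q -> sg ^+ 2 = 1 -> 0 < ra ->
  (forall x, y <= x <= q -> [/\ 0 < mu x, ra <= rho x, rho x <= rb & `|f x| <= B]) ->
  joins mu f eps alpha y 0 q (sg * rho q * tanh ((P q - P y) / eps))
    ((s2 - sg * alpha) * rho y ^+ 3 / 3 + sg * alpha * rho q ^+ 3 / 3
     + eps * (2 * rb * B * (3 + Lam) / ra + B + B ^+ 2 / ra ^+ 2 * (q - y))).
Proof.
move=> lP e0 al0 alL yq sg1 ra_gt0 H.
have s20 : 0 < s2 by have := s2_gt1; lra.
have sgn : `|sg| = 1 by exact: sign_norm sg1.
pose t x := tanh ((P x - P y) / eps).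
pose dt x := (1 - t x ^+ 2) * (rho x / s2 / eps).
have Dt x : is_derive x 1 t (dt x).
  apply: is_derive_comp1; first exact: is_derive_tanh.
  have := is_derive_mul (is_derive_add (lP x) (is_derive_cst1 (- P y) x)) (is_derive_cst1 eps^-1 x).
  by move=> H'; apply: is_derive_eq H' _; rewrite mulr0 add0r addr0 mulrC.
have ct : continuous t by move=> x; exact: is_derive_cvg (Dt x).
pose w x := sg * (rho x * t x).
pose dw x := sg * (rho x * dt x + t x * (- f x / rho x)).
have Dw x : y <= x <= q -> is_derive x 1 w (dw x).
  move=> /H[mx _ _ _]; have := is_derive_mul (is_derive_cst1 sg x) (is_derive_mul (is_derive_rho mx) (Dt x)).
  by move=> H'; apply: is_derive_eq H' _; rewrite mulr0 addr0.
have cdw x : y <= x <= q -> continuous_at x dw.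
  move=> /H[mx rx _ _]; apply: cts_mul; first exact: cts_cst.
  apply: cts_add; apply: cts_mul.
  - exact: continuous_rho.
  - apply: cts_mul.
      by apply: cts_add; [exact: cts_cst|apply/cts_opp/cts_exp/ct].
    by apply: cts_mul; [apply: cts_mul; [exact: continuous_rho|]|]; exact: cts_cst.
  - exact: ct.
  - apply: cts_mul; first by apply: cts_opp; exact: (@pot_cf _ _ _ std).
    apply: (cts_comp (@continuous_rho x)); apply: inv_continuous.
    by rewrite gt_eqF // rho_gt0.
pose C1 := 2 * rb * B * (3 + Lam) / ra + B.
pose C3 := B ^+ 2 / ra ^+ 2.
(* The C3 term pays for the square of the part t rho' of the slope; the C1 term pays for errors
   proportional to dt, whose total is bounded because t stays below 1. *)
pose F x := rho x ^+ 3 * (t x - t x ^+ 3 / 3) / s2 - (s2 - sg * alpha) / 3 * rho x ^+ 3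
   + eps * C1 * t x + eps * C3 * x.
pose dF x := (rho x ^+ 3 * ((1 - t x ^+ 2) * dt x) - 3 * rho x * f x * (t x - t x ^+ 3 / 3)) / s2
   + (s2 - sg * alpha) * rho x * f x + eps * C1 * dt x + eps * C3.
have DF x : y <= x <= q -> is_derive x 1 F (dF x).
  move=> /H[mx rx _ _]; have Dr := is_derive_rho mx; have rp := rho_gt0 mx.
  have D3 := is_derive_exp 3 Dr.
  have := is_derive_add (is_derive_add (is_derive_add
    (is_derive_mul (is_derive_mul D3 (is_derive_add (Dt x) (is_derive_opp
       (is_derive_mul (is_derive_exp 3 (Dt x)) (is_derive_cst1 (3^-1) x))))) (is_derive_cst1 (s2^-1) x))
    (is_derive_opp (is_derive_mul (is_derive_cst1 ((s2 - sg * alpha) / 3) x) D3)))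
    (is_derive_mul (is_derive_cst1 (eps * C1) x) (Dt x)))
    (is_derive_mul (is_derive_cst1 (eps * C3) x) (is_derive_id1 x)).
  move=> H'; apply: is_derive_eq H' _; rewrite /dF /=.
  by field; rewrite !gt_eqF.
have [By0 rb0] : 0 <= B /\ 0 < rb.
  have [_ h1 h2 h3] := H y ltac:(by rewrite lexx ltW); split; [exact: le_trans h3|lra].
have Py x : y <= x -> 0 <= t x.
  move=> yx; apply: tanh_ge0; rewrite divr_ge0 ?(ltW e0) // subr_ge0; exact: len_mono.
have t1 x : t x < 1 by have /andP[] := tanh_bound ((P x - P y) / eps).
have le x : y <= x <= q -> dens mu f eps alpha w dw x <= dF x.
  move=> hx; have [mx rx xR fB] := H x hx; have rp := rho_gt0 mx.
  have muE := rho_sqr (ltW mx).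
  have T0 : 0 <= t x by apply: Py; case/andP: hx.
  have T1 := t1 x.
  have dtE : eps * dt x * s2 = rho x * (1 - t x ^+ 2).
    by rewrite /dt; field; rewrite !gt_eqF.
  have tt : t x ^+ 2 <= t x by rewrite expr2 ler_piMr // ltW.
  have dt0 : 0 <= dt x by rewrite mulr_ge0 ?subr_ge0 ?(le_trans tt) ?(ltW T1) // !divr_ge0 ?sqrtr_ge0 // ltW.
  have rem1 : eps / 2 * (t x * (- f x / rho x)) ^+ 2 <= eps * C3.
    have b1 : (f x / rho x) ^+ 2 <= C3.
      rewrite /C3 -[B ^+ 2 / _]expr_div_n -(real_normK (num_real (f x / rho x))).
      rewrite lerXn2r ?nnegrE ?divr_ge0 ?(ltW ra_gt0) // normrM normfV (gtr0_norm rp).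
      by rewrite ler_pM // ?invr_ge0 ?(ltW rp) // lef_pV2 ?posrE.
    have b2 : (t x) ^+ 2 <= 1 by lra.
    have b3 : (t x * (- f x / rho x)) ^+ 2 <= C3.
      rewrite mulNr mulrN sqrrN exprMn; apply: le_trans b1.
      by rewrite ler_piMl ?sqr_ge0.
    have : 0 <= eps * (C3 - (t x * (- f x / rho x)) ^+ 2) by rewrite mulr_ge0 ?(ltW e0) // subr_ge0.
    have : 0 <= eps * C3 by rewrite mulr_ge0 ?(ltW e0) // divr_ge0 ?sqr_ge0.
    by clear - std; lra.
  have rem2 : - (eps * f x * t x * dt x) <= eps * B * dt x.
    rewrite (_ : - _ = eps * dt x * (- f x * t x)); last by ring.
    rewrite (_ : eps * B * dt x = eps * dt x * B); last by ring.
    rewrite ler_wpM2l //; first exact: mulr_ge0 (ltW e0) dt0.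
    apply: le_trans (ler_norm _) _; rewrite normrM normrN.
    by rewrite (ger0_norm T0) -[leRHS]mulr1 ler_pM // ltW.
  (* The bracket vanishes at t = 1, and 1 - t is itself O(eps dt): away from y the forcing
     contributes nothing beyond the exact derivative of rho^3. *)
  have rem3 : rho x * f x * (3 / s2 * (t x - t x ^+ 3 / 3) - sg * alpha * t x - (s2 - sg * alpha))
     <= eps * (2 * rb * B * (3 + Lam) / ra) * dt x.
    have E1 : 3 / s2 * (t x - t x ^+ 3 / 3) - sg * alpha * t x - (s2 - sg * alpha) =
       - (1 - t x) * ((1 - t x) * (2 + t x) / s2 - sg * alpha).
      by rewrite [in X in _ - (X - _)]s2V; field; rewrite gt_eqF.
    have i2 : s2^-1 <= 1 by rewrite invf_le1 // ltW // s2_gt1.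
    have i0 : 0 < s2^-1 by rewrite invr_gt0.
    have E2 : `|(1 - t x) * (2 + t x) / s2 - sg * alpha| <= 3 + Lam.
      apply: le_trans (ler_normB _ _) _; apply: lerD; last first.
        by rewrite normrM sgn mul1r ger0_norm.
      have u1 : 0 <= (1 - t x) * (2 + t x) by apply: mulr_ge0; [rewrite subr_ge0 ltW|rewrite addr_ge0].
      rewrite ger0_norm; last exact: mulr_ge0 u1 (ltW i0).
      apply: (@le_trans _ _ ((1 - t x) * (2 + t x) * 1)); first by rewrite ler_wpM2l.
      by move: T0 (sqr_ge0 (t x)); clear - std; lra.
    have E3 : 1 - t x <= 2 * eps * dt x / ra.
      rewrite ler_pdivlMr //.
      have a1 : (1 - t x) * ra <= (1 - t x) * rho x by rewrite ler_wpM2l //; lra.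
      have a2 : (1 - t x) * rho x <= rho x * (1 - t x ^+ 2).
        by rewrite mulrC ler_wpM2l ?(ltW rp) //; lra.
      have s22 := s2_le2.
      have a3 : eps * dt x * s2 <= eps * dt x * 2 by rewrite ler_wpM2l //; exact: mulr_ge0 (ltW e0) dt0.
      by move: a1 a2 a3 dtE; clear - std; lra.
    have E4 : `|rho x * f x| <= rb * B by rewrite normrM (gtr0_norm rp) ler_pM // ltW.
    rewrite E1; apply: le_trans (ler_norm _) _.
    have T1' : 0 <= 1 - t x by rewrite subr_ge0 ltW.
    rewrite normrM [X in _ * X <= _]normrM normrN (ger0_norm T1').
    apply: (@le_trans _ _ (rb * B * ((2 * eps * dt x / ra) * (3 + Lam)))).
      apply: ler_pM => //; first by rewrite mulr_ge0.
      by apply: ler_pM.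
    by rewrite (_ : rb * B * _ = eps * (2 * rb * B * (3 + Lam) / ra) * dt x) //; field; rewrite gt_eqF.
  have wE : w x ^+ 2 = rho x ^+ 2 * t x ^+ 2 by rewrite /w exprMn sg1 mul1r exprMn.
  have sq : dw x ^+ 2 = rho x ^+ 2 * dt x ^+ 2 - 2 * f x * t x * dt x + (t x * (- f x / rho x)) ^+ 2.
    by rewrite /dw exprMn sg1 mul1r; field; rewrite gt_eqF.
  rewrite /dens wE sq -muE.
  (* Equipartition: the profile equation makes the gradient and the potential parts equal, so their
     sum is a perfect product. *)
  have dtE2 : eps / 2 * (rho x ^+ 2 * dt x ^+ 2) + (4 * eps)^-1 * (rho x ^+ 2 * t x ^+ 2 - rho x ^+ 2) ^+ 2
     = rho x ^+ 3 * ((1 - t x ^+ 2) * dt x) / s2.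
    rewrite /dt; have e : s2 ^- 2 = 2^-1 by rewrite s2E.
    have -> : rho x ^+ 3 * ((1 - t x ^+ 2) * ((1 - t x ^+ 2) * (rho x / s2 / eps))) / s2 =
        rho x ^+ 4 * (1 - t x ^+ 2) ^+ 2 / eps * s2 ^- 2 by field; rewrite !gt_eqF.
    have -> : (rho x ^+ 2 * ((1 - t x ^+ 2) * (rho x / s2 / eps)) ^+ 2) =
        rho x ^+ 4 * (1 - t x ^+ 2) ^+ 2 / eps ^+ 2 * s2 ^- 2 by field; rewrite !gt_eqF.
    by rewrite e; field; rewrite gt_eqF.
  have -> : dF x = rho x ^+ 3 * ((1 - t x ^+ 2) * dt x) / s2 + eps * C3 + eps * B * dt x
     + eps * (2 * rb * B * (3 + Lam) / ra) * dt x - alpha * f x * w x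
     - rho x * f x * (3 / s2 * (t x - t x ^+ 3 / 3) - sg * alpha * t x - (s2 - sg * alpha)).
    by rewrite /dF /w /C1; ring.
  by move: dtE2 rem1 rem2 rem3; clear - std; lra.
have wy : w y = 0 by rewrite /w /t subrr mul0r tanh0 !mulr0.
have wq : w q = sg * rho q * tanh ((P q - P y) / eps) by rewrite /w mulrA.
rewrite -wy -wq; apply: (joins_piece yq Dw cdw DF le).
rewrite /F (_ : t y = 0); last by rewrite /t subrr mul0r tanh0.
have [mq _ _ _] := H q ltac:(by rewrite lexx ltW).
have Tq := t1 q; have Tq0 := Py q (ltW yq).
have Tb : t q - t q ^+ 3 / 3 <= 2 / 3.
  rewrite -subr_ge0 (_ : _ - _ = (1 - t q) * (1 - t q) * (2 + t q) / 3); last by field.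
  by rewrite divr_ge0 // !mulr_ge0 //; lra.
have i1 : rho q ^+ 3 * (t q - t q ^+ 3 / 3) / s2 <= s2 * rho q ^+ 3 / 3.
  have -> : s2 * rho q ^+ 3 / 3 = rho q ^+ 3 * (2 / 3) / s2.
    by rewrite [in LHS]s2V; field; rewrite gt_eqF.
  by rewrite ler_pM2r ?invr_gt0 // ler_pM2l // exprn_gt0 // rho_gt0.
have [L0 BR] : 0 <= 3 + Lam /\ 0 <= C1.
  by rewrite /C1; split; [lra|rewrite addr_ge0 // divr_ge0 ?(ltW ra_gt0) // !mulr_ge0 //; lra].
have i2 : eps * C1 * t q <= eps * C1 by rewrite ler_piMr ?mulr_ge0 // ltW.
rewrite /C1 /C3 in i2 *; move: i1 i2; clear - std.
by rewrite expr0n /= ; lra.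
Qed.

Lemma joins_le eps alpha p X q Y e e' : joins mu f eps alpha p X q Y e -> e <= e' ->
  joins mu f eps alpha p X q Y e'.
Proof.
move=> H; elim: H e' => {p X q Y e} [p q w dw F dF e pq D c DF le Fe e' ee'|p P c X q Q e1 e2 j1 h1 j2 h2 e' ee'].
  exact: joins_piece pq D c DF le (le_trans Fe ee').
rewrite (_ : e' = e1 + (e' - e1)); last by ring.
by apply: joins_cat j1 _; apply: h2; rewrite lerBrDl.
Qed.

Lemma half_transition_left (P : R -> R) eps alpha Lam p y sg ra rb B : is_len P -> 0 < eps -> 0 <= alpha -> alpha <= Lam ->
  p < y -> sg ^+ 2 = 1 -> 0 < ra ->
  (forall x, p <= x <= y -> [/\ 0 < mu x, ra <= rho x, rho x <= rb & `|f x| <= B]) ->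
  joins mu f eps alpha p (- (sg * rho p * tanh ((P y - P p) / eps))) y 0
    ((s2 - sg * alpha) * rho y ^+ 3 / 3 + sg * alpha * rho p ^+ 3 / 3
     + eps * (2 * rb * B * (3 + Lam) / ra + B + B ^+ 2 / ra ^+ 2 * (y - p))).
Proof.
move=> lP e0 al0 alL py sg1 ra_gt0 H.
have H' x : - y <= x <= - p -> [/\ 0 < mu x, ra <= rho x, rho x <= rb & `|f x| <= B].
  move=> hx; have := H (- x) ltac:(lra).
  by rewrite (pot_even std) rho_even (pot_odd std) normrN.
have := half_transition lP e0 al0 alL (_ : - y < - p) sg1 ra_gt0 H'.
move=> /(_ ltac:(by rewrite ltrN2)) /(joins_hat (pot_even std) (pot_odd std)).
by rewrite !opprK oppr0 !rho_even (len_odd _ _ lP) [- p + y]addrC.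
Qed.

(** An affine path over a length eps. Its slope and the potential are both of order 1 / eps in the
    density, which the length compensates, so the cost is O(tau^2) uniformly in eps. *)
Lemma layer eps alpha Lam p X Y tau B : 0 < eps -> 0 <= alpha -> alpha <= Lam ->
  `|X| <= tau -> `|Y| <= tau ->
  (forall x, p <= x <= p + eps -> `|mu x| <= tau ^+ 2 /\ `|f x| <= B) ->
  joins mu f eps alpha p X (p + eps) Y (2 * tau ^+ 2 + tau ^+ 4 + eps * (Lam * B * tau)).
Proof.
move=> e0 al0 alL hX hY H.
have tau0 : 0 <= tau := le_trans (normr_ge0 _) hX.
have B0 : 0 <= B by have [_ h] := H p ltac:(lra); exact: le_trans h.
pose s := (Y - X) / eps.
pose w x := X + s * (x - p).
have Dw x : is_derive x 1 w s.
  have := is_derive_add (is_derive_cst1 X x) (is_derive_mul (is_derive_cst1 s x)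
    (is_derive_add (is_derive_id1 x) (is_derive_cst1 (- p) x))).
  by move=> H'; apply: is_derive_eq H' _; ring.
pose k := eps / 2 * s ^+ 2 + (4 * eps)^-1 * (2 * tau ^+ 2) ^+ 2 + Lam * B * tau.
have Dk x : is_derive x 1 (fun x => k * x) k.
  have := is_derive_mul (is_derive_cst1 k x) (is_derive_id1 x).
  by move=> H'; apply: is_derive_eq H' _; ring.
have wb x : p <= x <= p + eps -> `|w x| <= tau.
  move=> /andP[h1 h2].
  have [t [t0 t1 ->]] : exists t : R, [/\ 0 <= t, t <= 1 & w x = (1 - t) * X + t * Y].
    exists ((x - p) / eps); split; first by rewrite divr_ge0 ?subr_ge0 // ltW.
      by rewrite ler_pdivrMr // mul1r lerBlDl.
    by rewrite /w /s; field; rewrite gt_eqF.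
  apply: le_trans (ler_normD _ _) _; rewrite !normrM (ger0_norm t0) ger0_norm ?subr_ge0 //.
  apply: (@le_trans _ _ ((1 - t) * tau + t * tau)).
    by apply: lerD; rewrite ler_wpM2l // subr_ge0.
  by rewrite -mulrDl subrK mul1r.
have le x : p <= x <= p + eps -> dens mu f eps alpha w (fun=> s) x <= k.
  move=> hx; have [m1 f1] := H x hx; have w1 := wb x hx.
  rewrite /dens /k; apply: lerD; first apply: lerD => //.
    rewrite ler_wpM2l ?invr_ge0 ?mulr_ge0 ?(ltW e0) // -(real_normK (num_real (w x ^+ 2 - mu x))).
    rewrite lerXn2r ?nnegrE ?mulr_ge0 ?sqr_ge0 // (le_trans (ler_normB _ _)) //.
    rewrite normrX mulr_natl mulr2n lerD // lerXn2r // nnegrE.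
  apply: le_trans (ler_norm _) _; rewrite normrN !normrM (ger0_norm al0).
  by apply: ler_pM => //; [exact: mulr_ge0|exact: ler_pM].
have -> : X = w p by rewrite /w subrr mulr0 addr0.
have -> : Y = w (p + eps) by rewrite /w /s; field; rewrite gt_eqF.
apply: (joins_piece _ (fun x _ => Dw x) (fun x _ => @cts_cst _ s x) (fun x _ => Dk x) le); first lra.
have -> : k * (p + eps) - k * p = (Y - X) ^+ 2 / 2 + tau ^+ 4 + eps * (Lam * B * tau).
  by rewrite /k /s; field; rewrite gt_eqF.
rewrite !lerD2r.
have : (Y - X) ^+ 2 <= (2 * tau) ^+ 2.
  rewrite -(real_normK (num_real (Y - X))) lerXn2r ?nnegrE ?mulr_ge0 //.
  by rewrite (le_trans (ler_normB _ _)) // mulr_natl mulr2n lerD.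
by rewrite exprMn; clear - std; lra.
Qed.

Lemma potential_bounds b : 0 < b -> (forall x, `|x| <= b -> 0 < mu x) ->
  exists ra rb B, 0 < ra /\ forall x, - b <= x <= b ->
   [/\ 0 < mu x, ra <= rho x, rho x <= rb & `|f x| <= B].
Proof.
move=> b0 hmu; have bb : - b <= b by lra.
have [B B0 hB] := continuous_bounded (- b) b (pot_cf std).
have [rb rb0 hrb] := continuous_bounded (- b) b continuous_rho.
have [z zb hz] := EVT_min bb (continuous_within (fun x _ => @continuous_rho x)).
have mz : 0 < mu z by apply: hmu; rewrite ler_norml; move: zb; rewrite in_itv.
exists (rho z), rb, B; split; first exact: rho_gt0.
move=> x hx; split.
- by apply: hmu; rewrite ler_norml.
- by apply: hz; rewrite in_itv.
- by have := hrb x hx; rewrite ger0_norm // sqrtr_ge0.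
- exact: hB.
Qed.

(** Near b and -b the barrier makes v of order th because mu < th^2 there; competitors can then be
    attached to v at small cost. *)
Lemma boundary_data b th Lam : 0 < b -> 0 < th -> 0 <= Lam -> mu b < th ^+ 2 ->
  exists d eps0, [/\ 0 < d, 0 < eps0,
    (forall x, `|x - b| <= d \/ `|x + b| <= d -> mu x < th ^+ 2) &
    (forall eps alpha v dv x, local_minimizer mu f eps alpha v dv -> 0 < eps -> eps <= eps0 ->
      0 <= alpha -> alpha <= Lam -> `|x - b| <= d \/ `|x + b| <= d -> `|v x| <= 2 * th)].
Proof.
move=> b0 th0 L0 hb.
have hb2 : mu b < (2 * th) ^+ 2.
  apply: lt_trans hb _; rewrite exprMn; have : 0 < th ^+ 2 by rewrite exprn_gt0.
  by clear - std; lra.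
have hb2' : mu (- b) < (2 * th) ^+ 2 by rewrite (pot_even std).
have th2 : 0 < 2 * th by rewrite mulr_gt0.
have [d1 [e1 [d10 e10 h1]]] := small_near (pot_d std) (pot_cf std) L0 th2 hb2.
have [d2 [e2 [d20 e20 h2]]] := small_near (pot_d std) (pot_cf std) L0 th2 hb2'.
have [d3 d30 h3] := continuous_near (@pot_cmu _ _ _ std b) (e := th ^+ 2 - mu b) ltac:(lra).
pose d := Num.min (Num.min d1 d2) (d3 / 2).
have dd1 : d <= d1 by rewrite !ge_min lexx.
have dd2 : d <= d2 by rewrite !ge_min lexx orbT.
have dd3 : d <= d3 / 2 by rewrite !ge_min lexx !orbT.
exists d, (Num.min e1 e2); split.
- by rewrite !lt_min d10 d20 divr_gt0.
- by rewrite lt_min e10 e20.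
- have K y : `|y - b| <= d -> mu y < th ^+ 2.
    move=> hy; have : `|y - b| < d3 by lra.
    by move=> /h3 /ltr_normlP[]; lra.
  by move=> x [/K //|hx]; rewrite -(pot_even std); apply: K; rewrite -opprD normrN.
move=> eps alpha v dv x lm e0; rewrite le_min => /andP[ee1 ee2] al0 alL [hx|hx].
  by apply: (h1 _ _ _ _ _ lm) => //; exact: le_trans dd1.
by apply: (h2 _ _ _ _ _ lm) => //; rewrite opprK; exact: le_trans dd2.
Qed.

(** The inner path stops at distance eps from the ends, and [layer] fills the two gaps. The leftover
    alpha rho(b - eps)^3 is negligible because rho <= th there. *)
Lemma upper_of_inner b th Lam (cost : R -> R) K e1 : 0 < b -> 0 < th -> th <= 1 -> 0 <= Lam ->
  (forall x, `|x| <= b -> 0 < mu x) -> mu b < th ^+ 2 -> 0 <= K -> 0 < e1 ->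
  (forall eps alpha, 0 < eps -> eps <= e1 -> 0 <= alpha -> alpha <= Lam -> exists X Y,
     [/\ `|X| <= rho (b - eps), `|Y| <= rho (b - eps) &
      joins mu f eps alpha (- (b - eps)) X (b - eps) Y
        (cost alpha + 2 * alpha * rho (b - eps) ^+ 3 / 3 + eps * K)]) ->
  exists2 eps0 : R, 0 < eps0 & forall eps alpha v dv F,
    local_minimizer mu f eps alpha v dv -> 0 < eps -> eps <= eps0 -> 0 <= alpha -> alpha <= Lam ->
    (forall x, is_derive x 1 F (dens mu f eps alpha v dv x)) ->
    F b - F (- b) <= cost alpha + (50 + Lam) * th ^+ 2.
Proof.
move=> b0 th0 th1 L0 hmu hb K0 e10 inner.
have [d [e2 [d0 e20 hd hv]]] := boundary_data b0 th0 L0 hb.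
have [B B0 hB] := continuous_bounded (- b) b (pot_cf std).
have t20 : 0 < th ^+ 2 by rewrite exprn_gt0.
(* All terms of order eps: the inner error K and the forcing in two layers with tau = 2 th. *)
pose C := K + 4 * (Lam * B * th).
have C0 : 0 <= C by rewrite addr_ge0 // !mulr_ge0 // ltW.
pose e3 := th ^+ 2 / (C + 1).
have e30 : 0 < e3 by rewrite divr_gt0 //; move: C0; clear - std; lra.
pose e0 := Num.min (Num.min e1 e2) (Num.min e3 (Num.min d (b / 2))).
exists e0; first by rewrite !lt_min e10 e20 e30 d0 divr_gt0.
move=> eps alpha v dv F lm ep0; rewrite !le_min => /andP[/andP[ee1 ee2] /and3P[ee3 eed eeb]] al0 alL DF.
have [X [Y [hX hY J]]] := inner eps alpha ep0 ee1 al0 alL.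
have mupos x : - b <= x <= b -> 0 < mu x by move=> hx; apply: hmu; rewrite ler_norml.
have near_b x : b - eps <= x <= b -> `|x - b| <= d.
  by move: eed; clear - std; move=> h /andP[h1 h2]; rewrite ler_norml; apply/andP; split; lra.
have near_Nb x : - b <= x <= - b + eps -> `|x + b| <= d.
  by move: eed; clear - std; move=> h /andP[h1 h2]; rewrite ler_norml; apply/andP; split; lra.
have rq : rho (b - eps) <= th.
  have h1 : mu (b - eps) < th ^+ 2 by apply: hd; left; apply: near_b; move: ep0; clear - std; lra.
  have h2 : 0 < mu (b - eps) by apply: mupos; move: ep0 eeb b0; clear - std; lra.
  by rewrite -(@ler_pXn2r _ 2) // ?nnegrE ?sqrtr_ge0 ?(ltW th0) // rho_sqr ltW.
have thle : th <= 2 * th by move: th0; clear - std; lra.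
have mb x : mu x < th ^+ 2 -> - b <= x <= b -> `|mu x| <= (2 * th) ^+ 2.
  move=> h1 /mupos h2; rewrite (gtr0_norm h2) exprMn.
  by move: h1 t20; clear - std; lra.
have vb : `|v b| <= 2 * th by apply: (hv _ _ _ _ _ lm) => //; left; apply: near_b; move: ep0; clear - std; lra.
have vNb : `|v (- b)| <= 2 * th by apply: (hv _ _ _ _ _ lm) => //; right; apply: near_Nb; move: ep0; clear - std; lra.
have J1 := @layer eps alpha Lam (- b) (v (- b)) X (2 * th) B ep0 al0 alL vNb
   (le_trans hX (le_trans rq thle)).
have {}J1 := J1 _.
have J2 := @layer eps alpha Lam (b - eps) Y (v b) (2 * th) B ep0 al0 alL
   (le_trans hY (le_trans rq thle)) vb.
have H1 x : - b <= x <= - b + eps -> `|mu x| <= (2 * th) ^+ 2 /\ `|f x| <= B.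
  move=> hx; have hx' : - b <= x <= b by move: hx eeb b0; clear - std; move=> /andP[h1 h2]; lra.
  by split; [apply: mb => //; apply: hd; right; exact: near_Nb|exact: hB].
have H2 x : b - eps <= x <= b - eps + eps -> `|mu x| <= (2 * th) ^+ 2 /\ `|f x| <= B.
  rewrite subrK => hx; have hx' : - b <= x <= b by move: hx eeb b0; clear - std; move=> /andP[h1 h2]; lra.
  by split; [apply: mb => //; apply: hd; left; exact: near_b|exact: hB].
have {}J2 := J2 H2; have {}J1 := J1 H1.
rewrite subrK in J2; rewrite [- b + eps]addrC -[eps - b]opprB in J1.
have := lm_min lm (joins_cat (joins_cat J1 J) J2) DF.
move=> /le_trans; apply.
(* Two layers with tau = 2 th cost at most 48 th^2; the term in alpha rho^3 adds at most Lam th^2,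
   and the terms in eps at most th^2, all within (50 + Lam) th^2. *)
have r3 : alpha * rho (b - eps) ^+ 3 <= Lam * th ^+ 2.
  apply: ler_pM => //; first by rewrite exprn_ge0 // sqrtr_ge0.
  apply: (@le_trans _ _ (th ^+ 3)); first by rewrite lerXn2r ?nnegrE ?sqrtr_ge0 ?(ltW th0).
  by rewrite exprS ler_piMl // ltW.
have r4 : th ^+ 4 <= th ^+ 2.
  by rewrite (_ : 4 = 2 + 2)%N // exprD ler_piMl ?(ltW t20) // exprn_ile1 // ltW.
have r5 : eps * C <= th ^+ 2.
  apply: (@le_trans _ _ (e3 * (C + 1))).
    by apply: ler_pM => //; [exact: ltW|move: C0; clear - std; lra].
  by rewrite /e3 divfK // gt_eqF //; move: C0; clear - std; lra.
have r6 : 0 <= Lam * th ^+ 2 by rewrite mulr_ge0 // ltW.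
rewrite /C in r5; move: r3 r4 r5 r6 t20; clear - std; rewrite !exprMn; lra.
Qed.

Lemma tanh_mul_le (r x : R) : 0 <= r -> `|r * tanh x| <= r.
Proof.
move=> r0; rewrite normrM (ger0_norm r0) ler_piMr // ler_norml.
by have /andP[h1 h2] := tanh_bound x; rewrite !ltW.
Qed.

(** A single upward transition, made of [half_transition] and its mirror image. The centre y stays
    free: it will be 0, zeta, or a point close to xi. *)
Lemma upper_one b th Lam y : 0 < b -> 0 < th -> th <= 1 -> 0 <= Lam ->
  (forall x, `|x| <= b -> 0 < mu x) -> mu b < th ^+ 2 -> `|y| < b ->
  exists2 eps0 : R, 0 < eps0 & forall eps alpha v dv F,
    local_minimizer mu f eps alpha v dv -> 0 < eps -> eps <= eps0 -> 0 <= alpha -> alpha <= Lam ->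
    (forall x, is_derive x 1 F (dens mu f eps alpha v dv x)) ->
    F b - F (- b) <= 2 / 3 * (s2 - alpha) * rho y ^+ 3 + (50 + Lam) * th ^+ 2.
Proof.
move=> b0 th0 th1 L0 hmu hb yb.
have [P lP] := len_exists.
have [ra [rb [B [ra0 H]]]] := potential_bounds b0 hmu.
have [_ u1 u2 u3] := H b ltac:(by rewrite lexx andbT; lra).
have B0 : 0 <= B := le_trans (normr_ge0 _) u3.
have rb0 : 0 <= rb by lra.
pose K0 := 2 * rb * B * (3 + Lam) / ra + B.
have K00 : 0 <= K0 by rewrite addr_ge0 // divr_ge0 ?(ltW ra0) // !mulr_ge0 // addr_ge0.
pose K1 := B ^+ 2 / ra ^+ 2.
have K10 : 0 <= K1 by rewrite divr_ge0 ?sqr_ge0.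
apply: (@upper_of_inner b th Lam (fun alpha => 2 / 3 * (s2 - alpha) * rho y ^+ 3) (2 * K0 + K1 * (2 * b)) ((b - `|y|) / 2)) => //.
- by apply: addr_ge0; apply: mulr_ge0 => //; apply: mulr_ge0 => //; exact: ltW.
- lra.
move=> eps alpha e0 ee al0 alL.
have yp : - (b - eps) < y by have := ler_norm (- y); rewrite normrN; lra.
have yq : y < b - eps by have := ler_norm y; lra.
have hr := rho_even (b - eps).
exists (- (1 * rho (- (b - eps)) * tanh ((P y - P (- (b - eps))) / eps))),
       (1 * rho (b - eps) * tanh ((P (b - eps) - P y) / eps)); split.
- by rewrite normrN mul1r hr tanh_mul_le // sqrtr_ge0.
- by rewrite mul1r tanh_mul_le // sqrtr_ge0.
have sub x : - (b - eps) <= x <= b - eps -> - b <= x <= b by lra.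
have J1 := @half_transition_left P eps alpha Lam (- (b - eps)) y 1 ra rb B lP e0 al0 alL yp (expr1n _ _) ra0
   (fun x hx => H x (sub x ltac:(lra))).
have J2 := @half_transition P eps alpha Lam y (b - eps) 1 ra rb B lP e0 al0 alL yq (expr1n _ _) ra0
   (fun x hx => H x (sub x ltac:(lra))).
apply: joins_le (joins_cat J1 J2) _.
rewrite hr -/K0 -/K1.
have : 0 <= eps * (K1 * eps) by apply: mulr_ge0; [exact: ltW|apply: mulr_ge0 => //; exact: ltW].
by clear - std; lra.
Qed.

(** The competitor is odd, with transitions at -z, 0 and z: its left half goes up at -z and down to
    the value 0 at the origin, and reflection supplies the right half. *)
Lemma upper_three b th Lam z : 0 < b -> 0 < th -> th <= 1 -> 0 <= Lam ->
  (forall x, `|x| <= b -> 0 < mu x) -> mu b < th ^+ 2 -> 0 < z -> z < b ->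
  exists2 eps0 : R, 0 < eps0 & forall eps alpha v dv F,
    local_minimizer mu f eps alpha v dv -> 0 < eps -> eps <= eps0 -> 0 <= alpha -> alpha <= Lam ->
    (forall x, is_derive x 1 F (dens mu f eps alpha v dv x)) ->
    F b - F (- b) <= 2 / 3 * (2 * (s2 - alpha) * rho z ^+ 3 + (s2 + alpha) * rho 0 ^+ 3) + (50 + Lam) * th ^+ 2.
Proof.
move=> b0 th0 th1 L0 hmu hb z0 zb.
have [P lP] := len_exists.
have [ra [rb [B [ra0 H]]]] := potential_bounds b0 hmu.
have [_ u1 u2 u3] := H b ltac:(by rewrite lexx andbT; lra).
have B0 : 0 <= B := le_trans (normr_ge0 _) u3.
have rb0 : 0 <= rb by lra.
pose K0 := 2 * rb * B * (3 + Lam) / ra + B.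
have K00 : 0 <= K0 by rewrite addr_ge0 // divr_ge0 ?(ltW ra0) // !mulr_ge0 // addr_ge0.
pose K1 := B ^+ 2 / ra ^+ 2.
have K10 : 0 <= K1 by rewrite divr_ge0 ?sqr_ge0.
(* the two transitions meet at equal P-distance from their centres *)
have [c /andP[c1 c2] cE] : exists2 c : R, - z <= c <= 0 & 2 * P c - (P 0 + P (- z)) = 0.
  apply: (@ivt _ (fun c => 2 * P c - (P 0 + P (- z)))) => [|x|]; first lra.
    apply: cts_add; last exact: cts_cst.
    by apply: cts_mul; [exact: cts_cst|exact: is_derive_cvg (lP x)].
  have := @len_mono P (- z) 0 lP ltac:(lra); clear - std; move=> h; apply/andP; split; lra.
have rzp : 0 < rho z by apply/rho_gt0/hmu; rewrite gtr0_norm // ltW.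
have Pz : P (- z) < P 0.
  have [|xi /andP[x1 x2] E] := @mvt _ P (fun x => rho x / s2) (- z) 0 _ (fun x _ => lP x); first lra.
  rewrite -subr_gt0 E; apply: mulr_gt0; last lra.
  have s20 : 0 < s2 by have := s2_gt1; clear - std; lra.
  apply: divr_gt0 s20; apply/rho_gt0/hmu; rewrite ler_norml; move: x1 x2 z0 zb; clear - std; lra.
have c1' : - z < c.
  by rewrite lt_neqAle c1 andbT; apply/negP => /eqP h; move: cE Pz; rewrite -h; clear - std; lra.
have c2' : c < 0.
  by rewrite lt_neqAle c2 andbT; apply/negP => /eqP h; move: cE Pz; rewrite h; clear - std; lra.
apply: (@upper_of_inner b th Lam (fun alpha => 2 / 3 * (2 * (s2 - alpha) * rho z ^+ 3 + (s2 + alpha) * rho 0 ^+ 3))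
   (6 * K0 + K1 * (2 * b)) ((b - z) / 2)) => //.
- by apply: addr_ge0; apply: mulr_ge0 => //; apply: mulr_ge0 => //; exact: ltW.
- lra.
move=> eps alpha e0 ee al0 alL.
have hr := rho_even (b - eps).
set X := - (1 * rho (- (b - eps)) * tanh ((P (- z) - P (- (b - eps))) / eps)).
have Xb : `|X| <= rho (b - eps) by rewrite normrN mul1r hr tanh_mul_le // sqrtr_ge0.
have sub x : - (b - eps) <= x <= 0 -> - b <= x <= b by lra.
have J1 := @half_transition_left P eps alpha Lam (- (b - eps)) (- z) 1 ra rb B lP e0 al0 alL ltac:(lra) (expr1n _ _) ra0
   (fun x hx => H x (sub x ltac:(lra))).
have J2 := @half_transition P eps alpha Lam (- z) c 1 ra rb B lP e0 al0 alL c1' (expr1n _ _) ra0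
   (fun x hx => H x (sub x ltac:(lra))).
have sN : (-1) ^+ 2 = 1 :> R by rewrite sqrrN expr1n.
(* With sign -1 the boundary term in alpha M(c) is opposite to the one of [J2], so the meeting point
   c leaves no trace in the cost. *)
have J3 := @half_transition_left P eps alpha Lam c 0 (-1) ra rb B lP e0 al0 alL c2' sN ra0
   (fun x hx => H x (sub x ltac:(lra))).
have E : - (-1 * rho c * tanh ((P 0 - P c) / eps)) = 1 * rho c * tanh ((P c - P (- z)) / eps).
  rewrite (_ : P 0 - P c = P c - P (- z)); last by move: cE; clear - std; lra.
  by rewrite !mulN1r mulNr opprK mul1r.
rewrite E in J3.
have J := joins_cat (joins_cat J1 J2) J3.
have J' := joins_hat (pot_even std) (pot_odd std) J.
rewrite oppr0 -/X opprK in J'.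
exists X, (- X); split=> //; first by rewrite normrN.
apply: joins_le (joins_cat J J') _.
rewrite hr !rho_even -/K0 -/K1.
have : 0 <= eps * (K1 * eps) by apply: mulr_ge0; [exact: ltW|apply: mulr_ge0 => //; exact: ltW].
by clear - std; lra.
Qed.

End Competitors.

(** * The Hamiltonian and the calibration *)

Section LocalEstimates.
Context {R : realType} (mu f : R -> R).
Implicit Types (v dv F w dw : R -> R) (p q x y c e eps alpha Lam r h s sg b : R).
Hypothesis std : potential mu f.
Notation s2 := (Num.sqrt (2 : R)).

(** The first integral of eps^2 v'' = v^3 - mu v for constant mu; here its derivative carries the
    factor f. *)
Definition hamil eps v dv x : R := eps ^+ 2 * dv x ^+ 2 / 2 - (mu x - v x ^+ 2) ^+ 2 / 4.

Lemma is_derive_hamil eps alpha v dv x : 0 < eps -> local_minimizer mu f eps alpha v dv ->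
  is_derive x 1 (hamil eps v dv) (f x * ((mu x - v x ^+ 2) - eps * alpha * dv x)).
Proof.
move=> e0 lm.
have D1 := is_derive_mul (is_derive_mul (is_derive_cst1 (eps ^+ 2) x) (is_derive_exp 2 (lm_dd lm x))) (is_derive_cst1 (2^-1) x).
have D2 := is_derive_mul (is_derive_exp 2 (is_derive_add (pot_d std x) (is_derive_opp (is_derive_exp 2 (lm_d lm x))))) (is_derive_cst1 (4^-1) x).
apply: is_derive_eq (is_derive_add D1 (is_derive_opp D2)) _ => /=.
by field; rewrite gt_eqF.
Qed.

Lemma norm_le_sqr (a c : R) : 0 < c -> `|a| <= c + a ^+ 2 / (4 * c).
Proof.
move=> c0; rewrite -subr_ge0 -(real_normK (num_real a)).
rewrite (_ : _ - _ = (2 * c - `|a|) ^+ 2 / (4 * c)); last by field; rewrite gt_eqF.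
by rewrite divr_ge0 ?sqr_ge0 // mulr_ge0 // ltW.
Qed.

(* The Modica-Mortola density controls both H (through eps) and H' (through sqrt eps). *)
Lemma hamil_bound b Lam K C : 0 < b -> 0 <= Lam -> 0 <= K -> 0 <= C -> exists2 D, 0 < D &
  forall eps alpha v dv F, local_minimizer mu f eps alpha v dv -> 0 < eps -> eps <= 1 ->
    0 <= alpha -> alpha <= Lam -> (forall x, is_derive x 1 F (dens mu f eps alpha v dv x)) ->
    (forall x, `|x| <= b -> `|v x| <= K) -> F b - F (- b) <= C ->
    forall x, `|x| <= b -> `|hamil eps v dv x| <= D * Num.sqrt eps.
Proof.
move=> b0 L0 K0 C0.
have [B B0 hB] := continuous_bounded (- b) b (pot_cf std).
pose E := Lam * B * K.
have E0 : 0 <= E by apply: mulr_ge0 => //; apply: mulr_ge0 => //; exact: ltW.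
pose C1 := C + 2 * b * E.
have C10 : 0 <= C1 by rewrite addr_ge0 // mulr_ge0 // mulr_ge0 // ltW.
pose D := C1 / (2 * b) + B * ((1 + Lam ^+ 2 / 2) * (2 * b) + 2 * C1).
have D0 : 0 <= D.
  apply: addr_ge0; first by rewrite divr_ge0 // mulr_ge0 // ltW.
  apply: mulr_ge0; first exact: ltW.
  apply: addr_ge0; last exact: mulr_ge0.
  apply: mulr_ge0; last by rewrite mulr_ge0 // ltW.
  by rewrite addr_ge0 // divr_ge0 // sqr_ge0.
exists (D + 1) => [|eps alpha v dv F lm e0 e1 al0 alL DF vK hF x]; first lra.
rewrite ler_norml => xb.
pose r := Num.sqrt eps.
have r0 : 0 < r by rewrite sqrtr_gt0.
have rE : r ^+ 2 = eps by rewrite sqr_sqrtr // ltW.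
have r1 : r <= 1 by rewrite -[leRHS]sqrtr1 ler_wsqrtr.
pose en y := eps / 2 * dv y ^+ 2 + (4 * eps)^-1 * (v y ^+ 2 - mu y) ^+ 2.
(* Adding E makes the density nonnegative on [-b, b], so the energy of every subinterval is bounded
   by the total C1. *)
pose S y := F y + E * y.
pose dS y := dens mu f eps alpha v dv y + E.
have DS (y : R) : is_derive y 1 S (dS y).
  apply: is_derive_eq (is_derive_add (DF y) (is_derive_mul (is_derive_cst1 E y) (is_derive_id1 y))) _.
  by rewrite /dS; ring.
have fvE y : - b <= y <= b -> alpha * f y * v y <= E.
  move=> hy; apply: le_trans (ler_norm _) _; rewrite !normrM (ger0_norm al0) /E.
  apply: ler_pM; [by rewrite mulr_ge0|by []| |by apply: vK; rewrite ler_norml].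
  by apply: ler_pM => //; exact: hB.
have enS y : - b <= y <= b -> en y <= dS y.
  by move=> /fvE; rewrite /en /dS /dens; clear - std; lra.
have en0 y : 0 <= en y.
  by rewrite addr_ge0 // mulr_ge0 ?sqr_ge0 // ?invr_ge0 ?divr_ge0 // ?mulr_ge0 // ltW.
have Sinc y z : - b <= y -> y <= z -> z <= b -> S z - S y <= C1.
  move=> h1 h2 h3.
  have m1 : 0 * (b - z) <= S b - S z.
    apply: (derive_cst_ge h3 (fun t _ => DS t)) => t ht; apply: le_trans (en0 t) (enS t _).
    by move: ht h1 h2; clear - std; move=> /andP[]; lra.
  have m2 : 0 * (y - - b) <= S y - S (- b).
    apply: (derive_cst_ge h1 (fun t _ => DS t)) => t ht; apply: le_trans (en0 t) (enS t _).
    by move: ht h3 h2; clear - std; move=> /andP[]; lra.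
  by move: m1 m2 hF; rewrite !mul0r /S /C1; clear - std; lra.
have Hen y : `|hamil eps v dv y| <= eps * en y.
  have -> : hamil eps v dv y = eps * (eps / 2 * dv y ^+ 2) - eps * ((4 * eps)^-1 * (v y ^+ 2 - mu y) ^+ 2).
    by rewrite /hamil; field; rewrite gt_eqF.
  apply: le_trans (ler_normB _ _) _; rewrite /en mulrDr !ger0_norm //.
    by apply: mulr_ge0 (ltW e0) _; rewrite mulr_ge0 ?sqr_ge0 // invr_ge0 mulr_ge0 // ltW.
  by apply: mulr_ge0 (ltW e0) _; rewrite mulr_ge0 ?sqr_ge0 // divr_ge0 // ltW.
(* With r = sqrt eps, [norm_le_sqr] trades |mu - v^2| for r plus r times the potential energy; the
   term eps alpha v' is treated likewise, whence one factor r overall. *)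
have HD y : - b <= y <= b -> `|f y * ((mu y - v y ^+ 2) - eps * alpha * dv y)| <= B * r * (1 + Lam ^+ 2 / 2 + 2 * dS y).
  move=> hy; have h := enS y hy; rewrite normrM -[leRHS]mulrA.
  apply: ler_pM => //; first exact: hB.
  have a1 : `|mu y - v y ^+ 2| <= r + r * ((4 * eps)^-1 * (v y ^+ 2 - mu y) ^+ 2).
    have := norm_le_sqr (mu y - v y ^+ 2) r0.
    rewrite -[_ ^+ 2 / _]mulrC -rE (_ : (4 * r)^-1 = r * (4 * r ^+ 2)^-1); last by field; rewrite gt_eqF.
    by move=> H; apply: le_trans H _; rewrite le_eqVlt; apply/orP; left; apply/eqP; field; rewrite gt_eqF.
  have a2 : `|eps * alpha * dv y| <= r * (Lam ^+ 2 / 2 + eps / 2 * dv y ^+ 2).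
    rewrite -rE (_ : r ^+ 2 * alpha * dv y = r * (alpha * (r * dv y))); last by ring.
    rewrite normrM (gtr0_norm r0) ler_pM2l //.
    have q1 : `|alpha * (r * dv y)| <= (alpha ^+ 2 + (r * dv y) ^+ 2) / 2.
      rewrite normrM -(real_normK (num_real alpha)) -(real_normK (num_real (r * dv y))).
      have := sqr_ge0 (`|alpha| - `|r * dv y|); clear - std; lra.
    have q2 : alpha ^+ 2 <= Lam ^+ 2 by rewrite lerXn2r ?nnegrE.
    by move: q1 q2; clear - std; rewrite exprMn; lra.
  apply: le_trans (ler_normB _ _) _.
  have : r * en y <= r * dS y by rewrite ler_pM2l.
  move: (mulr_ge0 (ltW r0) (en0 y)) a1 a2; rewrite /en; clear - std; lra.
have HM y z : - b <= y -> y <= z -> z <= b -> `|hamil eps v dv z - hamil eps v dv y| <= B * r * ((1 + Lam ^+ 2 / 2) * (2 * b) + 2 * C1).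
  move=> h1 h2 h3.
  pose T t := B * r * ((1 + Lam ^+ 2 / 2) * t + 2 * S t).
  have DT (t : R) : is_derive t 1 T (B * r * (1 + Lam ^+ 2 / 2 + 2 * dS t)).
    have := is_derive_mul (is_derive_cst1 (B * r) t) (is_derive_add (is_derive_mul (is_derive_cst1 (1 + Lam ^+ 2 / 2) t) (is_derive_id1 t)) (is_derive_mul (is_derive_cst1 2 t) (DS t))).
    by move=> H'; apply: is_derive_eq H' _; ring.
  have DH (t : R) := is_derive_hamil t e0 lm.
  have sub t : y <= t <= z -> - b <= t <= b by move: h1 h3; clear - std; move=> ? ? /andP[]; lra.
  have u1 := derive_le_le h2 (fun t _ => DH t) (fun t _ => DT t)
    (fun t ht => le_trans (ler_norm _) (HD t (sub t ht))).
  have u2 := @derive_le_le _ (fun t => - hamil eps v dv t) T (fun t => - (f t * ((mu t - v t ^+ 2) - eps * alpha * dv t))) _ y z h2 (fun t _ => is_derive_opp (DH t)) (fun t _ => DT t)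
    (fun t ht => le_trans (le_trans (ler_norm _) (eq_ind_r (fun u => u <= _) (lexx _) (normrN _))) (HD t (sub t ht))).
  have u3 : T z - T y <= B * r * ((1 + Lam ^+ 2 / 2) * (2 * b) + 2 * C1).
    rewrite /T -mulrBr; apply: ler_wpM2l; first by rewrite mulr_ge0 // ltW.
    have c1 : 1 <= 1 + Lam ^+ 2 / 2 by rewrite lerDl divr_ge0 // sqr_ge0.
    have c2 : (1 + Lam ^+ 2 / 2) * (z - y) <= (1 + Lam ^+ 2 / 2) * (2 * b).
      by rewrite ler_pM2l; move: c1 h1 h2 h3; clear - std; lra.
    by move: c2 (Sinc y z h1 h2 h3); clear - std; lra.
  by rewrite ler_norml; move: u1 u2 u3; clear - std; lra.
(* At a mean value point c the density is at most C1 / (2 b), and |H| is at most eps times it; [HM]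
   carries the smallness to every x. *)
have [|c /andP[c1 c2] cE] := @mvt _ S dS (- b) b _ (fun y _ => DS y); first lra.
have bb : - b <= b by lra.
have SC := Sinc (- b) b (lexx _) bb (lexx _).
have cb : - b <= c <= b by rewrite !ltW.
have dSc : dS c <= C1 / (2 * b).
  by rewrite ler_pdivlMr ?mulr_gt0 //; move: SC; rewrite cE; clear - std; lra.
have Hc : `|hamil eps v dv c| <= r * (C1 / (2 * b)).
  apply: le_trans (Hen c) _; rewrite -rE expr2 -mulrA ler_pM2l //.
  apply: (@le_trans _ _ (1 * en c)); first by rewrite ler_wpM2r.
  by rewrite mul1r (le_trans (enS c cb)).
have Hx : `|hamil eps v dv x - hamil eps v dv c| <= B * r * ((1 + Lam ^+ 2 / 2) * (2 * b) + 2 * C1).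
  case/andP: xb => x1 x2; have [xc|cx] := leP c x.
    by apply: HM => //; exact: ltW.
  by rewrite distrC; apply: HM => //; exact: ltW.
have -> : hamil eps v dv x = (hamil eps v dv x - hamil eps v dv c) + hamil eps v dv c by rewrite subrK.
apply: le_trans (ler_normD _ _) _; rewrite -/r.
have : 0 <= D * r by rewrite mulr_ge0 // ltW.
by move: Hx Hc r0; rewrite /D; clear - std; lra.
Qed.

(** A primitive in v of (mu - v^2) / s2. Its values at the wells are s2 M / 3 and - s2 M / 3, so a
    complete transition is worth 2 s2 M / 3. *)
Definition calib v x : R := (mu x * v x - v x ^+ 3 / 3) / s2.

(* e_0 >= kappa v' (mu - v^2) / sqrt 2 + eta e_0, and v' (mu - v^2) / sqrt 2 = calib' + sqrt 2 f v;
   the f v terms are compared with s rho and the error is absorbed by eta e_0. *)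
Lemma lower_piece eps alpha v dv F p q s kappa eta ra B D : local_minimizer mu f eps alpha v dv ->
  0 < eps -> p <= q -> s ^+ 2 = 1 -> 0 < eta -> `|kappa| <= 1 - eta -> 0 < ra ->
  (forall x, p <= x <= q -> [/\ 0 < mu x, ra <= rho mu x, `|f x| <= B & 0 <= s * v x]) ->
  `|kappa * s2 - alpha| <= D -> (forall x, is_derive x 1 F (dens mu f eps alpha v dv x)) ->
  kappa * (calib v q - calib v p) - (kappa * s2 - alpha) * s * (rho mu q ^+ 3 - rho mu p ^+ 3) / 3
    - eps * ((D * B / ra) ^+ 2 / eta) * (q - p) <= F q - F p.
Proof.
move=> lm e0 pq ss eta0 hk ra0 H hD DF.
have s20 : 0 < s2 by have := @s2_gt1 R; lra.
pose Z := eps * ((D * B / ra) ^+ 2 / eta).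
pose T x := kappa * calib v x - (kappa * s2 - alpha) * s / 3 * rho mu x ^+ 3 - Z * x.
pose dT x := kappa * (((mu x - v x ^+ 2) * dv x - 2 * f x * v x) / s2)
   + (kappa * s2 - alpha) * s * rho mu x * f x - Z.
have DT (x : R) : p <= x <= q -> is_derive x 1 T (dT x).
  move=> /H[mx rx _ _]; have rp := rho_gt0 mx.
  have D1 : is_derive x 1 (calib v) (((mu x - v x ^+ 2) * dv x - 2 * f x * v x) / s2).
    have := is_derive_mul (is_derive_add (is_derive_mul (pot_d std x) (lm_d lm x))
      (is_derive_opp (is_derive_mul (is_derive_exp 3 (lm_d lm x)) (is_derive_cst1 (3^-1) x)))) (is_derive_cst1 (s2^-1) x).
    by move=> H'; apply: is_derive_eq H' _ => /=; field; rewrite gt_eqF.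
  have D2 := is_derive_exp 3 (is_derive_rho std mx).
  have := is_derive_add (is_derive_add (is_derive_mul (is_derive_cst1 kappa x) D1)
    (is_derive_opp (is_derive_mul (is_derive_cst1 ((kappa * s2 - alpha) * s / 3) x) D2)))
    (is_derive_opp (is_derive_mul (is_derive_cst1 Z x) (is_derive_id1 x))).
  by move=> H'; apply: is_derive_eq H' _; rewrite /dT /=; field; rewrite !gt_eqF.
suff : T q - T p <= F q - F p.
  by rewrite /T -/Z; clear - std; lra.
apply: (derive_le_le pq DT (fun x _ => DF x)) => x hx.
have [mx rx fB sv] := H x hx; have rp := rho_gt0 mx.
pose a := dv x; pose g := mu x - v x ^+ 2.
pose e1 := eps / 2 * a ^+ 2 + (4 * eps)^-1 * g ^+ 2.
have e10 : 0 <= (4 * eps)^-1 * g ^+ 2 by rewrite mulr_ge0 ?sqr_ge0 // invr_ge0 mulr_ge0 // ltW.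
have e20 : 0 <= eps / 2 * a ^+ 2 by rewrite mulr_ge0 ?sqr_ge0 // divr_ge0 // ltW.
have e1ge : `|a * g / s2| <= e1.
  have S (t : R) : t ^+ 2 = 1 -> t * (a * g / s2) <= e1.
    move=> tt; rewrite -subr_ge0 /e1.
    have sE := @s2E R.
    have -> : eps / 2 * a ^+ 2 + (4 * eps)^-1 * g ^+ 2 - t * (a * g / s2) = (eps * a * s2 - t * g) ^+ 2 / (4 * eps).
      have iv : s2^-1 = s2 / 2 by rewrite [in RHS]s2V; field; rewrite gt_eqF.
      have -> : (eps * a * s2 - t * g) ^+ 2 = eps ^+ 2 * a ^+ 2 * s2 ^+ 2 - 2 * eps * a * t * g * s2 + t ^+ 2 * g ^+ 2 by ring.
      by rewrite tt sE iv; field; rewrite gt_eqF.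
    by rewrite divr_ge0 ?sqr_ge0 // mulr_ge0 // ltW.
  have := S 1 (expr1n _ _); have := S (-1) ltac:(by rewrite sqrrN expr1n).
  by rewrite ler_norml mul1r mulN1r; clear - std; lra.
have kap : kappa * (a * g / s2) <= (1 - eta) * e1.
  apply: le_trans (ler_norm _) _; rewrite normrM; exact: ler_pM.
have fv : f x * v x = f x * (s * rho mu x) + f x * (v x - s * rho mu x) by ring.
(* The sign condition keeps s v + rho above ra, so dividing mu - v^2 by it controls the distance to
   the well of that sign. *)
have dist : `|v x - s * rho mu x| <= `|g| / ra.
  rewrite ler_pdivlMr //.
  have -> : `|v x - s * rho mu x| = `|s * v x - rho mu x|.
    have -> : v x - s * rho mu x = s * (s * v x - rho mu x).
      by rewrite mulrBr mulrA -expr2 ss mul1r.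
    rewrite normrM; have -> : `|s| = 1 by exact: sign_norm ss.
    by rewrite mul1r.
  have -> : g = - ((s * v x - rho mu x) * (s * v x + rho mu x)).
    rewrite -subr_sqr exprMn ss mul1r rho_sqr ?opprB //; exact: ltW.
  rewrite normrN normrM ler_wpM2l // ger0_norm; last by move: sv rp; clear - std; lra.
  by move: sv rx; clear - std; lra.
have rem : `|(kappa * s2 - alpha) * (f x * (v x - s * rho mu x))| <= eta * ((4 * eps)^-1 * g ^+ 2) + Z.
  have B0 : 0 <= B := le_trans (normr_ge0 _) fB.
  have D0 : 0 <= D := le_trans (normr_ge0 _) hD.
  have b1 : `|(kappa * s2 - alpha) * (f x * (v x - s * rho mu x))| <= D * (B * (`|g| / ra)).
    rewrite normrM; apply: ler_pM => //; rewrite normrM; exact: ler_pM.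
  apply: le_trans b1 _.
  have -> : D * (B * (`|g| / ra)) = (D * B / ra) * `|g| by ring.
  rewrite /Z -(real_normK (num_real g)); move: (D * B / ra) `|g| => t u.
  rewrite -subr_ge0.
  have -> : eta * ((4 * eps)^-1 * u ^+ 2) + eps * (t ^+ 2 / eta) - t * u = (eta * u - 2 * eps * t) ^+ 2 / (4 * eps * eta).
    by field; rewrite !gt_eqF.
  by rewrite divr_ge0 ?sqr_ge0 // !mulr_ge0 // ltW.
rewrite /dT /dens -/a.
have -> : eps / 2 * a ^+ 2 + (4 * eps)^-1 * (v x ^+ 2 - mu x) ^+ 2 = e1 by rewrite /e1 -[v x ^+ 2 - _]opprB sqrrN.
have -> : ((mu x - v x ^+ 2) * a - 2 * f x * v x) / s2 = a * g / s2 - s2 * (f x * v x).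
  by rewrite [in s2 * _]s2V /g; field; rewrite gt_eqF.
move: rem; rewrite ler_norml => /andP[rem1 rem2].
have q1 : 0 <= eta * (eps / 2 * a ^+ 2) by rewrite mulr_ge0 // ltW.
move: kap rem1 q1; rewrite /e1; clear - std; lra.
Qed.

(** At x the function v misses its well by d and moves away from it. While it does, the gap stays
    above d / 2 and a small Hamiltonian imposes a speed of at least d / (4 eps); over a length r
    this carries v out of [0, K]. *)
Lemma escape v dv m x r d eps K sg : (forall y, is_derive y 1 v (dv y)) -> continuous dv ->
  0 < r -> 0 < d -> 0 < eps -> sg ^+ 2 = 1 ->
  (forall y, x <= y <= x + r -> `|m y - m x| <= d / 2 /\ 0 <= v y <= K) ->
  (forall y, x <= y <= x + r -> (m y - v y ^+ 2) ^+ 2 / 4 - d ^+ 2 / 32 <= eps ^+ 2 * dv y ^+ 2 / 2) ->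
  4 * eps * K < r * d -> sg * dv x < 0 -> ~ (d <= sg * (m x - v x ^+ 2)).
Proof.
move=> D1 cdv r0 d0 e0 ss hm hH hK dx hd.
have sgn : `|sg| = 1 by exact: sign_norm ss.
have Dsv (t : R) : is_derive t 1 (fun y => sg * v y) (sg * dv t).
  by apply: is_derive_eq (is_derive_mul (is_derive_cst1 sg t) (D1 t)) _; ring.
have key y : x <= y <= x + r -> sg * v y <= sg * v x -> d / 4 <= eps * `|dv y|.
  move=> hy h; have [m1 /andP[v0 _]] := hm y hy.
  have [_ /andP[vx0 _]] := hm x ltac:(move: r0; clear - std; lra).
  have h2 : sg * v y ^+ 2 <= sg * v x ^+ 2.
    have : 0 <= (sg * v x - sg * v y) * (v x + v y) by rewrite mulr_ge0 ?subr_ge0 // addr_ge0.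
    by clear - std; lra.
  have h3 : `|sg * (m y - m x)| <= d / 2 by rewrite normrM sgn mul1r.
  have h4 : d / 2 <= sg * (m y - v y ^+ 2).
    by move: h3; rewrite ler_norml => /andP[h3 _]; move: h2 h3 hd; clear - std; lra.
  have h5 : (d / 2) ^+ 2 <= (m y - v y ^+ 2) ^+ 2.
    have -> : (m y - v y ^+ 2) ^+ 2 = (sg * (m y - v y ^+ 2)) ^+ 2 by rewrite exprMn ss mul1r.
    by rewrite lerXn2r ?nnegrE //; move: h4 d0; clear - std; lra.
  rewrite -(@ler_pXn2r _ 2) ?nnegrE //; [|by move: d0; clear - std; lra|by rewrite mulr_ge0 // ltW].
  have -> : (eps * `|dv y|) ^+ 2 = eps ^+ 2 * dv y ^+ 2 by rewrite exprMn real_normK // num_real.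
  by move: (hH y hy) h5; clear - std; lra.
have neg y : x <= y <= x + r -> sg * dv y < 0.
  move=> /andP[y1 y2]; rewrite ltNge; apply/negP => hy.
  have xy : x < y by rewrite lt_neqAle y1 andbT; apply/eqP => E; move: hy dx; rewrite -E; clear - std; lra.
  have cn : continuous (fun y => - (sg * dv y)).
    by move=> z; apply: cts_opp; apply: cts_mul; [exact: cts_cst|exact: cdv].
  have [||z [/andP[z1 z2] zE zp]] := @first_zero _ (fun y => - (sg * dv y)) x y xy cn.
  - by move: dx; clear - std; lra.
  - by move: hy; clear - std; lra.
  have zr : x <= z <= x + r by move: z1 z2 y2; clear - std; lra.
  have mono : sg * v z - sg * v x <= 0 * (z - x).
    apply: (derive_cst_le (ltW z1) (fun t _ => Dsv t)) => t /andP[t1 t2].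
    have [tz|zt] := ltP t z; last by have -> : t = z; [by apply/eqP; rewrite eq_le t2 zt|move: zE; clear - std; lra].
    by have := zp t; rewrite t1 tz => /(_ isT); clear - std; lra.
  have := key z zr ltac:(move: mono; clear - std; lra).
  have -> : `|dv z| = 0 by rewrite -[LHS]mul1r -sgn -normrM; move: zE => /eqP; rewrite oppr_eq0 => /eqP ->; rewrite normr0.
  by rewrite mulr0; move: d0; clear - std; lra.
have fin : sg * v (x + r) - sg * v x <= - (d / (4 * eps)) * (x + r - x).
  apply: (derive_cst_le _ (fun t _ => Dsv t)) => [|t ht]; first by move: r0; clear - std; lra.
  have mono : sg * v t - sg * v x <= 0 * (t - x).
    case/andP: ht => t1 t2; apply: (derive_cst_le t1 (fun t _ => Dsv t)) => u /andP[u1 u2].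
    by apply/ltW/neg; rewrite u1 (le_trans u2).
  have := key t ht ltac:(move: mono; clear - std; lra).
  have -> : `|dv t| = - (sg * dv t) by rewrite -[LHS]mul1r -sgn -normrM ltr0_norm // neg.
  move=> h; rewrite -mulNr ler_pdivlMr ?mulr_gt0 //; move: h; clear - std; lra.
have [_ /andP[v1 v2]] := hm x ltac:(move: r0; clear - std; lra).
have [_ /andP[v3 v4]] := hm (x + r) ltac:(move: r0; clear - std; lra).
have b1 : `|sg * (v (x + r) - v x)| <= K.
  by rewrite normrM sgn mul1r ler_norml; move: v1 v2 v3 v4; clear - std; lra.
have b2 : K < d / (4 * eps) * r.
  by rewrite mulrAC ltr_pdivlMr ?mulr_gt0 //; move: hK; clear - std; lra.
by move: b1; rewrite ler_norml => /andP[b1 _]; move: b1 b2 fin; clear - std; lra.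
Qed.

Lemma gronwall (N dN : R -> R) C e L : 0 <= L -> 0 <= C -> 0 <= e ->
  (forall s, 0 <= s <= L -> is_derive s 1 N (dN s)) ->
  (forall s, 0 <= s <= L -> dN s <= C * N s + e) -> N L <= (N 0 + e * L) * expR (C * L).
Proof.
move=> L0 C0 e0 DN h.
have De (s : R) : is_derive s 1 (fun s => expR (- (C * s))) (- (C * expR (- (C * s)))).
  have := is_derive_exp1 (is_derive_opp (is_derive_mul (is_derive_cst1 C s) (is_derive_id1 s))).
  by move=> H; apply: is_derive_eq H _; ring.
have : N L * expR (- (C * L)) - N 0 * expR (- (C * 0)) <= e * (L - 0).
  apply: (@derive_cst_le _ (fun s => N s * expR (- (C * s))) (fun s => N s * (- (C * expR (- (C * s)))) + expR (- (C * s)) * dN s)) => // s hs.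
    exact: is_derive_mul (DN s hs) (De s).
  have e1 : 0 < expR (- (C * s)) := expR_gt0 _.
  have e2 : expR (- (C * s)) <= 1.
    by rewrite -expR0 ler_expR oppr_le0 mulr_ge0 //; case/andP: hs.
  have := h s hs; rewrite -subr_ge0 => /(mulr_ge0 (ltW e1)).
  have : e * expR (- (C * s)) <= e * 1 by rewrite ler_wpM2l.
  by clear - std; lra.
rewrite mulr0 oppr0 expR0 mulr1 addr0 lerBlDr addrC expRN.
by rewrite ler_pdivrMr ?expR_gt0.
Qed.

End LocalEstimates.

(** * Zeros of a minimizer *)

Record profile {R : realType} (mu f : R -> R) (zeta xi : R) : Prop := Profile {
  pr_pot : potential mu f;
  pr_z0 : 0 < zeta;
  pr_zx : zeta < xi;
  pr_mu : forall x, `|x| < xi -> 0 < mu x;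
  pr_xi : mu xi = 0;
  pr_fpos : forall x, zeta < x -> 0 < f x;
  pr_fneg : forall x, 0 < x -> x < zeta -> f x < 0
}.

Section Components.
Context {R : realType}.
Implicit Types (g : R -> R) (p q x y z : R).

Lemma component g p q x : continuous g -> p < x < q -> g p <= 0 -> g q <= 0 -> 0 < g x ->
  exists p' q', p <= p' /\ [/\ p' < q', q' <= q, g p' = 0, g q' = 0 & forall y, p' < y < q' -> 0 < g y].
Proof.
move=> cg /andP[px xq] gp gq gx.
have [q' [/andP[xq' q'q] gq' hq']] := first_zero xq cg gx gq.
have [p' [/andP[pp' p'x] gp' hp']] := last_zero px cg gx gp.
exists p', q'; do 2 split=> //; first exact: lt_trans xq'.
move=> y /andP[y1 y2]; have [yx|xy] := leP y x; first by apply: hp'; rewrite y1.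
by apply: hq'; rewrite y2 ltW.
Qed.

Lemma component_left g q x : continuous g -> x < q -> g q <= 0 -> 0 < g x ->
  (exists p' q', [/\ p' < q', q' <= q, g p' = 0, g q' = 0 & forall y, p' < y < q' -> 0 < g y]) \/
  exists q', [/\ q' <= q, g q' = 0 & forall y, y < q' -> 0 < g y].
Proof.
move=> cg xq gq gx; have [[p [px gp]]|H] := pselect (exists p, p < x /\ g p <= 0).
  left; have [|p' [q' [_ [h1 h2 h3 h4 h5]]]] := @component g p q x cg _ gp gq gx; first by rewrite px.
  by exists p', q'.
have [q' [/andP[xq' q'q] gq' hq']] := first_zero xq cg gx gq.
right; exists q'; split=> // y yq.
have [xy|yx] := leP x y; first by apply: hq'; rewrite xy.
by rewrite ltNge; apply/negP => gy; apply: H; exists y.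
Qed.

Lemma sign_after g dg x y : continuous g -> is_derive x 1 g dg -> 0 < dg -> g x = 0 ->
  x < y -> (forall z, x < z <= y -> g z <> 0) -> 0 < g y.
Proof.
move=> cg Dg dg0 gx xy nz.
have [d d0 hd] := derive_pos_near Dg dg0.
pose t := Num.min y (x + d / 2).
have xt : x < t by rewrite lt_min xy ltrDl divr_gt0.
have td : `|t - x| < d.
  rewrite gtr0_norm ?subr_gt0 // ltrBlDl /t; apply: (@le_lt_trans _ _ (x + d / 2)).
    by rewrite ge_min lexx orbT.
  by lra.
have gt : 0 < g t by have [h _] := hd t td; rewrite -gx; exact: h.
have ty : t <= y by rewrite ge_min lexx.
rewrite ltNge; apply/negP => gy.
have ty' : t < y by rewrite lt_neqAle ty andbT; apply/eqP => E; move: gt gy; rewrite E; lra.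
have [z [/andP[z1 z2] gz _]] := first_zero ty' cg gt gy.
by apply: (nz z) => //; rewrite z2 (lt_trans xt).
Qed.

Lemma sign_before g dg x y : continuous g -> is_derive x 1 g dg -> 0 < dg -> g x = 0 ->
  y < x -> (forall z, y <= z < x -> g z <> 0) -> g y < 0.
Proof.
move=> cg Dg dg0 gx yx nz.
suff : 0 < hat g (- y) by rewrite /hat opprK oppr_gt0.
apply: (@sign_after (hat g) dg (- x) (- y)) => //.
- by move=> z; apply/cts_opp/cts_reflect/cg.
- by apply: is_derive_hat; rewrite opprK.
- by rewrite /hat opprK gx oppr0.
- by rewrite ltrN2.
- move=> z hz; rewrite /hat => /eqP; rewrite oppr_eq0 => /eqP; apply: nz; lra.
Qed.

End Components.

(** * Number, order and direction of the zeros *)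

Section Zeros.
Context {R : realType} (mu f : R -> R) (zeta xi : R).
Implicit Types (v dv F w dw : R -> R) (p q x y c e d eps alpha a b : R).
Hypothesis pr : profile mu f zeta xi.
Let std := pr_pot pr.

Lemma f_left x : x < - zeta -> f x < 0.
Proof.
move=> h; have := pr_fpos pr (x := - x) ltac:(lra).
by rewrite (pot_odd std); lra.
Qed.

Lemma f_mid x : - zeta < x -> x < 0 -> 0 < f x.
Proof.
move=> h h'; have := pr_fneg pr (x := - x) ltac:(lra) ltac:(lra).
by rewrite (pot_odd std); lra.
Qed.

Lemma mu_incr x y : 0 <= x -> x < y -> y <= zeta -> mu x < mu y.
Proof.
move=> x0 xy yz; have [c /andP[c1 c2] E] := mvt xy (fun z _ => pot_d std z).
rewrite -subr_gt0 E; apply: mulr_gt0; last lra.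
by have := pr_fneg pr (x := c) ltac:(lra) ltac:(lra); lra.
Qed.

Lemma mu_decr x y : zeta <= x -> x < y -> mu y < mu x.
Proof.
move=> x0 xy; have [c /andP[c1 c2] E] := mvt xy (fun z _ => pot_d std z).
rewrite -subr_lt0 E nmulr_rlt0; first lra.
by have := pr_fpos pr (x := c) ltac:(lra); lra.
Qed.

Definition one_zero v y : Prop :=
  [/\ v y = 0, forall x, x < y -> v x < 0 & forall x, y < x -> 0 < v x].

Definition three_zeros v y1 y2 y3 : Prop :=
  [/\ [/\ y1 < y2, y2 < y3 & `|y2| < zeta], [/\ v y1 = 0, v y2 = 0 & v y3 = 0],
   [/\ forall x, x < y1 -> v x < 0 & forall x, y1 < x < y2 -> 0 < v x] &
   [/\ forall x, y2 < x < y3 -> v x < 0 & forall x, y3 < x -> 0 < v x]].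

Section Fixed.
Variables (eps alpha : R).
Hypotheses (e0 : 0 < eps) (al0 : 0 < alpha).

Lemma lm_cv v dv : local_minimizer mu f eps alpha v dv -> continuous v.
Proof. by move=> lm x; exact: is_derive_cvg (lm_d lm x). Qed.

Lemma lm_cdv v dv : local_minimizer mu f eps alpha v dv -> continuous dv.
Proof. by move=> lm x; exact: is_derive_cvg (lm_dd lm x). Qed.

(** Asked only on [-zeta, zeta], where the Hamiltonian provides it; farther out it follows from
    [left_zero] and [right_zero]. *)
Definition nondegenerate v dv := forall x, `|x| <= zeta -> v x = 0 -> dv x <> 0.

(** To the left of -zeta, f < 0, so the sign rule forbids v > 0. A further zero would be an interior
    maximum of v, while the equation gives v'' = - alpha f / eps > 0 there. *)
Lemma left_zero v dv a : local_minimizer mu f eps alpha v dv -> nondegenerate v dv ->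
  v a = 0 -> a <= - zeta -> 0 < dv a /\ forall x, x < a -> v x < 0.
Proof.
move=> lm nd va az; have cv := lm_cv lm.
have le x : x < a -> v x <= 0.
  move=> xa; rewrite leNgt; apply/negP => vx.
  have va0 : v a <= 0 by rewrite va.
  have [[p [q [pq qa vp vq H]]]|[q [qa vq H]]] := component_left cv xa va0 vx.
    apply: (lm_flip lm pq vp vq) => y /andP[y1 y2].
    rewrite pmulr_llt0; [by apply: f_left; lra|by apply: H; rewrite y1].
  apply: (lm_flipl lm vq) => y yq.
  rewrite pmulr_llt0; [by apply: f_left; lra|by apply: H].
have DD x : v x = 0 -> x < - zeta -> 0 < (v x ^+ 3 - mu x * v x - eps * alpha * f x) / eps ^+ 2.
  move=> vx xz; rewrite vx expr0n mulr0 /= subr0 sub0r divr_gt0 ?exprn_gt0 //.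
  by rewrite -mulrN mulr_gt0 ?mulr_gt0 // oppr_gt0; exact: f_left.
split; last first.
  move=> x xa; rewrite lt_neqAle le // andbT; apply/eqP => vx.
  have := DD x vx ltac:(lra); apply/negP; rewrite -leNgt.
  apply: (@max_second _ v dv x _ (a - x)) => [|y _||y hy].
  - by rewrite subr_gt0.
  - exact: lm_d lm y.
  - exact: lm_dd lm x.
  by rewrite vx; apply: le; move: hy; rewrite ltr_norml; lra.
(* A zero slope at a < -zeta would, with v'' > 0, make v positive just left of a; at a = -zeta it is
   excluded by nondegeneracy. *)
rewrite ltNge; apply/negP; rewrite le_eqVlt => /predU1P[h|h].
  have [E|az'] : a = - zeta \/ a < - zeta by move: az; rewrite le_eqVlt => /predU1P.
    by apply: (nd a) => //; rewrite E normrN gtr0_norm // (pr_z0 pr).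
  have [d d0 hd] := derive_pos_near (lm_dd lm a) (DD a va az').
  have [|c /andP[c1 c2] E] := @mvt _ v dv (a - d / 2) a _ (fun x _ => lm_d lm x); first lra.
  have [_ /(_ c2)] : (a < c -> dv a < dv c) /\ (c < a -> dv c < dv a).
    by apply: hd; rewrite ltr_norml; lra.
  rewrite h => dc; have := le (a - d / 2) ltac:(lra).
  have : dv c * (a - (a - d / 2)) < 0 by rewrite pmulr_llt0 //; lra.
  by rewrite -E va; lra.
have [d d0 hd] := derive_pos_near (is_derive_opp (lm_d lm a)) (df := - dv a) ltac:(lra).
have [_ H] := hd (a - d / 2) ltac:(rewrite ltr_norml; lra).
have := H ltac:(lra); have := le (a - d / 2) ltac:(lra); rewrite va; lra.
Qed.

Lemma nondegenerate_hat v dv : nondegenerate v dv -> nondegenerate (hat v) (fun x => dv (- x)).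
Proof.
move=> nd x xz; rewrite /hat => /eqP; rewrite oppr_eq0 => /eqP; apply: nd.
by rewrite normrN.
Qed.

Lemma hat_eq0 v x : v x = 0 -> hat v (- x) = 0.
Proof. by rewrite /hat opprK => ->; rewrite oppr0. Qed.

Lemma right_zero v dv a : local_minimizer mu f eps alpha v dv -> nondegenerate v dv ->
  v a = 0 -> zeta <= a -> 0 < dv a /\ forall x, a < x -> 0 < v x.
Proof.
move=> lm nd va az.
have [|h1 h2] := @left_zero (hat v) _ (- a) (local_minimizer_hat (pot_even std) (pot_odd std) lm) (nondegenerate_hat nd) (hat_eq0 va); first lra.
split; first by move: h1; rewrite opprK.
by move=> x ax; have := h2 (- x) ltac:(lra); rewrite /hat opprK; lra.
Qed.

(** Between -zeta and 0, f is positive, so the sign rule excludes components where v < 0. *)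
Lemma between_left v dv a c x : local_minimizer mu f eps alpha v dv -> v a = 0 -> v c = 0 ->
  - zeta <= a -> c <= 0 -> a < x < c -> 0 <= v x.
Proof.
move=> lm va vc az c0 xac; rewrite leNgt; apply/negP => vx.
have cn : continuous (fun x => - v x) by move=> y; apply: cts_opp; exact: lm_cv lm y.
have [|||p [q [ap [pq qc /eqP vp /eqP vq H]]]] := @component _ (fun x => - v x) a c x cn xac; try lra.
move: vp vq; rewrite !oppr_eq0 => /eqP vp /eqP vq.
apply: (lm_flip lm pq vp vq) => y hy; have := H y hy; rewrite oppr_gt0 => vy.
by rewrite nmulr_llt0 //; apply: f_mid; lra.
Qed.

Lemma between_right v dv a c x : local_minimizer mu f eps alpha v dv -> v a = 0 -> v c = 0 ->
  0 <= a -> c <= zeta -> a < x < c -> v x <= 0.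
Proof.
move=> lm va vc az c0 xac.
have := @between_left (hat v) _ (- c) (- a) (- x) (local_minimizer_hat (pot_even std) (pot_odd std) lm) (hat_eq0 vc) (hat_eq0 va).
by rewrite /hat opprK => /(_ ltac:(lra) ltac:(lra) ltac:(lra)); lra.
Qed.

Section Count.
Variables (v dv : R -> R) (xL xR : R).
Hypotheses (lm : local_minimizer mu f eps alpha v dv) (nd : nondegenerate v dv).
Hypotheses (vL : v xL < 0) (vR : 0 < v xR) (xLz : xL < - zeta) (xRz : zeta < xR).
Let cv : continuous v := lm_cv lm.
Let cnv : continuous (fun x => - v x).
Proof. by move=> y; apply: cts_opp; exact: cv. Qed.
Let z0 : 0 < zeta.
Proof. exact: pr_z0 pr. Qed.

Lemma all_nondegenerate x : v x = 0 -> dv x <> 0.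
Proof.
move=> vx; have [xz|xz] := leP `|x| zeta; first exact: nd.
have [|] := leP x 0 => x0.
  have [|h _] := left_zero lm nd vx; last by move=> E; move: h; rewrite E ltxx.
  by move: xz; rewrite ler0_norm //; lra.
have [|h _] := right_zero lm nd vx; last by move=> E; move: h; rewrite E ltxx.
by move: xz; rewrite gtr0_norm //; lra.
Qed.

Lemma down_inside d : v d = 0 -> dv d < 0 -> `|d| < zeta.
Proof.
move=> vd dd; rewrite ltr_norml; apply/andP; split; rewrite ltNge; apply/negP => h.
  by have [h' _] := left_zero lm nd vd h; lra.
by have [h' _] := right_zero lm nd vd h; lra.
Qed.

Lemma near_after y z e : y < z -> 0 < e -> exists2 x : R, y < x < z & `|x - y| < e.
Proof.
move=> yz e0'; exists (y + Num.min (e / 2) ((z - y) / 2)).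
  have : Num.min (e / 2) ((z - y) / 2) <= (z - y) / 2 by rewrite ge_min lexx orbT.
  have : 0 < Num.min (e / 2) ((z - y) / 2) by rewrite lt_min !divr_gt0 // subr_gt0.
  lra.
have : Num.min (e / 2) ((z - y) / 2) <= e / 2 by rewrite ge_min lexx.
have : 0 < Num.min (e / 2) ((z - y) / 2) by rewrite lt_min !divr_gt0 // subr_gt0.
by rewrite [y + _]addrC addrK => h1 h2; rewrite gtr0_norm //; lra.
Qed.

Lemma pos_after u z : v u = 0 -> 0 < dv u -> u < z -> exists2 x : R, u < x < z & 0 < v x.
Proof.
move=> vu du uz; have [d d0 hd] := derive_pos_near (lm_d lm u) du.
have [x hx xd] := near_after uz d0; exists x => //.
by have [h _] := hd x xd; rewrite -vu; apply: h; case/andP: hx.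
Qed.

Lemma neg_after u z : v u = 0 -> dv u < 0 -> u < z -> exists2 x : R, u < x < z & v x < 0.
Proof.
move=> vu du uz; have [d d0 hd] := derive_pos_near (is_derive_opp (lm_d lm u)) (df := - dv u) ltac:(lra).
have [x hx xd] := near_after uz d0; exists x => //.
by have [h _] := hd x xd; have := h ltac:(lra); rewrite vu; lra.
Qed.

Lemma pos_before u z : v u = 0 -> dv u < 0 -> z < u -> exists2 x : R, z < x < u & 0 < v x.
Proof.
move=> vu du zu; have [d d0 hd] := derive_pos_near (is_derive_opp (lm_d lm u)) (df := - dv u) ltac:(lra).
have [|x hx xd] := @near_after (- u) (- z) d _ d0; first lra.
exists (- x); first lra.
have [_ h] := hd (- x) ltac:(by rewrite -opprD normrN addrC; move: xd; rewrite opprK addrC).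
by have := h ltac:(lra); rewrite vu; lra.
Qed.

Lemma neg_before u z : v u = 0 -> 0 < dv u -> z < u -> exists2 x : R, z < x < u & v x < 0.
Proof.
move=> vu du zu; have [d d0 hd] := derive_pos_near (lm_d lm u) du.
have [|x hx xd] := @near_after (- u) (- z) d _ d0; first lra.
exists (- x); first lra.
have [_ h] := hd (- x) ltac:(by rewrite -opprD normrN addrC; move: xd; rewrite opprK addrC).
by have := h ltac:(lra); rewrite vu; lra.
Qed.

Lemma no_zero_after_down d u : v d = 0 -> dv d < 0 -> d < u -> u <= 0 -> v u <> 0.
Proof.
move=> vd dd du u0 vu; have := down_inside vd dd; rewrite ltr_norml => /andP[d1 d2].
have [x hx vx] := neg_after vd dd du.
by have := between_left lm vd vu (ltW d1) u0 hx; lra.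
Qed.

Lemma no_zero_before_down d u : v d = 0 -> dv d < 0 -> u < d -> 0 <= u -> v u <> 0.
Proof.
move=> vd dd du u0 vu; have := down_inside vd dd; rewrite ltr_norml => /andP[d1 d2].
have [x hx vx] := pos_before vd dd du.
by have := between_right lm vu vd u0 (ltW d2) hx; lra.
Qed.

(** If d1 < 0 < d2, there is another zero between the two downward crossings; whichever side of 0 it
    lies on, one of the two preceding lemmas excludes it. The other positions are excluded
    directly. *)
Lemma down_unique d1 d2 : v d1 = 0 -> dv d1 < 0 -> v d2 = 0 -> dv d2 < 0 -> ~ (d1 < d2).
Proof.
move=> v1 D1 v2 D2 d12.
have [d20|d20] := leP d2 0; first exact: (no_zero_after_down v1 D1 d12 d20 v2).
have [d10|d10] := leP 0 d1; first exact: (no_zero_before_down v2 D2 d12 d10 v1).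
have [x /andP[x1 x2] vx] := neg_after v1 D1 d12.
have [y /andP[y1 y2] vy] := pos_before v2 D2 x2.
have [|z /andP[z1 z2] vz] := @ivt _ v x y (ltW y1) cv; first by rewrite !ltW.
have [u0|u0] := leP z 0.
  by apply: (no_zero_after_down v1 D1 _ u0 vz); lra.
by apply: (no_zero_before_down v2 D2 _ (ltW u0) vz); lra.
Qed.

Lemma down_between u1 u2 : v u1 = 0 -> 0 < dv u1 -> v u2 = 0 -> 0 < dv u2 -> u1 < u2 ->
  exists2 d : R, u1 < d < u2 & v d = 0 /\ dv d < 0.
Proof.
move=> v1 D1 v2 D2 u12.
have [x /andP[x1 x2] vx] := pos_after v1 D1 u12.
have [y /andP[y1 y2] vy] := neg_before v2 D2 x2.
have [z [/andP[z1 z2] vz hz]] := first_zero y1 cv vx (ltW vy).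
exists z; first lra.
split=> //; rewrite ltNge; apply/negP => dz0.
have dz : 0 < dv z by rewrite lt_neqAle dz0 andbT eq_sym; apply/eqP; exact: all_nondegenerate.
have [t /andP[t1 t2] vt] := neg_before vz dz z1.
by have := hz t ltac:(lra); lra.
Qed.

Lemma up_before d : v d = 0 -> dv d < 0 -> exists2 u : R, xL < u < d & v u = 0 /\ 0 < dv u.
Proof.
move: z0 xLz => zz xz vd dd; have := down_inside vd dd; rewrite ltr_norml => /andP[d1 d2].
have [|y /andP[y1 y2] vy] := @pos_before d xL vd dd; first lra.
have [z [/andP[z1 z2] vz hz]] := last_zero y1 cv vy (ltW vL).
have zL : xL < z by rewrite lt_neqAle z1 andbT; apply/eqP => E; move: vL; rewrite E vz ltxx.
exists z; first lra.
split=> //; rewrite ltNge; apply/negP => dz0.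
have dz : dv z < 0 by rewrite lt_neqAle dz0 andbT; apply/eqP; exact: all_nondegenerate.
have [t /andP[t1 t2] vt] := neg_after vz dz z2.
by have := hz t ltac:(lra); lra.
Qed.

Lemma up_after d : v d = 0 -> dv d < 0 -> exists2 u : R, d < u < xR & v u = 0 /\ 0 < dv u.
Proof.
move: z0 xRz vR => zz xz vRp vd dd; have := down_inside vd dd; rewrite ltr_norml => /andP[d1 d2].
have [|y /andP[y1 y2] vy] := @neg_after d xR vd dd; first lra.
have [||z [/andP[z1 z2] /eqP vz hz]] := @first_zero _ (fun x => - v x) y xR y2 cnv; try lra.
move: vz; rewrite oppr_eq0 => /eqP vz.
have zR : z < xR by rewrite lt_neqAle z2 andbT; apply/eqP => E; move: vR; rewrite -E vz ltxx.
exists z; first lra.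
split=> //; rewrite ltNge; apply/negP => dz0.
have dz : dv z < 0 by rewrite lt_neqAle dz0 andbT; apply/eqP; exact: all_nondegenerate.
have [t /andP[t1 t2] vt] := pos_before vz dz z1.
by have := hz t ltac:(lra); lra.
Qed.

(** All zeros are transversal, so upward and downward crossings alternate, starting and ending with
    upward ones. At most one crossing is downward, which leaves one zero or three. *)
Lemma zeros_cases : (exists2 y : R, xL < y < xR & one_zero v y) \/
  (exists y1 y2 y3, three_zeros v y1 y2 y3).
Proof.
have [[d [vd dd]]|nod] := pselect (exists d, v d = 0 /\ dv d < 0); last first.
  have up x : v x = 0 -> 0 < dv x.
    move=> vx; rewrite lt_neqAle eq_sym; apply/andP; split; first exact/eqP/all_nondegenerate.
    by rewrite leNgt; apply/negP => h; apply: nod; exists x.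
  have [||y /andP[y1 y2] vy] := @ivt _ v xL xR _ cv; [by move: z0 xLz xRz => h1 h2 h3; lra|by rewrite !ltW|].
  have uniq x : v x = 0 -> x = y.
    move=> vx; apply/eqP; rewrite eq_le; apply/andP; split; rewrite leNgt; apply/negP => h.
      by have [d _ [h1 h2]] := down_between vy (up y vy) vx (up x vx) h; apply: nod; exists d.
    by have [d _ [h1 h2]] := down_between vx (up x vx) vy (up y vy) h; apply: nod; exists d.
  left; exists y.
    rewrite !lt_neqAle y1 y2 !andbT; apply/andP; split; apply/eqP => E.
      by move: vL; rewrite E vy ltxx.
    by move: vR; rewrite -E vy ltxx.
  split=> // x xy.
    apply: (sign_before cv (lm_d lm y) (up y vy) vy xy) => z hz /uniq; lra.
  apply: (sign_after cv (lm_d lm y) (up y vy) vy xy) => z hz /uniq; lra.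
right.
have [u1 /andP[_ u1d] [v1 D1]] := up_before vd dd.
have [u3 /andP[du3 _] [v3 D3]] := up_after vd dd.
have all x : v x = 0 -> [\/ x = u1, x = d | x = u3].
  move=> vx; have [xd|dx|->] := ltgtP x d; last by constructor 2.
  - constructor 1.
    have up : 0 < dv x.
      rewrite ltNge; apply/negP; rewrite le_eqVlt => /predU1P[/(all_nondegenerate vx)//|h].
      exact: (down_unique vx h vd dd xd).
    apply/eqP; rewrite eq_le; apply/andP; split; rewrite leNgt; apply/negP => h.
      have [e /andP[e1 e2] [h1 h2]] := down_between v1 D1 vx up h.
      by apply: (down_unique h1 h2 vd dd); lra.
    have [e /andP[e1 e2] [h1 h2]] := down_between vx up v1 D1 h.
    by apply: (down_unique h1 h2 vd dd); lra.
  - constructor 3.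
    have up : 0 < dv x.
      rewrite ltNge; apply/negP; rewrite le_eqVlt => /predU1P[/(all_nondegenerate vx)//|h].
      exact: (down_unique vd dd vx h dx).
    apply/eqP; rewrite eq_le; apply/andP; split; rewrite leNgt; apply/negP => h.
      have [e /andP[e1 e2] [h1 h2]] := down_between v3 D3 vx up h.
      by apply: (down_unique vd dd h1 h2); lra.
    have [e /andP[e1 e2] [h1 h2]] := down_between vx up v3 D3 h.
    by apply: (down_unique vd dd h1 h2); lra.
exists u1, d, u3; split=> //.
- by split=> //; exact: down_inside.
- split=> x hx.
    by apply: (sign_before cv (lm_d lm u1) D1 v1 hx) => z hz /all[]; lra.
  case/andP: hx => x1 x2; apply: (sign_after cv (lm_d lm u1) D1 v1 x1) => z hz /all[]; lra.
- split=> x hx.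
    case/andP: hx => x1 x2; apply: (sign_before cv (lm_d lm u3) D3 v3 x2) => z hz /all[]; lra.
  by apply: (sign_after cv (lm_d lm u3) D3 v3 hx) => z hz /all[]; lra.
Qed.

End Count.

End Fixed.

End Zeros.

(** * Lower bounds *)

Section LowerBounds.
Context {R : realType} (mu f : R -> R) (zeta xi : R).
Implicit Types (p q x y c : R).
Hypothesis pr : profile mu f zeta xi.
Let std := pr_pot pr.
Notation s2 := (Num.sqrt (2 : R)).
Notation M x := (rho mu x ^+ 3).

Definition clamp (b y : R) : R := Num.max (- b) (Num.min b y).

Lemma clamp_cases b y : 0 < b -> [\/ clamp b y = y /\ - b <= y <= b, clamp b y = - b /\ y < - b | clamp b y = b /\ b < y].
Proof.
move=> b0; rewrite /clamp; have [h1|h1] := leP b y.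
  rewrite max_r; last lra.
  by move: h1; rewrite le_eqVlt => /predU1P[<-|h1]; [constructor 1; split=> //; lra|constructor 3].
have [h2|h2] := leP (- b) y; first by constructor 1; split=> //; lra.
by constructor 2.
Qed.

Lemma clamp_in b y : 0 < b -> - b <= clamp b y <= b.
Proof. by move=> b0; case: (clamp_cases y b0) => -[-> h]; lra. Qed.

Lemma clamp_le_id b x y : 0 < b -> - b < clamp b y -> x <= clamp b y -> x <= y.
Proof. by move=> b0; case: (clamp_cases y b0) => -[-> h]; lra. Qed.

Lemma clamp_ge_id b x y : 0 < b -> clamp b y < b -> clamp b y <= x -> y <= x.
Proof. by move=> b0; case: (clamp_cases y b0) => -[-> h]; lra. Qed.

Lemma clamp_lt_id b x y : 0 < b -> x < b -> clamp b y < x -> y < x.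
Proof. by move=> b0; case: (clamp_cases y b0) => -[-> h]; lra. Qed.

Lemma clamp_gt_id b x y : 0 < b -> - b < x -> x < clamp b y -> x < y.
Proof. by move=> b0; case: (clamp_cases y b0) => -[-> h]; lra. Qed.

Lemma lt_clamp b y z : 0 < b -> - b < z -> y < z -> clamp b y < z.
Proof. by move=> b0; case: (clamp_cases y b0) => -[-> h]; lra. Qed.

Lemma gt_clamp b y z : 0 < b -> z < b -> z < y -> z < clamp b y.
Proof. by move=> b0; case: (clamp_cases y b0) => -[-> h]; lra. Qed.

Lemma ge0_closed (g : R -> R) p q : continuous g -> p < q ->
  (forall x, p < x < q -> 0 <= g x) -> forall x, p <= x <= q -> 0 <= g x.
Proof.
move=> cg pq H x hx; rewrite leNgt; apply/negP => gx.
have [|d d0 hd] := continuous_near (cg x) (_ : 0 < - g x); first by rewrite oppr_gt0.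
pose t := Num.min (d / 2) ((q - p) / 2).
have t0 : 0 < t by rewrite lt_min !divr_gt0 // subr_gt0.
have [t1 t2] : t <= d / 2 /\ t <= (q - p) / 2 by rewrite !ge_min !lexx orbT.
have neg y : `|y - x| <= t -> g y < 0.
  move=> hy; have := hd y ltac:(lra); rewrite ltr_norml; lra.
have [xm|xm] := leP x ((p + q) / 2).
  have := H (x + t / 2) ltac:(lra); have := neg (x + t / 2) ltac:(rewrite ler_norml; lra); lra.
have := H (x - t / 2) ltac:(lra); have := neg (x - t / 2) ltac:(rewrite ler_norml; lra); lra.
Qed.

Variables (eps alpha : R) (v dv F : R -> R) (b th ra rm B Lam : R).
Hypotheses (lm : local_minimizer mu f eps alpha v dv) (e0 : 0 < eps) (b0 : 0 < b) (th0 : 0 < th) (th1 : th <= 1)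
  (ra0 : 0 < ra) (Hb : forall x, - b <= x <= b -> [/\ 0 < mu x, ra <= rho mu x, rho mu x <= rm & `|f x| <= B])
  (hb : mu b <= th ^+ 2) (vb : `|v b| <= 2 * th) (vNb : `|v (- b)| <= 2 * th)
  (al0 : 0 <= alpha) (alL : alpha <= Lam)
  (he : eps * (((2 + Lam) * B / ra) ^+ 2 / th) * (2 * b) <= th)
  (hc : forall x, - b <= x <= b -> dv x = 0 -> `|mu x - v x ^+ 2| * (`|v x| + 2 * rm) <= th)
  (DF : forall x, is_derive x 1 F (dens mu f eps alpha v dv x)).

Local Notation G := (calib mu v).

(** The case kappa = k (1 - th), eta = th of [lower_piece]: s is the sign of v, k the direction in
    which the calibration is followed. Clamping can produce degenerate pieces, so p = q is
    allowed. *)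
Lemma piece p q s k : p <= q -> - b <= p -> q <= b -> s ^+ 2 = 1 -> k ^+ 2 = 1 ->
  (p < q -> forall x, p <= x <= q -> 0 <= s * v x) ->
  k * (1 - th) * (G q - G p) - (k * (1 - th) * s2 - alpha) * s * (M q - M p) / 3
    - eps * (((2 + Lam) * B / ra) ^+ 2 / th) * (q - p) <= F q - F p.
Proof.
move=> pq pb qb ss kk hs.
have [E|lt] : p = q \/ p < q by move: pq; rewrite le_eqVlt => /predU1P.
  by rewrite E !subrr !mulr0 mul0r !subr0.
have nk : `|k| = 1 by exact: sign_norm kk.
have t1 : 0 <= 1 - th by rewrite subr_ge0.
apply: (lower_piece std lm e0 pq ss th0 _ ra0 _ _ DF).
- by rewrite normrM nk mul1r ger0_norm.
- move=> x hx; have [h1 h2 _ h3] := Hb (x := x) ltac:(move: hx pb qb; move=> /andP[]; lra).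
  by split=> //; exact: hs.
- apply: le_trans (ler_normB _ _) _; rewrite (ger0_norm al0).
  apply: lerD => //; rewrite !normrM nk mul1r (ger0_norm t1) (ger0_norm (sqrtr_ge0 _)).
  have := @s2_le2 R; have := @s2_gt1 R; move: th0; move=> h0 h1 h2.
  rewrite -[leRHS]mul1r; apply: ler_pM => //; lra.
Qed.

Lemma calib_small x : 0 <= mu x -> mu x <= th ^+ 2 -> `|v x| <= 2 * th -> `|G x| <= 5 * th.
Proof.
move=> m0 m1 vx; have s1 := @s2_gt1 R; have t0 := ltW th0.
have t2 : th ^+ 2 <= 1 by rewrite exprn_ile1.
rewrite /calib normrM normfV (ger0_norm (sqrtr_ge0 _)) ler_pdivrMr; last by move: s1; lra.
have : `|mu x * v x - v x ^+ 3 / 3| <= 5 * th.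
  apply: le_trans (ler_normB _ _) _; rewrite (normrM (mu x)) (normrM (v x ^+ 3)) normfV normrX (ger0_norm m0) (ger0_norm (ler0n _ 3)).
  have a1 : mu x * `|v x| <= 1 * (2 * th) by apply: ler_pM => //; exact: le_trans t2.
  have a2 : `|v x| ^+ 3 <= (2 * th) ^+ 3 by rewrite lerXn2r // nnegrE mulr_ge0.
  have a3 : th ^+ 3 <= th by rewrite exprS ler_piMr.
  by move: a1 a2 a3 t0; rewrite exprMn; lra.
move=> h; apply: le_trans h _; rewrite ler_peMr ?mulr_ge0 //; exact: ltW.
Qed.

Let G_b : `|G b| <= 5 * th.
Proof. by apply: calib_small => //; apply: ltW; case: (Hb (x := b)) => //; move: b0; lra. Qed.

Let G_Nb : `|G (- b)| <= 5 * th.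
Proof.
apply: calib_small => //; last by rewrite (pot_even std).
by apply: ltW; case: (Hb (x := - b)) => //; move: b0; lra.
Qed.

Let G_clamp y : v y = 0 -> `|G (clamp b y)| <= 5 * th.
Proof.
move=> vy; case: (clamp_cases y b0) => -[-> h] //.
by rewrite /calib vy mulr0 expr0n mul0r subrr mul0r normr0 mulr_ge0 // ltW.
Qed.

Let M_b : 0 <= M b <= th.
Proof.
have r0 : 0 <= rho mu b := sqrtr_ge0 _.
rewrite exprn_ge0 //=; have t0 := ltW th0.
have r1 : rho mu b <= th.
  rewrite -(@ler_pXn2r _ 2) ?nnegrE // rho_sqr // ltW //.
  by case: (Hb (x := b)) => //; move: b0; lra.
apply: le_trans (_ : th ^+ 3 <= th); first by rewrite lerXn2r.
by rewrite exprS ler_piMr // exprn_ile1.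
Qed.

Let M_le x : - b <= x <= b -> 0 <= M x <= rm ^+ 3.
Proof.
move=> /Hb[_ h1 h2 _]; have r0 : 0 <= rho mu x := sqrtr_ge0 _.
by rewrite exprn_ge0 //= lerXn2r // nnegrE // (le_trans r0).
Qed.

Let tsM x : - b <= x <= b -> 0 <= th * s2 * M x <= 2 * rm ^+ 3 * th.
Proof.
move=> /M_le /andP[h1 h2]; have t0 := ltW th0; have s0 : 0 <= s2 := sqrtr_ge0 _.
apply/andP; split; first by apply: mulr_ge0 => //; exact: mulr_ge0.
have -> : 2 * rm ^+ 3 * th = th * 2 * rm ^+ 3 by ring.
apply: ler_pM => //; [exact: mulr_ge0|apply: ler_pM => //; exact: s2_le2].
Qed.

Let tn X c : `|X| <= c -> `|(1 - th) * X| <= c.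
Proof.
move=> h; rewrite normrM; apply: le_trans h; rewrite ler_piMl //.
by rewrite ger0_norm; move: th0 th1; lra.
Qed.

Let Z := eps * (((2 + Lam) * B / ra) ^+ 2 / th).
Let Lth : 0 <= Lam * th /\ alpha * M b <= Lam * th.
Proof.
have /andP[m1 m2] := M_b; split; first by apply: mulr_ge0 (le_trans al0 alL) (ltW th0).
by apply: ler_pM.
Qed.

(** Both pieces follow the calibration upward, and its values at the ends are O(th). The terms in
    rho^3 have opposite signs on the two sides of y, so they add up to twice the value at y. *)
Lemma lower_one y : one_zero v y ->
  2 / 3 * (s2 - alpha) * M (clamp b y) - (40 + 8 * rm ^+ 3 + 2 * Lam) * th <= F b - F (- b).
Proof.
move=> [vy neg pos]; have /andP[y1 y2] := clamp_in y b0.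
have s11 : (-1) ^+ 2 = 1 :> R by rewrite sqrrN expr1n.
have P1 := @piece (- b) (clamp b y) (-1) 1 y1 (lexx _) y2 s11 (expr1n _ _).
have P2 := @piece (clamp b y) b 1 1 y2 y1 (lexx _) (expr1n _ _) (expr1n _ _).
have {}P1 := P1 _.
have {P1}/P1 P1 : - b < clamp b y -> forall x, - b <= x <= clamp b y -> 0 <= -1 * v x.
  move=> h x /andP[x1 x2]; rewrite mulN1r oppr_ge0.
  have xy := clamp_le_id b0 h x2.
  by move: xy; rewrite le_eqVlt => /predU1P[->|/neg/ltW//]; rewrite vy.
have {P2}/P2 P2 : clamp b y < b -> forall x, clamp b y <= x <= b -> 0 <= 1 * v x.
  move=> h x /andP[x1 x2]; rewrite mul1r.
  have xy := clamp_ge_id b0 h x1.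
  by move: xy; rewrite le_eqVlt => /predU1P[<-|/pos/ltW//]; rewrite vy.
have he' := he; rewrite -/Z in P1 P2 he'.
have g1 := tn (G_clamp vy); have g2 := tn G_b; have g3 := tn G_Nb.
have /andP[m1 m2] := tsM (clamp_in y b0).
have /andP[m3 m4] := tsM (x := b) ltac:(move: b0; lra).
have /andP[m5 m6] := M_b; have [l1 l2] := Lth.
have s3 : s2 * M b <= 2 * th by apply: ler_pM => //; exact: s2_le2.
have s4 : 0 <= alpha * M b by rewrite mulr_ge0.
move: P1 P2; rewrite (rho_even std).
move: g1 g2 g3; rewrite !ler_norml => /andP[g1 g1'] /andP[g2 g2'] /andP[g3 g3'].
move: th0 he' g1 g1' g2 g2' g3 g3' m1 m2 m3 m4 m5 m6 l1 l2 s3 s4; lra.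
Qed.

(** At a critical point the Hamiltonian bound, here [hc], brings s v close to rho; the defect of the
    calibration from its value at the well is exactly - (s v - rho)^2 (s v + 2 rho) / (3 s2). *)
Lemma calib_crit s x : s ^+ 2 = 1 -> - b <= x <= b -> 0 <= s * v x -> dv x = 0 ->
  `|s * G x - s2 / 3 * M x| <= 6 * th.
Proof.
move=> ss xb sv d0; have [mx _ r2 _] := Hb xb; have rp := rho_gt0 mx.
have sn : `|s| = 1 by exact: sign_norm ss.
have s1 := @s2_gt1 R; have s20 : 0 < s2 by move: s1; lra.
pose w := s * v x; have w2 : v x ^+ 2 = w ^+ 2 by rewrite exprMn ss mul1r.
have wn : `|v x| = w by rewrite -[w](ger0_norm sv) normrM sn mul1r.
have -> : s * G x - s2 / 3 * M x = - ((w - rho mu x) ^+ 2 * (w + 2 * rho mu x)) / 3 / s2.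
  have -> : s * G x = (rho mu x ^+ 2 * w - w ^+ 3 / 3) / s2.
    rewrite rho_sqr ?(ltW mx) // /calib /w exprMn [s ^+ 3]exprS ss; field; rewrite gt_eqF //.
  have -> : s2 / 3 * M x = 2 / 3 * M x / s2 by rewrite {1}s2V; field; rewrite gt_eqF.
  by field; rewrite gt_eqF.
have h := hc xb d0; rewrite wn w2 in h.
have sq : (w - rho mu x) ^+ 2 <= `|mu x - w ^+ 2|.
  rewrite -(rho_sqr (ltW mx)) subr_sqr normrM -(real_normK (num_real (w - rho mu x))) expr2 distrC.
  rewrite ler_wpM2l // ger0_norm; last by rewrite addr_ge0 // ltW.
  rewrite ler_norml; move: sv rp; rewrite -/w; lra.
have sum0 : 0 <= w + 2 * rho mu x by rewrite addr_ge0 // mulr_ge0 // ltW.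
have : (w - rho mu x) ^+ 2 * (w + 2 * rho mu x) <= th.
  apply: le_trans h; apply: ler_pM => //; first exact: sqr_ge0.
  by move: r2; lra.
set t := _ * _ => ht; have t0 : 0 <= t by rewrite mulr_ge0 // sqr_ge0.
rewrite !normrM !normfV normrN (ger0_norm t0) (gtr0_norm s20) (ger0_norm (ler0n _ 3)).
rewrite ler_pdivrMr //; apply: (@le_trans _ _ (6 * th * 1)); first by move: ht th0; lra.
by rewrite ler_wpM2l ?(ltW s1) // mulr_ge0 // ltW.
Qed.

Let edge_crit s : s ^+ 2 = 1 -> `|s * G b - s2 / 3 * M b| <= 6 * th /\ `|s * G (- b) - s2 / 3 * M (- b)| <= 6 * th.
Proof.
move=> ss; have sn : `|s| = 1 by exact: sign_norm ss.
have /andP[m1 m2] := M_b.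
have h0 : `|s2 / 3 * M b| <= th.
  rewrite ger0_norm; last by rewrite mulr_ge0 // divr_ge0.
  have : s2 * M b <= 2 * th by apply: ler_pM => //; exact: s2_le2.
  by move: th0; lra.
by split; apply: le_trans (ler_normB _ _) _; rewrite normrM sn mul1r ?(rho_even std); move: G_b G_Nb h0; lra.
Qed.

(* Between two consecutive zeros the calibration changes sign at a critical point. *)
Lemma crit_point s p q : s ^+ 2 = 1 -> - b <= p -> p < q -> q <= b -> (v p = 0 \/ p = - b) -> (v q = 0 \/ q = b) ->
  (forall x, p < x < q -> 0 <= s * v x) ->
  exists2 c : R, p <= c <= q & `|s * G c - s2 / 3 * M c| <= 6 * th.
Proof.
move=> ss pb pq qb Hp Hq hs; have [E1 E2] := edge_crit ss.
case: Hp => [vp|->] in pq pb hs *; last by exists (- b) => //; rewrite lexx ltW.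
case: Hq => [vq|->] in pq qb hs *; last by exists b => //; rewrite lexx ltW.
have [|c /andP[c1 c2] E] := @mvt _ v dv p q pq; first by move=> x _; exact: lm_d lm x.
have dc : dv c = 0.
  move: E; rewrite vp vq subrr => /esym/eqP; rewrite mulf_eq0 subr_eq0 => /orP[/eqP//|/eqP h].
  by move: pq; rewrite h ltxx.
exists c; first by rewrite !ltW.
by apply: calib_crit => //; [lra|apply: hs; rewrite c1].
Qed.

(** Six pieces: the calibration is followed upward through the two upward transitions and downward
    between c and d. Switching direction at c produces 2 (G c - s2 M c / 3), which is negligible by
    the choice of c, and similarly at d. *)
Lemma lower_three_sum q1 y q3 c d : `|G q1| <= 5 * th -> `|G q3| <= 5 * th -> v y = 0 ->
  q1 <= c <= y -> y <= d <= q3 -> - b <= q1 -> q3 <= b -> - b <= y -> y <= b ->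
  `|1 * G c - s2 / 3 * M c| <= 6 * th -> `|-1 * G d - s2 / 3 * M d| <= 6 * th ->
  (forall x, - b < q1 -> - b <= x <= q1 -> 0 <= -1 * v x) ->
  (forall x, q1 <= x <= y -> 0 <= 1 * v x) -> (forall x, y <= x <= q3 -> 0 <= -1 * v x) ->
  (forall x, q3 < b -> q3 <= x <= b -> 0 <= 1 * v x) ->
  2 / 3 * ((s2 - alpha) * (M q1 + M q3) + (s2 + alpha) * M y)
   - (200 + 40 * rm ^+ 3 + 2 * Lam) * th <= F b - F (- b).
Proof.
move=> G1 G3 vy /andP[c4 c5] /andP[d4 d5] a1 a4 b1 b2 C1 D1 w1 w2 w3 w4.
have s11 : (-1) ^+ 2 = 1 :> R by rewrite sqrrN expr1n.
have s1 : 1 ^+ 2 = 1 :> R by rewrite expr1n.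
have bc := le_trans a1 c4; have cb := le_trans c5 b2.
have bd := le_trans b1 d4; have db := le_trans d5 a4.
have q1b := le_trans c4 cb; have q3b := le_trans bd d5.
have v2 x : q1 <= x <= c -> 0 <= 1 * v x by case/andP=> h1 h2; apply: w2; rewrite h1 (le_trans h2).
have v3 x : c <= x <= y -> 0 <= 1 * v x by case/andP=> h1 h2; apply: w2; rewrite h2 (le_trans _ h1).
have v4 x : y <= x <= d -> 0 <= -1 * v x by case/andP=> h1 h2; apply: w3; rewrite h1 (le_trans h2).
have v5 x : d <= x <= q3 -> 0 <= -1 * v x by case/andP=> h1 h2; apply: w3; rewrite h2 (le_trans _ h1).
have B1 x : - b <= x -> x <= b -> - b <= x <= b by move=> -> ->.
have /andP[m1 m2] := tsM (B1 _ a1 q1b).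
have /andP[m3 m4] := tsM (B1 _ q3b a4).
have /andP[m5 m6] := tsM (B1 _ (le_trans b1 b2) (lexx b)).
have /andP[m7 m8] := tsM (B1 _ b1 b2).
have /andP[m9 m10] := tsM (B1 _ bc cb).
have /andP[m11 m12] := tsM (B1 _ bd db).
have /andP[m13 m14] := M_b; have [l1 l2] := Lth.
have s3 : s2 * M b <= 2 * th by apply: ler_pM => //; exact: s2_le2.
have s4 : 0 <= alpha * M b by rewrite mulr_ge0.
have g1 := tn G1; have g2 := tn G_b; have g3 := tn G_Nb; have g4 := tn G3.
have {C1 D1}[C1 D1] := (tn C1, tn D1).
have g5 : G y = 0 by rewrite /calib vy mulr0 expr0n mul0r subrr mul0r.
have Q1 := piece a1 (lexx _) q1b s11 s1 (fun h x hx => w1 x h hx).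
have Q2 := piece c4 a1 cb s1 s1 (fun _ => v2).
have Q3 := piece c5 bc b2 s1 s11 (fun _ => v3).
have Q4 := piece d4 b1 db s11 s11 (fun _ => v4).
have Q5 := piece d5 bd a4 s11 s1 (fun _ => v5).
have Q6 := piece a4 q3b (lexx _) s1 s1 (fun h x hx => w4 x h hx).
have he' := he; rewrite -/Z in Q1 Q2 Q3 Q4 Q5 Q6 he'.
move: Q1 Q2 Q3 Q4 Q5 Q6; rewrite (rho_even std) g5.
move: g1 g2 g3 g4 C1 D1; rewrite !ler_norml => /andP[g1 g1'] /andP[g2 g2'] /andP[g3 g3'] /andP[g4 g4'] /andP[C1 C1'] /andP[D1 D1'].
have th0' := th0.
lra.
Qed.

Lemma lower_three y1 y2 y3 : zeta < b -> three_zeros zeta v y1 y2 y3 ->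
  2 / 3 * ((s2 - alpha) * (M (clamp b y1) + M (clamp b y3)) + (s2 + alpha) * M y2)
   - (200 + 40 * rm ^+ 3 + 2 * Lam) * th <= F b - F (- b).
Proof.
move=> zb [[y12 y23 y2z] [v1 v2 v3] [n1 p1] [n2 p2]].
have b0' := b0; have th0' := th0.
have /andP[b1 b2] : - b < y2 < b by move: y2z; rewrite ltr_norml; lra.
have /andP[a1 a2] := clamp_in y1 b0; have /andP[a3 a4] := clamp_in y3 b0.
have c1 : clamp b y1 < y2 by exact: lt_clamp.
have c3 : y2 < clamp b y3 by exact: gt_clamp.
have s11 : (-1) ^+ 2 = 1 :> R by rewrite sqrrN expr1n.
have s1 : 1 ^+ 2 = 1 :> R by rewrite expr1n.
have w1 x : - b < clamp b y1 -> - b <= x <= clamp b y1 -> 0 <= -1 * v x.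
  move=> h /andP[x1 x2]; rewrite mulN1r oppr_ge0.
  by have := clamp_le_id b0 h x2; rewrite le_eqVlt => /predU1P[->|/n1/ltW//]; rewrite v1.
have w2' x : clamp b y1 < x < y2 -> 0 <= 1 * v x.
  move=> /andP[h x2]; rewrite mul1r; apply/ltW/p1; rewrite x2 andbT.
  exact: clamp_lt_id (lt_trans x2 b2) h.
have w3' x : y2 < x < clamp b y3 -> 0 <= -1 * v x.
  move=> /andP[h x2]; rewrite mulN1r oppr_ge0; apply/ltW/n2; rewrite h.
  exact: clamp_gt_id (lt_trans b1 h) x2.
have w4 x : clamp b y3 < b -> clamp b y3 <= x <= b -> 0 <= 1 * v x.
  move=> h /andP[x1 x2]; rewrite mul1r.
  by have := clamp_ge_id b0 h x1; rewrite le_eqVlt => /predU1P[<-|/p2/ltW//]; rewrite v3.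
have csv s : continuous (fun x => s * v x).
  by move=> x; apply: cts_mul; [exact: cts_cst|exact: lm_cv lm x].
have w2 := ge0_closed (csv 1) c1 w2'.
have w3 := ge0_closed (csv (-1)) c3 w3'.
have e1 : v (clamp b y1) = 0 \/ clamp b y1 = - b.
  by case: (clamp_cases y1 b0) => -[E _]; [left; rewrite E|right|by move: c1; rewrite E ltNge ltW].
have e3 : v (clamp b y3) = 0 \/ clamp b y3 = b.
  by case: (clamp_cases y3 b0) => -[E _]; [left; rewrite E|by move: c3; rewrite E ltNge ltW|right].
have [c c45 C1] := crit_point s1 a1 c1 (ltW b2) e1 (or_introl v2) w2'.
have [d d45 D1] := crit_point s11 (ltW b1) c3 a4 (or_introl v2) e3 w3'.
apply: (lower_three_sum (G_clamp v1) (G_clamp v3) v2 c45 d45 a1 a4 (ltW b1) (ltW b2) C1 D1 w1 w2 w3 w4).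
Qed.

End LowerBounds.

(** * Estimates for small epsilon *)

Section Eventually.
Context {R : realType} (mu f : R -> R) (zeta xi : R).
Implicit Types (p q x y c e d h th r eps alpha : R) (v dv F : R -> R).
Implicit Types (Q : R -> R -> (R -> R) -> (R -> R) -> Prop).
Hypothesis pr : profile mu f zeta xi.
Let std := pr_pot pr.
Let dmu := pot_d std.
Let cf := pot_cf std.
Notation s2 := (Num.sqrt (2 : R)).
Notation M x := (rho mu x ^+ 3).
Variable (a0 : R).
Hypothesis a00 : 0 < a0.

(** Eventually in (eps, alpha), uniformly over all local minimizers: such properties combine before
    any family of minimizers is chosen. *)
Definition evt Q : Prop := exists2 e0 : R, 0 < e0 &
  forall eps alpha v dv, local_minimizer mu f eps alpha v dv -> 0 < eps -> eps <= e0 ->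
    `|alpha - a0| <= e0 -> Q eps alpha v dv.

Lemma evt_all Q : (forall eps alpha v dv, local_minimizer mu f eps alpha v dv -> 0 < eps -> Q eps alpha v dv) -> evt Q.
Proof. by move=> H; exists 1 => // eps alpha v dv lm e0 _ _; exact: H. Qed.

Lemma evt_mp Q Q' : evt Q -> evt (fun eps alpha v dv => Q eps alpha v dv -> Q' eps alpha v dv) -> evt Q'.
Proof.
move=> [e1 e10 h1] [e2 e20 h2]; exists (Num.min e1 e2); first by rewrite lt_min e10.
move=> eps alpha v dv lm e0; rewrite !le_min => /andP[u1 u2] /andP[u3 u4].
by apply: h2 => //; exact: h1.
Qed.

Lemma evt_small c : 0 < c -> evt (fun eps alpha _ _ => eps <= c /\ `|alpha - a0| <= c).
Proof. by move=> c0; exists c. Qed.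

Lemma evt_alpha : evt (fun _ alpha _ _ => a0 / 2 <= alpha <= 2 * a0).
Proof.
apply: evt_mp (evt_small (_ : 0 < a0 / 2)) (evt_all _); first by rewrite divr_gt0.
move=> eps alpha v dv _ _ [_]; rewrite ler_norml; move: a00 => h0 /andP[h1 h2]; lra.
Qed.

Lemma evt_unif Q e1 : 0 < e1 -> (forall eps alpha v dv, local_minimizer mu f eps alpha v dv ->
  0 < eps -> eps <= e1 -> 0 <= alpha -> alpha <= 2 * a0 -> Q eps alpha v dv) -> evt Q.
Proof.
move=> e10 H; apply: evt_mp (evt_small e10) (evt_mp evt_alpha (evt_all _)) => eps alpha v dv lm e0.
move: a00 => h0 /andP[h1 h2] [h3 _]; apply: H => //; lra.
Qed.

Lemma evt_hat Q : evt Q -> evt (fun eps alpha v dv => Q eps alpha (hat v) (fun x => dv (- x))).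
Proof.
move=> [e1 e10 H]; exists e1 => // eps alpha v dv lm e0 h1 h2; apply: H => //.
exact (local_minimizer_hat (pot_even std) (pot_odd std) lm).
Qed.

Lemma evt_bound L : exists2 K, 0 < K & evt (fun _ _ v _ => forall x, `|x| <= L -> `|v x| <= K).
Proof.
have L0 : 0 <= 2 * a0 by rewrite mulr_ge0 // ltW.
have [K K0 H] := bound_on dmu cf L L0; exists K => //.
by apply: (evt_unif ltr01) => eps alpha v dv lm e0 e1 h1 h2 x; exact: (H _ _ _ _ _ lm).
Qed.

Lemma dens_primitive eps alpha v dv : local_minimizer mu f eps alpha v dv ->
  exists F, forall x, is_derive x 1 F (dens mu f eps alpha v dv x).
Proof.
move=> lm; apply: antiderivative => x.
have cv := lm_cv lm (x := x); have cdv := lm_cdv lm (x := x); have cm := @pot_cmu _ _ _ std x.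
apply: cts_add.
  apply: cts_add; apply: cts_mul; try exact: cts_cst; apply: cts_exp => //.
  by apply: cts_add; [exact: cts_exp|exact: cts_opp].
by apply/cts_opp/cts_mul => //; apply: cts_mul; [exact: cts_cst|exact: cf].
Qed.

Lemma near_edge c th : c < xi -> 0 < th -> exists b : R, [/\ c < b, zeta < b, b < xi & mu b < th ^+ 2].
Proof.
move=> cx th0; have zx := pr_zx pr.
have [|d d0 hd] := @continuous_near _ mu xi (th ^+ 2) (@pot_cmu _ _ _ std xi); first by rewrite exprn_gt0.
pose m := Num.max (Num.max c zeta) (xi - d).
have m1 : c <= m by rewrite !le_max lexx.
have m2 : zeta <= m by rewrite !le_max lexx orbT.
have m3 : xi - d <= m by rewrite !le_max lexx !orbT.
have m4 : m < xi by rewrite !gt_max cx zx ltrBlDr ltrDl.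
exists ((m + xi) / 2); split; try lra.
have := hd ((m + xi) / 2) ltac:(rewrite ltr_norml; lra).
by rewrite (pr_xi pr) subr0 => /(le_lt_trans (ler_norm _)).
Qed.

Lemma mu_inside b x : b < xi -> `|x| <= b -> 0 < mu x.
Proof. by move=> bx xb; apply: (pr_mu pr); exact: le_lt_trans bx. Qed.

Lemma rho_le_zeta x : `|x| < xi -> rho mu x <= rho mu zeta.
Proof.
move=> xx; apply: ler_wsqrtr.
have -> : mu x = mu `|x|.
  by have [h|h] := leP 0 x; [rewrite ger0_norm|rewrite ltr0_norm // (pot_even std)].
have [h|h|->//] := ltgtP `|x| zeta; apply/ltW.
  by apply: (mu_incr pr).
exact: (mu_decr pr).
Qed.

(** A crude energy bound suffices: the competitor with a transition at 0 and tolerance th = 1, on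
    some [-b, b] containing [-c, c]. *)
Lemma evt_hamil c h : 0 < c -> c < xi -> 0 < h ->
  evt (fun eps _ v dv => forall x, `|x| <= c -> `|hamil mu eps v dv x| <= h).
Proof.
move=> c0 cx h0; have [b [cb zb bx mb]] := near_edge cx (ltr01 (R := R)).
have b0 := lt_trans c0 cb; have L0 : 0 <= 2 * a0 by rewrite mulr_ge0 // ltW.
have hmu x : `|x| <= b -> 0 < mu x := mu_inside bx.
have [e1 e10 up] := @upper_one R mu f std b 1 (2 * a0) 0 b0 ltr01 (lexx 1) L0 hmu mb ltac:(by rewrite normr0).
have [K K0 eK] := evt_bound b.
pose C := 2 / 3 * s2 * M 0 + (50 + 2 * a0).
have M0 : 0 <= M 0 by rewrite exprn_ge0 // sqrtr_ge0.
have C0 : 0 <= C by rewrite addr_ge0 // ?addr_ge0 // !mulr_ge0 // sqrtr_ge0.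
have [D D0 HD] := hamil_bound std b0 L0 (ltW K0) C0.
have q0 : 0 < (h / D) ^+ 2 by rewrite exprn_gt0 // divr_gt0.
apply: evt_mp eK (evt_mp (evt_small q0) _).
apply: (@evt_unif _ (Num.min 1 e1)); first by rewrite lt_min ltr01.
move=> eps alpha v dv lm e0; rewrite le_min => /andP[h1 h2] al0 alL [h3 _] vK x xc.
have [F DF] := dens_primitive lm.
have J : F b - F (- b) <= C.
  apply: le_trans (up _ _ _ _ _ lm e0 h2 al0 alL DF) _.
  by rewrite expr1n mulr1 lerD2r; apply: ler_wpM2r => //; lra.
apply: le_trans (HD _ _ _ _ _ lm e0 h1 al0 alL DF vK J x _) _; first exact: le_trans xc (ltW cb).
have : Num.sqrt eps <= h / D.
  by apply: le_trans (ler_wsqrtr h3) _; rewrite sqrtr_sqr ger0_norm // divr_ge0 // ltW.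
by rewrite ler_pdivlMr // mulrC.
Qed.

(** At a double zero H equals - mu^2 / 4, and mu is at least mu 0 on [-zeta, zeta]: this contradicts
    |H| <= (mu 0)^2 / 8. *)
Lemma evt_nondegenerate : evt (fun _ _ v dv => nondegenerate zeta v dv).
Proof.
have z0 := pr_z0 pr.
have m0 : 0 < mu 0 by apply: (pr_mu pr); rewrite normr0 (lt_trans z0) // (pr_zx pr).
have h0 : 0 < mu 0 ^+ 2 / 8 by rewrite divr_gt0 // exprn_gt0.
apply: evt_mp (evt_hamil z0 (pr_zx pr) h0) (evt_all _) => eps alpha v dv lm e0 H x xz vx dx.
have := H x xz; rewrite /hamil vx dx expr0n /= mulr0 mul0r sub0r subr0 normrN ger0_norm; last first.
  by rewrite divr_ge0 // sqr_ge0.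
have mx : mu 0 <= mu x.
  have -> : mu x = mu `|x|.
    by have [h|h] := leP 0 x; [rewrite ger0_norm|rewrite ltr0_norm // (pot_even std)].
  have := normr_ge0 x; rewrite le_eqVlt => /predU1P[<-//|h].
  by apply/ltW/(mu_incr pr).
have : mu 0 ^+ 2 <= mu x ^+ 2 by rewrite lerXn2r // nnegrE ltW // (lt_le_trans m0).
by have := exprn_gt0 2 m0; lra.
Qed.

(** On the side of m where v' points outward the slope reaches k r / 2 after half the radius, and v
    gains k r^2 / 4 over the other half. *)
Lemma convex_growth v dv ddv m r k K : 0 < r -> 0 <= k ->
  (forall y : R, is_derive y 1 v (dv y)) -> (forall y : R, is_derive y 1 dv (ddv y)) ->
  (forall y, `|y - m| <= r -> k <= ddv y /\ 0 <= v y <= K) -> k * r ^+ 2 / 4 <= K.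
Proof.
move=> r0 k0 D1 D2 H.
have near y : m - r <= y <= m + r -> k <= ddv y /\ 0 <= v y <= K.
  by move=> hy; apply: H; rewrite ler_norml; lra.
have slope y z : m - r <= y -> y <= z -> z <= m + r -> k * (z - y) <= dv z - dv y.
  move=> h1 h2 h3; apply: (derive_cst_ge h2 (fun t _ => D2 t)) => t ht.
  by have [] := near t ltac:(lra).
have kr : 0 <= k * r by rewrite mulr_ge0 // ltW.
have [d0|d0] := leP 0 (dv m).
  have : (k * r / 2) * (m + r - (m + r / 2)) <= v (m + r) - v (m + r / 2).
    apply: (derive_cst_ge _ (fun t _ => D1 t)) => [|t ht]; first lra.
    have := slope m t ltac:(lra) ltac:(lra) ltac:(lra).
    have : k * (r / 2) <= k * (t - m) by rewrite ler_wpM2l //; lra.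
    lra.
  have [_ /andP[_ ]] := near (m + r) ltac:(lra); have [_ /andP[]] := near (m + r / 2) ltac:(lra).
  by lra.
have : v (m - r / 2) - v (m - r) <= - (k * r / 2) * (m - r / 2 - (m - r)).
  apply: (derive_cst_le _ (fun t _ => D1 t)) => [|t ht]; first lra.
  have := slope t m ltac:(lra) ltac:(lra) ltac:(lra).
  have : k * (r / 2) <= k * (m - t) by rewrite ler_wpM2l //; lra.
  lra.
have [_ /andP[_ ]] := near (m - r) ltac:(lra); have [_ /andP[]] := near (m - r / 2) ltac:(lra).
by lra.
Qed.

(** If v were nonnegative on [-xi - d, -xi], then mu <= 0 and f < 0 would give v'' >= k / eps on a
    fixed interval there, incompatible with the uniform bound on v. *)
Lemma evt_neg_left d : 0 < d -> evt (fun _ _ v _ => exists2 x : R, - xi - d <= x <= - xi & v x < 0).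
Proof.
move=> d0; have zx := pr_zx pr; have z0 := pr_z0 pr.
have [K K0 eK] := evt_bound (xi + d).
have [||z zi hz] := @EVT_max _ f (- xi - d) (- xi - d / 2).
- lra.
- by apply: continuous_within => x _; exact: cf.
have fz : f z < 0 by apply: (f_left pr); move: zi; rewrite in_itv /=; lra.
pose k := a0 / 2 * - f z.
have k0 : 0 < k by rewrite mulr_gt0 ?divr_gt0 // oppr_gt0.
have q0 : 0 < k * (d / 4) ^+ 2 / (8 * K) by apply: divr_gt0; apply: mulr_gt0 => //; rewrite exprn_gt0 // divr_gt0.
apply: evt_mp eK (evt_mp (evt_small q0) (evt_mp evt_alpha (evt_all _))) => eps alpha v dv lm e0 /andP[al1 al2] [he _] vK.
apply: contrapT => no.
have v0 x : - xi - d <= x <= - xi -> 0 <= v x.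
  by move=> hx; rewrite leNgt; apply/negP => vx; apply: no; exists x.
have := @convex_growth v dv _ (- xi - 3 * d / 4) (d / 4) (k / eps) K ltac:(lra) ltac:(by rewrite divr_ge0 // ltW) (lm_d lm) (lm_dd lm).
have H y : `|y - (- xi - 3 * d / 4)| <= d / 4 -> k / eps <= (v y ^+ 3 - mu y * v y - eps * alpha * f y) / eps ^+ 2 /\ 0 <= v y <= K.
  rewrite ler_norml => hy; have yi : - xi - d <= y <= - xi - d / 2 by lra.
  have vy := v0 y ltac:(lra).
  have vyK := vK y ltac:(rewrite ler_norml; lra).
  split; last by rewrite vy (le_trans (ler_norm _)).
  rewrite ler_pdivlMr ?exprn_gt0 // (_ : k / eps * eps ^+ 2 = eps * k); last by field; rewrite gt_eqF.
  have my : mu y <= 0.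
    have := mu_decr pr (x := xi) (y := - y) ltac:(lra) ltac:(lra).
    by rewrite (pot_even std) (pr_xi pr) => /ltW.
  have fy : f y <= f z by apply: hz; rewrite in_itv.
  have t1 : 0 <= v y ^+ 3 by rewrite exprn_ge0.
  have t2 : 0 <= - mu y * v y by rewrite mulr_ge0 // oppr_ge0.
  have t3 : k <= alpha * - f y.
    by apply: ler_pM; [rewrite divr_ge0 // ltW|rewrite oppr_ge0 ltW| |rewrite lerN2].
  have : eps * k <= eps * (alpha * - f y) by rewrite ler_pM2l.
  lra.
move=> /(_ H).
have -> : k / eps * (d / 4) ^+ 2 / 4 = k * (d / 4) ^+ 2 / (4 * eps) by field; rewrite gt_eqF.
rewrite ler_pdivrMr ?mulr_gt0 //; move: he; rewrite ler_pdivlMr ?mulr_gt0 //.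
have : 0 < K * eps by rewrite mulr_gt0.
have : 0 < k * (d / 4) ^+ 2 by rewrite mulr_gt0 // exprn_gt0 // divr_gt0.
lra.
Qed.

(** The signs found just outside -xi and xi launch the count, and they confine a single zero to ]-xi
    - d, xi + d[. *)
Lemma evt_zeros d : 0 < d -> evt (fun _ _ v _ =>
  (exists2 y : R, - xi - d < y < xi + d & one_zero v y) \/ exists y1 y2 y3, three_zeros zeta v y1 y2 y3).
Proof.
move=> d0; have zx := pr_zx pr.
apply: evt_mp (evt_neg_left d0) (evt_mp (evt_hat (evt_neg_left d0)) (evt_mp evt_nondegenerate (evt_mp evt_alpha (evt_all _)))).
move=> eps alpha v dv lm e0 /andP[al1 _] nd [xR hR]; rewrite /hat oppr_lt0 => vR [xL hL vL].
have al0 : 0 < alpha by apply: lt_le_trans al1; rewrite divr_gt0.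
have xz1 : xL < - zeta by lra.
have xz2 : zeta < - xR by lra.
by have [[y hy oz]|] := zeros_cases pr e0 al0 lm nd vL vR xz1 xz2; [left; exists y => //; lra|right].
Qed.

Lemma evt_lower b th : zeta < b -> b < xi -> 0 < th -> th <= 1 -> mu b < th ^+ 2 ->
  evt (fun eps alpha v dv => forall F, (forall x, is_derive x 1 F (dens mu f eps alpha v dv x)) ->
   (forall y, one_zero v y ->
     2 / 3 * (s2 - alpha) * M (clamp b y) - (200 + 40 * M zeta + 4 * a0) * th <= F b - F (- b)) /\
   (forall y1 y2 y3, three_zeros zeta v y1 y2 y3 ->
     2 / 3 * ((s2 - alpha) * (M (clamp b y1) + M (clamp b y3)) + (s2 + alpha) * M y2)
       - (200 + 40 * M zeta + 4 * a0) * th <= F b - F (- b))).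
Proof.
move=> zb bx th0 th1 mb; have z0 := pr_z0 pr; have b0 := lt_trans z0 zb.
have L0 : 0 <= 2 * a0 by rewrite mulr_ge0 // ltW.
have [ra [rb [B [ra0 Hb]]]] := potential_bounds std b0 (fun x => mu_inside bx).
have rz0 : 0 <= rho mu zeta := sqrtr_ge0 _.
have Hb' x : - b <= x <= b -> [/\ 0 < mu x, ra <= rho mu x, rho mu x <= rho mu zeta & `|f x| <= B].
  move=> hx; have [h1 h2 _ h3] := Hb x hx; split=> //; apply: rho_le_zeta.
  by apply: le_lt_trans bx; rewrite ler_norml.
have [d [e1 [d0 e10 _ hv]]] := boundary_data std b0 th0 L0 mb.
have [K K0 eK] := evt_bound b.
pose S := K + 2 * rho mu zeta + 1.
have S0 : 0 < S by rewrite /S; lra.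
(* At a critical point |H| = (mu - v^2)^2 / 4, so this bound means |mu - v^2| <= th / S, where S
   dominates |v| + 2 rho. *)
have h0 : 0 < (th / S) ^+ 2 / 4 by rewrite divr_gt0 // exprn_gt0 // divr_gt0.
pose W := ((2 + 2 * a0) * B / ra) ^+ 2 / th.
have W0 : 0 <= W by rewrite divr_ge0 ?sqr_ge0 // ltW.
have q0 : 0 < th / (W * (2 * b) + 1).
  by rewrite divr_gt0 // ltr_wpDl // mulr_ge0 // mulr_ge0 // ltW.
apply: evt_mp eK (evt_mp (evt_hamil b0 bx h0) (evt_mp (evt_small q0) (evt_unif e10 _))).
move=> eps alpha v dv lm e0 ee al0 alL [he _] hH vK F DF.
have vb : `|v b| <= 2 * th by apply: (hv _ _ _ _ _ lm) => //; left; rewrite subrr normr0 ltW.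
have vNb : `|v (- b)| <= 2 * th by apply: (hv _ _ _ _ _ lm) => //; right; rewrite addNr normr0 ltW.
have he' : eps * W * (2 * b) <= th.
  have : eps * (W * (2 * b) + 1) <= th by rewrite -ler_pdivlMr // ltr_wpDl // mulr_ge0 // mulr_ge0 // ltW.
  by rewrite mulrDr mulr1 mulrA; lra.
have hc x : - b <= x <= b -> dv x = 0 -> `|mu x - v x ^+ 2| * (`|v x| + 2 * rho mu zeta) <= th.
  move=> hx dx; have xb : `|x| <= b by rewrite ler_norml.
  have := hH x xb; rewrite /hamil dx expr0n mulr0 mul0r sub0r normrN.
  rewrite ger0_norm; last by rewrite divr_ge0 ?sqr_ge0.
  rewrite ler_pM2r ?invr_gt0 // -(real_normK (num_real (mu x - _))) ler_pXn2r ?nnegrE //; last first.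
    by rewrite divr_ge0 // ltW.
  rewrite ler_pdivlMr // => h; apply: le_trans h.
  by apply: ler_wpM2l => //; have := vK x xb; rewrite /S; lra.
have low := @lower_one R mu f zeta xi pr eps alpha v dv F b th ra (rho mu zeta) B (2 * a0) lm e0 b0 th0 th1 ra0 Hb' (ltW mb) vb vNb al0 alL he' DF.
have low3 := @lower_three R mu f zeta xi pr eps alpha v dv F b th ra (rho mu zeta) B (2 * a0) lm e0 b0 th0 th1 ra0 Hb' (ltW mb) vb vNb al0 alL he' hc DF.
split=> [y oz|y1 y2 y3 tz]; last by apply: le_trans (low3 y1 y2 y3 zb tz); rewrite lerD2l lerN2 ler_pM2r //; lra.
apply: le_trans (low y oz); rewrite lerD2l lerN2 ler_pM2r //.
have : 0 <= M zeta by rewrite exprn_ge0.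
lra.
Qed.

End Eventually.

(** * Location of the zeros *)

Section Location.
Context {R : realType} (mu f : R -> R) (zeta xi : R).
Implicit Types (p q x y c e d h th r eps alpha tol : R) (v dv F : R -> R).
Hypothesis pr : profile mu f zeta xi.
Let std := pr_pot pr.
Let z0 : 0 < zeta. Proof. exact: pr_z0 pr. Qed.
Let zx : zeta < xi. Proof. exact: pr_zx pr. Qed.
Notation s2 := (Num.sqrt (2 : R)).
Notation M x := (rho mu x ^+ 3).

Lemma mu_abs x : mu x = mu `|x|.
Proof. by have [h|h] := leP 0 x; [rewrite ger0_norm|rewrite ltr0_norm // (pot_even std)]. Qed.

Lemma M_ge0 x : 0 <= M x. Proof. by rewrite exprn_ge0 // sqrtr_ge0. Qed.

Lemma M_gt0 x : `|x| < xi -> 0 < M x.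
Proof. by move=> h; rewrite exprn_gt0 // rho_gt0 // (pr_mu pr). Qed.

Lemma M_mono x y : mu x <= mu y -> M x <= M y.
Proof. by move=> h; rewrite lerXn2r ?nnegrE ?sqrtr_ge0 // ler_wsqrtr. Qed.

Lemma M_smono x y : 0 <= mu x -> mu x < mu y -> M x < M y.
Proof.
move=> h1 h2; rewrite ltrXn2r ?nnegrE ?sqrtr_ge0 //.
by rewrite ltr_sqrt //; exact: le_lt_trans h2.
Qed.

Lemma M_max x : `|x| < xi -> M x <= M zeta.
Proof. by move=> h; rewrite lerXn2r ?nnegrE ?sqrtr_ge0 // (rho_le_zeta pr). Qed.

Lemma mu_incr_le x y : 0 <= x -> x <= y -> y <= zeta -> mu x <= mu y.
Proof. by move=> h1; rewrite le_eqVlt => /predU1P[->//|h2] h3; exact/ltW/(mu_incr pr). Qed.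

Lemma mu_decr_le x y : zeta <= x -> x <= y -> mu y <= mu x.
Proof. by move=> h1; rewrite le_eqVlt => /predU1P[->//|h2]; exact/ltW/(mu_decr pr). Qed.

Lemma M_center x : `|x| <= zeta -> M 0 <= M x.
Proof. by move=> h; apply: M_mono; rewrite (mu_abs x) mu_incr_le. Qed.

Lemma M_inside x c : zeta <= c -> `|x| <= c -> Num.min (M 0) (M c) <= M x.
Proof.
move=> zc xc; rewrite ge_min; have [h|h] := leP `|x| zeta; first by rewrite M_center.
by apply/orP; right; apply: M_mono; rewrite (mu_abs x) mu_decr_le // ltW.
Qed.

(** The strict maximum of M at zeta and -zeta in quantitative form: t is the smaller of the drops of
    M at points p and q within d of zeta. *)
Lemma peak d : 0 < d -> exists2 t : R, 0 < t & forall x, `|x| < xi -> M zeta - t < M x -> `| `|x| - zeta| < d.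
Proof.
move=> d0; have z0' := z0; have zx' := zx.
pose p := Num.max 0 (zeta - d); pose q := Num.min (zeta + d) ((zeta + xi) / 2).
have [p0 pz] : 0 <= p /\ p < zeta by rewrite le_max lexx gt_max z0; split=> //; lra.
have [qz qx] : zeta < q /\ q < xi.
  by rewrite lt_min gt_min; split; [apply/andP; split; lra|apply/orP; right; lra].
have Np : M p < M zeta.
  by apply: M_smono; [apply/ltW/(pr_mu pr); rewrite ger0_norm //; lra|exact: (mu_incr pr)].
have Nq : M q < M zeta.
  by apply: M_smono; [apply/ltW/(pr_mu pr); rewrite ger0_norm //; lra|exact: (mu_decr pr)].
exists (Num.min (M zeta - M p) (M zeta - M q)); first by rewrite lt_min !subr_gt0 Np.
move=> x xx hx; have h1 : Num.min (M zeta - M p) (M zeta - M q) <= M zeta - M p by rewrite ge_min lexx.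
have h2 : Num.min (M zeta - M p) (M zeta - M q) <= M zeta - M q by rewrite ge_min lexx orbT.
have xp : p < `|x|.
  rewrite ltNge; apply/negP => h; have : M x <= M p by apply: M_mono; rewrite mu_abs mu_incr_le // ltW.
  by lra.
have xq : `|x| < q.
  rewrite ltNge; apply/negP => h; have : M x <= M q by apply: M_mono; rewrite (mu_abs x) mu_decr_le // ltW.
  by lra.
have h3 : zeta - d <= p by rewrite le_max lexx orbT.
have h4 : q <= zeta + d by rewrite ge_min lexx.
by rewrite ltr_norml; lra.
Qed.

Lemma valley d : 0 < d -> exists2 t : R, 0 < t & forall x, `|x| < zeta -> M x < M 0 + t -> `|x| < d.
Proof.
move=> d0; have z0' := z0; have zx' := zx; pose p := Num.min d zeta.
have [p0 pz] : 0 < p /\ p <= zeta by rewrite lt_min d0 z0 ge_min lexx orbT.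
exists (M p - M 0) => [|x xz]; first rewrite subr_gt0.
  by apply: M_smono; [apply/ltW/(pr_mu pr); rewrite normr0; lra|exact: (mu_incr pr)].
rewrite addrC subrK => hx; rewrite ltNge; apply/negP => h.
have pd : p <= d by rewrite ge_min lexx.
have : M p <= M x by apply: M_mono; rewrite (mu_abs x) mu_incr_le //; [exact: ltW|exact: le_trans h|exact: ltW].
by lra.
Qed.

Variable a0 : R.
Hypothesis a00 : 0 < a0.
Local Notation evt := (evt mu f a0).

(** Lower bounds for both patterns against an upper bound U, the common factor 2/3 being divided
    out. *)
Definition energy_below (b tol : R) (U : R -> R) := evt (fun _ alpha v _ =>
  (forall u, one_zero v u -> (s2 - alpha) * M (clamp b u) <= U alpha + tol) /\
  (forall y1 y2 y3, three_zeros zeta v y1 y2 y3 ->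
    (s2 - alpha) * (M (clamp b y1) + M (clamp b y3)) + (s2 + alpha) * M y2 <= U alpha + tol)).

Lemma compare tol c : 0 < tol -> c < xi -> exists b : R, [/\ c < b, zeta < b, b < xi,
  (forall y, `|y| < b -> energy_below b tol (fun alpha => (s2 - alpha) * M y)) &
  energy_below b tol (fun alpha => 2 * (s2 - alpha) * M zeta + (s2 + alpha) * M 0)].
Proof.
(* E adds the error constants of the lower and upper bounds; th is chosen so that th E fits into 2/3
   tol. *)
move=> t0 cx; pose E := (200 + 40 * M zeta + 4 * a0) + (50 + 2 * a0).
have E0 : 0 < E by have := M_ge0 zeta; have := a00; rewrite /E; lra.
pose th := Num.min 1 (2 / 3 * tol / E).
have th0 : 0 < th by rewrite lt_min ltr01 divr_gt0 // mulr_gt0.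
have th1 : th <= 1 by rewrite ge_min lexx.
have thE : th * E <= 2 / 3 * tol by rewrite -ler_pdivlMr // ge_min lexx orbT.
have th2 : th ^+ 2 <= th by rewrite expr2 ler_piMl // ltW.
have th2' : (50 + 2 * a0) * th ^+ 2 <= (50 + 2 * a0) * th by rewrite ler_wpM2l // addr_ge0 // mulr_ge0 // ltW.
have [b [cb zb bx mb]] := near_edge pr cx th0.
have b0 := lt_trans z0 zb; have L0 : 0 <= 2 * a0 by rewrite mulr_ge0 // ltW.
have hmu x : `|x| <= b -> 0 < mu x := mu_inside pr bx.
have low := evt_lower pr a00 zb bx th0 th1 mb.
have key (U : R -> R) e1 : 0 < e1 -> (forall eps alpha v dv F,
    local_minimizer mu f eps alpha v dv -> 0 < eps -> eps <= e1 -> 0 <= alpha -> alpha <= 2 * a0 ->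
    (forall x, is_derive x 1 F (dens mu f eps alpha v dv x)) ->
    F b - F (- b) <= 2 / 3 * U alpha + (50 + 2 * a0) * th ^+ 2) -> energy_below b tol U.
  move=> e10 up; apply: evt_mp low (evt_unif a00 e10 _) => eps alpha v dv lm e0 ee al0 alL H.
  have [F DF] := dens_primitive pr lm; have [h1 h3] := H F DF.
  have J := up _ _ _ _ F lm e0 ee al0 alL DF.
  split=> [u oz|y1 y2 y3 tz].
    by have := h1 u oz; move: J th2' thE; rewrite /E; clear; lra.
  by have := h3 y1 y2 y3 tz; move: J th2' thE; rewrite /E; clear; lra.
exists b; split=> //.
  move=> y yb; have [e1 e10 up] := @upper_one R mu f std b th (2 * a0) y b0 th0 th1 L0 hmu mb yb.
  by apply: (key _ e1 e10) => eps alpha v dv F lm e0 ee al0 alL DF; rewrite mulrA; exact: (up _ _ _ _ _ lm).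
have [e1 e10 up] := @upper_three R mu f std b th (2 * a0) zeta b0 th0 th1 L0 hmu mb z0 zb.
by apply: (key _ e1 e10) => eps alpha v dv F lm e0 ee al0 alL DF; exact: (up _ _ _ _ _ lm).
Qed.

Lemma clamp_norm b y : 0 < b -> `|clamp b y| <= `|y|.
Proof.
move=> b0; case: (clamp_cases y b0) => -[-> h] //.
  by rewrite normrN (gtr0_norm b0) ler0_norm; lra.
by rewrite !gtr0_norm; lra.
Qed.

Lemma clamp_id b y : 0 < b -> `|clamp b y| < b -> clamp b y = y.
Proof.
by move=> b0; case: (clamp_cases y b0) => -[-> h] //; rewrite ?normrN gtr0_norm // ltxx.
Qed.

Lemma clamp_lt b y : 0 < b -> b < xi -> `|clamp b y| < xi.
Proof. by move=> b0 bx; apply: le_lt_trans bx; rewrite ler_norml clamp_in. Qed.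

Lemma norm_near (y c d : R) : `| `|y| - c| <= d -> `|y + c| <= d \/ `|y - c| <= d.
Proof.
have [y0|y0] := leP 0 y; first by rewrite (ger0_norm y0) => h; right.
by rewrite (ltr0_norm y0) => h; left; rewrite -normrN opprD.
Qed.

(** All transitions have positive cost, and one placed near xi is almost free because M is small
    there. Three zeros cost at least about M 0, and a single zero in [-c, c] at least k m, both too
    much. *)
Lemma locate_subcritical d : a0 < s2 -> 0 < d -> evt (fun _ _ v _ =>
  exists2 y : R, one_zero v y & `|y + xi| <= d \/ `|y - xi| <= d).
Proof.
move=> as2 d0; have z0' := z0; have zx' := zx; have a0' := a00; have s22 := @s2_le2 R; have s21 := @s2_gt1 R.
pose c := Num.max zeta (xi - d).
have [zc cx] : zeta <= c /\ c < xi by rewrite le_max lexx gt_max zx; split=> //; lra.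
have dc : xi - d <= c by rewrite le_max lexx orbT.
pose m := Num.min (M 0) (M c).
have m0 : 0 < m by rewrite lt_min !M_gt0 ?normr0 ?ger0_norm //; lra.
have mM : m <= M 0 by rewrite ge_min lexx.
pose k := (s2 - a0) / 2.
have [k0 k1] : 0 < k /\ k <= 1 by rewrite /k; split; lra.
have km : 0 < k * m by rewrite mulr_gt0.
pose th := Num.min 1 (k * m / 8).
have th0 : 0 < th by rewrite lt_min ltr01 divr_gt0.
have [th1 th2] : th <= 1 /\ th <= k * m / 8 by rewrite !ge_min !lexx orbT.
have [y [cy zy yx my]] := near_edge pr cx th0.
have My : M y <= k * m / 8.
  have y0 : 0 < mu y by apply: (pr_mu pr); rewrite gtr0_norm; lra.
  apply: le_trans th2; apply: (@le_trans _ _ (th ^+ 3)).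
    have r0 : 0 <= rho mu y := sqrtr_ge0 _.
    rewrite lerXn2r ?nnegrE // ?(ltW th0) // -(@ler_pXn2r _ 2) ?nnegrE ?(ltW th0) //.
    by rewrite rho_sqr ltW.
  by rewrite exprS ler_piMr ?exprn_ile1 // ltW.
have km4 : 0 < k * m / 4 by rewrite divr_gt0.
have [b [yb zb bx E1 _]] := compare km4 yx.
have b0 : 0 < b by lra.
have yb' : `|y| < b by rewrite gtr0_norm //; lra.
have {}E1 := E1 y yb'.
apply: evt_mp E1 (evt_mp (evt_zeros pr a00 d0) (evt_mp (evt_small mu f a0 k0) (evt_mp (evt_alpha mu f a00) (evt_all _ _)))).
move=> eps alpha v dv lm e0 /andP[al1 al2] [_ hk] Z [h1 h3].
have {hk} ak : k <= s2 - alpha by move: hk; rewrite ler_norml /k; lra.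
have U : (s2 - alpha) * M y <= k * m / 4.
  have : (s2 - alpha) * M y <= 2 * (k * m / 8) by apply: ler_pM (M_ge0 _) _ My; move: ak k0 s22 al1 a0'; clear - z0 zx a00 std; lra.
  by move=> h; apply: le_trans h _; clear - z0 zx a00 std; lra.
case: Z => [[u hu oz]|[y1 [y2 [y3 tz]]]]; last first.
  have [[_ _ /ltW/M_center m2] _ _ _] := tz.
  have L := h3 _ _ _ tz.
  have t1 : 0 <= (s2 - alpha) * (M (clamp b y1) + M (clamp b y3)) by apply: mulr_ge0; [exact: le_trans (ltW k0) ak|rewrite addr_ge0 // M_ge0].
  have t2 : 1 * M y2 <= (s2 + alpha) * M y2 by apply: ler_wpM2r; [exact: M_ge0|move: s21 al1 a0'; clear - z0 zx a00 std; lra].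
  have t3 : k * m <= 1 * m by rewrite ler_wpM2r // ltW.
  by exfalso; move: L U t1 t2 t3 m2 mM m0; clear - z0 zx a00 std; lra.
exists u => //; apply: norm_near; rewrite ler_norml.
have L := h1 u oz.
have : c < `|clamp b u|.
  rewrite ltNge; apply/negP => h; have := M_inside zc h; rewrite -/m => mm.
  have : k * m <= (s2 - alpha) * M (clamp b u) by apply: ler_pM => //; exact: ltW.
  by move: L U km; clear - z0 zx a00 std; lra.
have := clamp_norm u b0; have : `|u| < xi + d by rewrite ltr_norml; move: hu; clear - z0 zx a00 std; lra.
by move=> h1' h2'; move: (h1') (h2') dc; clear - z0 zx a00 std; lra.
Qed.

(** Upward transitions now have negative cost, most favourable at the maxima of M, so the competitor
    sits at zeta. Three zeros would cost more by about g > 0. *)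
Lemma locate_middle d : s2 < a0 -> 0 < (s2 - a0) * M zeta + (s2 + a0) * M 0 -> 0 < d ->
  evt (fun _ _ v _ => exists2 y : R, one_zero v y & `|y + zeta| <= d \/ `|y - zeta| <= d).
Proof.
move=> as2 g0 d0; have z0' := z0; have zx' := zx; have a0' := a00.
have Mz : 0 < M zeta by apply: M_gt0; rewrite gtr0_norm.
have M0 := M_ge0 0.
pose d' := Num.min d ((xi - zeta) / 2).
have d'0 : 0 < d' by rewrite lt_min d0 divr_gt0 // subr_gt0.
have [dd dx] : d' <= d /\ d' <= (xi - zeta) / 2 by rewrite !ge_min !lexx orbT.
have [t t0 pk] := peak d'0.
pose g := (s2 - a0) * M zeta + (s2 + a0) * M 0; rewrite -/g in g0.
pose k := (a0 - s2) / 2; have k0 : 0 < k by rewrite /k; lra.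
have kt : 0 < k * t by rewrite mulr_gt0.
pose tol := Num.min (k * t / 2) (g / 4).
have tol0 : 0 < tol by rewrite lt_min !divr_gt0.
have [tol1 tol2] : tol <= k * t / 2 /\ tol <= g / 4 by rewrite !ge_min !lexx orbT.
have cx : zeta + d' < xi by lra.
have [b [cb zb bx E1 _]] := compare tol0 cx.
have b0 : 0 < b by lra.
have {}E1 := E1 zeta ltac:(by rewrite gtr0_norm).
(* Replacing a0 by alpha in g changes it by (alpha - a0)(M 0 - M zeta), which this threshold keeps
   below g / 4. *)
have q0 : 0 < g / (4 * (M zeta + M 0)) by rewrite divr_gt0 // mulr_gt0 // ltr_wpDr.
apply: evt_mp E1 (evt_mp (evt_zeros pr a00 d0) (evt_mp (evt_small mu f a0 q0) (evt_mp (evt_small mu f a0 k0) (evt_all _ _)))).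
move=> eps alpha v dv lm e0 [_ hk] [_ hg] Z [h1 h3].
have {hk} ak : k <= alpha - s2 by move: hk; rewrite ler_norml /k; clear - z0 zx a00 std; lra.
have mM x : `|x| < xi -> (s2 - alpha) * M zeta <= (s2 - alpha) * M x.
  by move=> h; rewrite ler_wnM2l ?M_max //; move: ak k0; clear - z0 zx a00 std; lra.
case: Z => [[u hu oz]|[y1 [y2 [y3 tz]]]]; last first.
  have [[_ _ yz] _ _ _] := tz; have m2 := M_center (ltW yz).
  have L := h3 _ _ _ tz.
  have t1 := mM _ (clamp_lt y1 b0 bx); have t2 := mM _ (clamp_lt y3 b0 bx).
  have t3 : (s2 + alpha) * M 0 <= (s2 + alpha) * M y2.
    by rewrite ler_wpM2l //; have := @s2_gt1 R; move: ak k0; clear - z0 zx a00 std; lra.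
  have t4 : `|(alpha - a0) * (M 0 - M zeta)| <= g / 4.
    rewrite normrM; apply: (@le_trans _ _ (g / (4 * (M zeta + M 0)) * (M zeta + M 0))).
      apply: ler_pM => //; apply: le_trans (ler_normB _ _) _; rewrite !ger0_norm //; move: Mz M0; clear - z0 zx a00 std; lra.
    rewrite (_ : _ * _ = g / 4) //; field; rewrite gt_eqF //; move: Mz M0; clear - z0 zx a00 std; lra.
  by exfalso; move: t4; rewrite ler_norml /g in tol2 g0 *; move: L t1 t2 t3 tol2 g0; clear - z0 zx a00 std; lra.
exists u => //; have L := h1 u oz; have cl := clamp_lt u b0 bx.
have : M zeta - t < M (clamp b u).
  rewrite ltNge; apply/negP => h.
  have : k * t <= (alpha - s2) * (M zeta - M (clamp b u)) by apply: ler_pM (ltW k0) (ltW t0) ak _; rewrite lerBrDr addrC -lerBrDr.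
  by move: L kt tol1; clear - z0 zx a00 std; lra.
move=> /(pk _ cl) near; have E : clamp b u = u.
  by apply: clamp_id => //; move: near cb; rewrite ltr_norml; clear - z0 zx a00 std; lra.
by apply: norm_near; rewrite E in near; apply: le_trans (ltW near) dd.
Qed.

(** Here g < 0, so three transitions beat one. Each of the three terms is bounded below by its
    optimal value, so near equality forces each zero close to an optimal place. *)
Lemma locate_supercritical d : (s2 - a0) * M zeta + (s2 + a0) * M 0 < 0 -> 0 < d ->
  evt (fun _ _ v _ => exists y1 y2 y3, three_zeros zeta v y1 y2 y3 /\
    [/\ `|y1 + zeta| <= d, `|y2| <= d & `|y3 - zeta| <= d]).
Proof.
move=> g0 d0; have z0' := z0; have zx' := zx; have a0' := a00; have s21 := @s2_gt1 R.
have Mz : 0 < M zeta by apply: M_gt0; rewrite gtr0_norm.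
have M0 : 0 < M 0 by apply: M_gt0; rewrite normr0; lra.
have as2 : s2 < a0.
  rewrite ltNge; apply/negP => h.
  have : 0 <= (s2 - a0) * M zeta by rewrite mulr_ge0 ?subr_ge0 // ltW.
  have : 0 <= (s2 + a0) * M 0 by apply: mulr_ge0; [lra|exact: ltW].
  by lra.
(* The bound zeta / 3 separates -zeta, 0 and zeta, so the order of the zeros decides which of y1 and
   y3 is near -zeta. *)
pose d' := Num.min d (Num.min ((xi - zeta) / 2) (zeta / 3)).
have d'0 : 0 < d' by rewrite !lt_min d0 !divr_gt0 // subr_gt0.
have [dd dx dz] : [/\ d' <= d, d' <= (xi - zeta) / 2 & d' <= zeta / 3] by rewrite !ge_min !lexx !orbT.
have [t t0 pk] := peak d'0; have [t' t'0 vl] := valley d'0.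
pose g := (s2 - a0) * M zeta + (s2 + a0) * M 0; rewrite -/g in g0.
pose k := (a0 - s2) / 2; have k0 : 0 < k by rewrite /k; lra.
have kt : 0 < k * t by rewrite mulr_gt0.
pose tol := Num.min (k * t / 2) (Num.min (t' / 2) (- g / 4)).
have tol0 : 0 < tol by rewrite !lt_min !divr_gt0 // oppr_gt0.
have [tol1 tol2 tol3] : [/\ tol <= k * t / 2, tol <= t' / 2 & tol <= - g / 4] by rewrite !ge_min !lexx !orbT.
have cx : zeta + d' < xi by lra.
have [b [cb zb bx _ E3]] := compare tol0 cx.
have b0 : 0 < b by lra.
have q0 : 0 < - g / (4 * (M zeta + M 0)) by rewrite divr_gt0 ?oppr_gt0 // mulr_gt0 // addr_gt0.
apply: evt_mp E3 (evt_mp (evt_zeros pr a00 d0) (evt_mp (evt_small mu f a0 q0) (evt_mp (evt_small mu f a0 k0) (evt_all _ _)))).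
move=> eps alpha v dv lm e0 [_ hk] [_ hg] Z [h1 h3].
have {hk} ak : k <= alpha - s2 by move: hk; rewrite ler_norml /k; clear - z0 zx a00 std; lra.
have mM x : `|x| < xi -> (s2 - alpha) * M zeta <= (s2 - alpha) * M x.
  by move=> h; rewrite ler_wnM2l ?M_max //; move: ak k0; clear - z0 zx a00 std; lra.
case: Z => [[u hu oz]|[y1 [y2 [y3 tz]]]].
  have L := h1 _ oz; have t1 := mM _ (clamp_lt u b0 bx).
  have t4 : `|(alpha - a0) * (M 0 - M zeta)| <= - g / 4.
    rewrite normrM; apply: (@le_trans _ _ (- g / (4 * (M zeta + M 0)) * (M zeta + M 0))).
      apply: ler_pM => //; apply: le_trans (ler_normB _ _) _; rewrite !gtr0_norm //; move: Mz M0; clear - z0 zx a00 std; lra.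
    rewrite (_ : _ * _ = - g / 4) //; field; rewrite gt_eqF //; move: Mz M0; clear - z0 zx a00 std; lra.
  by exfalso; move: t4; rewrite ler_norml /g in tol3 g0 *; move: L t1 tol3 g0; clear - z0 zx a00 std; lra.
exists y1, y2, y3; split=> //.
have [[y12 y23 yz] _ _ _] := tz; have m2 := M_center (ltW yz); have L := h3 _ _ _ tz.
have c1 := clamp_lt y1 b0 bx; have c3 := clamp_lt y3 b0 bx.
have t1 := mM _ c1; have t2 := mM _ c3.
have s2a : 1 <= s2 + alpha by move: ak k0 s21; clear - z0 zx a00 std; lra.
have t4 : 1 * (M y2 - M 0) <= (s2 + alpha) * (M y2 - M 0) by apply: ler_wpM2r s2a; rewrite subr_ge0.
have n2 : `|y2| < d' by apply: vl => //; move: L t1 t2 t4 tol2 t'0; clear - z0 zx a00 std; lra.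
have loc y : `|clamp b y| < xi -> (alpha - s2) * (M zeta - M (clamp b y)) <= tol -> `| `|y| - zeta| < d'.
  move=> cl hy; have : M zeta - t < M (clamp b y).
    rewrite ltNge; apply/negP => h.
    have : k * t <= (alpha - s2) * (M zeta - M (clamp b y)) by apply: ler_pM (ltW k0) (ltW t0) ak _; rewrite lerBrDr addrC -lerBrDr.
    by move: kt tol1 hy; clear - z0 zx a00 std; lra.
  move=> /(pk _ cl) near; have E : clamp b y = y.
    by apply: clamp_id => //; move: near cb; rewrite ltr_norml; clear - z0 zx a00 std; lra.
  by rewrite E in near.
have t3 : 0 <= (s2 + alpha) * (M y2 - M 0) by rewrite mulr_ge0 ?subr_ge0 // (le_trans ler01).
have n1 : `|y1 + zeta| <= d' \/ `|y1 - zeta| <= d'.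
  by apply/norm_near/ltW/(loc y1 c1); move: L t2 t3; clear - z0 zx a00 std; lra.
have n3 : `|y3 + zeta| <= d' \/ `|y3 - zeta| <= d'.
  by apply/norm_near/ltW/(loc y3 c3); move: L t1 t3; clear - z0 zx a00 std; lra.
move: n2; rewrite ltr_norml => /andP[n2 n2'].
split.
- by case: n1; rewrite !ler_norml; move: y12 n2 n2' dd dz z0'; clear - z0 zx a00 std; lra.
- by rewrite ler_norml; move: n2 n2' dd; clear - z0 zx a00 std; lra.
- by case: n3; rewrite !ler_norml; move: y23 n2 n2' dd dz z0'; clear - z0 zx a00 std; lra.
Qed.

End Location.

(** * Blow-up *)

Section KinkODE.
Context {R : realType}.
Implicit Types (w dw W dW e : R -> R) (k K eta L s sg m : R).

(* Gronwall for |w - W|^2 + |w' - W'|^2. *)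
Lemma ode_close w dw W dW e k K eta L : 0 <= k -> 0 <= L -> 0 <= eta ->
  (forall s : R, is_derive s 1 w (dw s)) -> (forall s : R, is_derive s 1 dw (w s ^+ 3 - k * w s + e s)) ->
  (forall s : R, is_derive s 1 W (dW s)) -> (forall s : R, is_derive s 1 dW (W s ^+ 3 - k * W s)) ->
  (forall s, 0 <= s <= L -> [/\ `|w s| <= K, `|W s| <= K & `|e s| <= eta]) ->
  forall s, 0 <= s <= L -> (w s - W s) ^+ 2 + (dw s - dW s) ^+ 2 <=
    ((w 0 - W 0) ^+ 2 + (dw 0 - dW 0) ^+ 2 + eta ^+ 2 * L) * expR ((2 + 3 * K ^+ 2 + k) * L).
Proof.
move=> k0 L0 et0 D1 D2 D3 D4 H.
pose N s := (w s - W s) ^+ 2 + (dw s - dW s) ^+ 2.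
pose dN s := 2 * (w s - W s) * (dw s - dW s) +
  2 * (dw s - dW s) * ((w s - W s) * (w s ^+ 2 + w s * W s + W s ^+ 2) - k * (w s - W s) + e s).
have DN (s : R) : is_derive s 1 N (dN s).
  have := is_derive_add (is_derive_exp 2 (is_derive_add (D1 s) (is_derive_opp (D3 s))))
    (is_derive_exp 2 (is_derive_add (D2 s) (is_derive_opp (D4 s)))).
  by move=> H'; apply: is_derive_eq H' _; rewrite /dN /=; ring.
pose C := 2 + 3 * K ^+ 2 + k.
have K20 := sqr_ge0 K.
have C0 : 0 <= C by rewrite /C; lra.
have le s : 0 <= s <= L -> dN s <= C * N s + eta ^+ 2.
  move=> hs; have [h1 h2 h3] := H s hs; rewrite /dN /N.
  move: (w s - W s) (dw s - dW s) => a b.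
  pose q := 1 + (w s ^+ 2 + w s * W s + W s ^+ 2) - k.
  have q1 : `|q| <= 1 + 3 * K ^+ 2 + k.
    have K0 : 0 <= K := le_trans (normr_ge0 _) h1.
    have b1 : `|w s ^+ 2| <= K ^+ 2 by rewrite normrX lerXn2r ?nnegrE.
    have b2 : `|W s ^+ 2| <= K ^+ 2 by rewrite normrX lerXn2r ?nnegrE.
    have b3 : `|w s * W s| <= K ^+ 2 by rewrite normrM expr2; apply: ler_pM.
    apply: le_trans (ler_normB _ _) _; rewrite (ger0_norm k0) lerD2r.
    apply: le_trans (ler_normD _ _) _; rewrite normr1.
    have := ler_normD (w s ^+ 2 + w s * W s) (W s ^+ 2); have := ler_normD (w s ^+ 2) (w s * W s).
    by move: b1 b2 b3; clear; lra.
  have q2 : 2 * (a * b) * q <= (1 + 3 * K ^+ 2 + k) * (a ^+ 2 + b ^+ 2).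
    have ab : `|2 * (a * b)| <= a ^+ 2 + b ^+ 2.
      rewrite ler_norml; have := sqr_ge0 (a + b); have := sqr_ge0 (a - b).
      by clear; lra.
    by apply: le_trans (ler_norm _) _; rewrite normrM mulrC; apply: ler_pM.
  have q3 : 2 * b * e s <= b ^+ 2 + eta ^+ 2.
    have e2 : e s ^+ 2 <= eta ^+ 2.
      by rewrite -(real_normK (num_real (e s))) lerXn2r ?nnegrE.
    by have := sqr_ge0 (b - e s); move: e2; clear; lra.
  by move: q2 q3 (sqr_ge0 a); rewrite /q /C; clear; lra.
move=> s /andP[s0 sL].
have g := @gronwall R N dN C (eta ^+ 2) s s0 C0 (sqr_ge0 _) (fun t _ => DN t)
  (fun t ht => le t ltac:(move: ht sL; clear; move=> /andP[]; lra)).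
apply: le_trans g _.
have N0 : 0 <= N 0 by rewrite addr_ge0 ?sqr_ge0.
apply: ler_pM.
- by rewrite addr_ge0 // mulr_ge0 // sqr_ge0.
- exact: expR_ge0.
- by rewrite lerD2l ler_wpM2l ?sqr_ge0.
- by rewrite ler_expR ler_wpM2l.
Qed.

Definition kink_profile sg m s : R := sg * (Num.sqrt m * tanh (s * Num.sqrt (m / 2))).
Definition kink_slope sg m s : R := sg * (Num.sqrt m * ((1 - tanh (s * Num.sqrt (m / 2)) ^+ 2) * Num.sqrt (m / 2))).

Lemma is_derive_kink sg m s : is_derive s 1 (kink_profile sg m) (kink_slope sg m s).
Proof.
pose c := Num.sqrt (m / 2).
have D : is_derive s 1 (fun t : R => tanh (t * c)) ((1 - tanh (s * c) ^+ 2) * c).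
  apply: is_derive_comp1; first exact: is_derive_tanh.
  apply: is_derive_eq (is_derive_mul (is_derive_id1 s) (is_derive_cst1 c s)) _; ring.
have := is_derive_mul (is_derive_cst1 sg s) (is_derive_mul (is_derive_cst1 (Num.sqrt m) s) D).
by move=> H; apply: is_derive_eq H _; rewrite /kink_slope -/c; ring.
Qed.

Lemma is_derive_kink_slope sg m s : sg ^+ 2 = 1 -> 0 <= m ->
  is_derive s 1 (kink_slope sg m) (kink_profile sg m s ^+ 3 - m * kink_profile sg m s).
Proof.
move=> ss m0; pose c := Num.sqrt (m / 2); pose r := Num.sqrt m.
have cE : c ^+ 2 = m / 2 by rewrite sqr_sqrtr // divr_ge0.
have rE : r ^+ 2 = m by rewrite sqr_sqrtr.
have D : is_derive s 1 (fun t : R => tanh (t * c)) ((1 - tanh (s * c) ^+ 2) * c).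
  apply: is_derive_comp1; first exact: is_derive_tanh.
  apply: is_derive_eq (is_derive_mul (is_derive_id1 s) (is_derive_cst1 c s)) _; ring.
have := is_derive_mul (is_derive_cst1 sg s) (is_derive_mul (is_derive_cst1 r s)
  (is_derive_mul (is_derive_add (is_derive_cst1 1 s) (is_derive_opp (is_derive_exp 2 D))) (is_derive_cst1 c s))).
move=> H; apply: is_derive_eq H _; rewrite /kink_profile -/c -/r /=.
set t := tanh _; have -> : (sg * (r * t)) ^+ 3 = sg ^+ 2 * r ^+ 2 * (sg * r * t ^+ 3) by ring.
rewrite ss rE; have -> : m = 2 * c ^+ 2 by rewrite cE; field.
by ring.
Qed.

Lemma kink_profile0 sg m : kink_profile sg m 0 = 0.
Proof. by rewrite /kink_profile mul0r tanh0 !mulr0. Qed.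

Lemma kink_profileN sg m s : kink_profile sg m (- s) = - kink_profile sg m s.
Proof. by rewrite /kink_profile mulNr tanhN !mulrN. Qed.

Lemma kink_slopeN sg m s : kink_slope sg m (- s) = kink_slope sg m s.
Proof. by rewrite /kink_slope mulNr tanhN sqrrN. Qed.

Lemma kink_slope0 sg m : 0 <= m -> kink_slope sg m 0 = sg * (m / Num.sqrt 2).
Proof.
move=> m0; rewrite /kink_slope mul0r tanh0 expr0n subr0 mul1r sqrtrM // sqrtrV //.
by rewrite [Num.sqrt m * _]mulrA -expr2 sqr_sqrtr.
Qed.

Lemma kink_bound sg m s : `|sg| = 1 -> `|kink_profile sg m s| <= Num.sqrt m.
Proof.
by move=> sn; rewrite /kink_profile normrM sn mul1r tanh_mul_le // sqrtr_ge0.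
Qed.

End KinkODE.

(** * Behaviour of v at scale eps: outside, in the wells, and at a zero *)

Section BlowUp.
Context {R : realType} (mu f : R -> R) (zeta xi : R).
Implicit Types (p q x y z c l d h th r eps alpha L m sg s : R) (v dv F : R -> R).
Hypothesis pr : profile mu f zeta xi.
Let std := pr_pot pr.
Let dmu := pot_d std.
Let cf := pot_cf std.
Variable a0 : R.
Hypothesis a00 : 0 < a0.
Local Notation evt := (evt mu f a0).

(** For v this is the barrier. For eps v', the mean value theorem on [x, x + eps] finds a point
    where it is at most 2 t, and the equation bounds eps^2 v'', hence its variation over that
    length. *)
Lemma evt_vanish x0 th : 0 < th -> mu x0 <= 0 -> exists2 d : R, 0 < d & evt (fun eps _ v dv =>
  forall x, `|x - x0| <= d -> `|v x| <= th /\ `|eps * dv x| <= th).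
Proof.
move=> th0 m0; have L0 : 0 <= 2 * a0 by rewrite mulr_ge0 // ltW.
have [Mb Mb0 hM] := continuous_bounded (x0 - 1) (x0 + 1) (@pot_cmu _ _ _ std).
have [B B0 hB] := continuous_bounded (x0 - 1) (x0 + 1) cf.
pose t := Num.min 1 (th / (2 * (4 + Mb))).
have t0 : 0 < t by rewrite lt_min ltr01 divr_gt0 // mulr_gt0 // addr_gt0.
have [t1 tM] : t <= 1 /\ t * (2 * (4 + Mb)) <= th.
  by rewrite -ler_pdivlMr ?mulr_gt0 ?addr_gt0 // !ge_min !lexx orbT.
have [d0 [e1 [d00 e10 sm]]] := @small_near R mu f dmu cf x0 t (2 * a0) L0 t0 (le_lt_trans m0 (exprn_gt0 2 t0)).
pose d := Num.min d0 1 / 2.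
have d'0 : 0 < d by rewrite divr_gt0 // lt_min d00 ltr01.
have [d1 d2] : 2 * d <= d0 /\ 2 * d <= 1.
  by rewrite /d mulrC divfK // !ge_min !lexx orbT.
exists d => //.
have q0 : 0 < th / (2 * (2 * a0 * B)) by rewrite divr_gt0 // mulr_gt0 // mulr_gt0 // mulr_gt0.
apply: evt_mp (evt_small mu f a0 d'0) (evt_mp (evt_small mu f a0 q0) (evt_unif a00 e10 _)).
move=> eps alpha v dv lm e0 ee al0 alL [he _] [hd _] x xd.
have sm' y : `|y - x0| <= 2 * d -> `|v y| <= t.
  by move=> hy; apply: (sm _ _ _ _ _ lm) => //; exact: le_trans d1.
have tth : t <= th by move: tM t0 Mb0 (mulr_gt0 t0 Mb0); clear - a00 std; lra.
have near y : x <= y <= x + eps -> `|y - x0| <= 2 * d.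
  by move: xd; rewrite !ler_norml; move: hd e0; clear - a00 std; move=> ? ? /andP[? ?] /andP[? ?]; lra.
split; first by apply: le_trans (sm' x _) tth; apply: near; rewrite lexx lerDl ltW.
pose g y := (v y ^+ 3 - mu y * v y - eps * alpha * f y) / eps ^+ 2.
have gb y : x <= y <= x + eps -> `|g y| * eps ^+ 2 <= t * (1 + Mb) + th / 2.
  move=> hy; have vy := sm' y (near y hy).
  have yi : x0 - 1 <= y <= x0 + 1.
    by have := near y hy; rewrite ler_norml; move: d2; clear - a00 std; move=> ? /andP[? ?]; lra.
  rewrite /g normrM normfV [X in _ / X]ger0_norm ?sqr_ge0 // divfK ?gt_eqF ?exprn_gt0 //.
  apply: le_trans (ler_normB _ _) _; apply: lerD.
    apply: le_trans (ler_normB _ _) _; rewrite mulrDr mulr1; apply: lerD.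
      rewrite normrX; apply: (@le_trans _ _ (t ^+ 3)); first by rewrite lerXn2r ?nnegrE // ltW.
      by rewrite exprS ler_piMr ?exprn_ile1 // ltW.
    by rewrite normrM mulrC; apply: ler_pM => //; exact: hM.
  rewrite !normrM (ger0_norm al0) (gtr0_norm e0).
  apply: (@le_trans _ _ (eps * (2 * a0 * B))).
    by rewrite -mulrA ler_pM2l //; apply: ler_pM => //; exact: hB.
  have hh : 0 < 2 * (2 * a0 * B) by rewrite !mulr_gt0.
  by move: he; rewrite ler_pdivlMr //; clear - a00 std; lra.
have xe : x < x + eps by rewrite ltrDl.
have [y /andP[y1 y2] E1] := mvt xe (fun y _ => lm_d lm y).
have [z /andP[z1 z2] E2] := mvt y1 (fun y _ => lm_dd lm y).
have b1 : `|eps * dv y| <= 2 * t.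
  have -> : eps * dv y = v (x + eps) - v x by rewrite E1; ring.
  apply: le_trans (ler_normB _ _) _; rewrite mulr_natl mulr2n.
  by apply: lerD; apply: sm'; apply: near; rewrite ?lexx ?lerDl ltW.
have b2 : `|eps * (dv y - dv x)| <= t * (1 + Mb) + th / 2.
  apply: le_trans (gb z _); last by rewrite (ltW z1) (ltW (lt_trans z2 y2)).
  rewrite E2 -/(g z) (_ : eps * (g z * (y - x)) = g z * (eps * (y - x))); last by ring.
  rewrite (normrM (g z)); apply: ler_wpM2l => //.
  rewrite ger0_norm; last by rewrite mulr_ge0 ?subr_ge0 // ltW.
  by rewrite expr2 ler_pM2l //; move: y2; clear - a00 std; lra.
have -> : eps * dv x = eps * dv y - eps * (dv y - dv x) by ring.
by apply: le_trans (ler_normB _ _) _; move: b1 b2 tM t0; clear - a00 std; lra.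
Qed.

(** A gap between sg v and rho is excluded by [escape]; the margin r is the room in which v would
    escape. The Hamiltonian then bounds eps v'. *)
Lemma evt_flat p q r th sg : - xi < p -> q < xi -> 0 < r -> 0 < th -> sg ^+ 2 = 1 ->
  evt (fun eps _ v dv => (forall x, p <= x <= q -> 0 <= sg * v x) ->
    forall x, p + r <= x <= q - r -> `|sg * v x - rho mu x| <= th /\ `|eps * dv x| <= th).
Proof.
move=> px qx r0 th0 ss; have sn := sign_norm ss.
have z0 := pr_z0 pr; have zx := pr_zx pr.
pose c := Num.max (Num.max (- p) q) zeta.
have [c0 cx] : 0 < c /\ c < xi.
  by rewrite lt_max z0 orbT !gt_max qx zx !andbT; split=> //; lra.
have pc x : p <= x <= q -> - c <= x <= c.
  have : - p <= c by rewrite !le_max lexx.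
  have : q <= c by rewrite !le_max lexx orbT.
  lra.
have [ra [rb [B [ra0 Hb]]]] := potential_bounds std c0 (fun x => mu_inside pr cx).
have [K K0 eK] := evt_bound pr a00 c.
pose B1 := B + 1.
have B0 : 0 <= B by have [_ _ _ h] := Hb c ltac:(lra); exact: le_trans h.
have [d [d0 d1 d2]] : exists d : R, [/\ 0 < d, d <= th * ra & d <= th / 2].
  by exists (Num.min (th * ra) (th / 2)); rewrite lt_min mulr_gt0 ?divr_gt0 // !ge_min !lexx orbT.
have B10 : 0 < B1 by rewrite /B1; lra.
have [r' [r'0 r1 r2]] : exists r' : R, [/\ 0 < r', r' <= r & r' * (4 * B1) <= d].
  exists (Num.min r (d / (4 * B1))).
  by rewrite -ler_pdivlMr ?mulr_gt0 // !ge_min !lexx orbT lt_min r0 divr_gt0 // mulr_gt0.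
have h0 : 0 < d ^+ 2 / 32 by rewrite divr_gt0 // exprn_gt0.
have q0 : 0 < r' * d / (8 * K) by rewrite divr_gt0 // mulr_gt0.
apply: evt_mp (evt_hamil pr a00 c0 cx h0) (evt_mp eK (evt_mp (evt_small mu f a0 q0) (evt_all _ _))).
move=> eps alpha v dv lm e0 [he _] vK hH pos x xpq.
have hK : 4 * eps * K < r' * d.
  have : 0 < r' * d by rewrite mulr_gt0.
  have K8 : 0 < 8 * K by rewrite mulr_gt0.
  by move: he; rewrite ler_pdivlMr //; clear - a00 std; lra.
have mlip y y' : p <= y -> y <= y' -> y' <= q -> y' - y <= r' -> `|mu y' - mu y| <= d / 2.
  move=> h1 h2 h3 h4; have [t /andP[t1 t2] ->] := mvt_le h2 (fun t _ => dmu t).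
  have [_ _ _ ft] := Hb t (pc t ltac:(lra)).
  rewrite !normrM normrN (ger0_norm (ler0n _ 2)) [X in _ * X]ger0_norm ?subr_ge0 //.
  have : `|f t| * (y' - y) <= B1 * r'.
    by apply: ler_pM; rewrite ?subr_ge0 // /B1; lra.
  by move: r2; clear - a00 std; lra.
have ham y : p <= y <= q -> (mu y - (sg * v y) ^+ 2) ^+ 2 / 4 - d ^+ 2 / 32 <= eps ^+ 2 * (sg * dv y) ^+ 2 / 2.
  move=> hy; have := hH y ltac:(rewrite ler_norml; exact: pc).
  rewrite !exprMn ss !mul1r /hamil ler_norml; clear - a00 std; move=> /andP[]; lra.
have ham' y : p <= y <= q -> eps ^+ 2 * dv y ^+ 2 / 2 - (mu y - v y ^+ 2) ^+ 2 / 4 <= d ^+ 2 / 32.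
  by move=> hy; have := hH y ltac:(rewrite ler_norml; exact: pc); rewrite /hamil ler_norml; clear - a00 std; move=> /andP[].
have vp y : p <= y <= q -> 0 <= sg * v y <= K.
  move=> hy; rewrite pos //=; apply: le_trans (ler_norm _) _; rewrite normrM sn mul1r.
  by apply: vK; rewrite ler_norml; exact: pc.
have Dv (y : R) : is_derive y 1 (fun y => sg * v y) (sg * dv y).
  by apply: is_derive_eq (is_derive_mul (is_derive_cst1 sg y) (lm_d lm y)) _; ring.
have cdv : continuous (fun y => sg * dv y).
  by move=> y; apply: cts_mul; [exact: cts_cst|exact: lm_cdv lm y].
have xpq' : p <= x <= q by lra.
have right y : x <= y <= x + r' -> [/\ p <= x, y <= q, y - x <= r' & p <= y <= q].
  by move: xpq r1 r0; clear - a00 std => /andP[? ?] ? ? /andP[? ?]; split; lra.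
have left y : - x <= y <= - x + r' -> [/\ p <= - y, x <= q, x - - y <= r' & p <= - y <= q].
  by move: xpq r1 r0; clear - a00 std => /andP[? ?] ? ? /andP[? ?]; split; lra.
(* t = 1 treats sg v below the well, t = -1 above it. According to the sign of v' at x, the function
   or its reflection moves away from the well; if v' x = 0, the Hamiltonian alone excludes the
   gap. *)
have main t : t ^+ 2 = 1 -> ~ (d <= t * (mu x - (sg * v x) ^+ 2)).
  move=> tt hd.
  have [dx|dx|dx] := ltgtP (t * (sg * dv x)) 0.
  - apply: (escape Dv cdv r'0 d0 e0 tt _ _ hK dx hd) => y hy; have [h1 h2 h3 h4] := right y hy; last exact: ham.
    by split; [apply: mlip => //; case/andP: hy|exact: vp].
  - have D' (y : R) : is_derive y 1 (fun y => sg * v (- y)) (- (sg * dv (- y))).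
      exact: (is_derive_reflect (Dv (- y))).
    have cdv' : continuous (fun y => - (sg * dv (- y))).
      by move=> y; apply: cts_opp; exact: (@cts_reflect _ (fun y => sg * dv y) y (cdv (- y))).
    have dx' : t * - (sg * dv (- - x)) < 0 by rewrite opprK mulrN oppr_lt0.
    have hd' : d <= t * (mu (- - x) - (sg * v (- - x)) ^+ 2) by rewrite opprK.
    apply: (@escape _ _ _ (fun y => mu (- y)) (- x) r' d eps K t D' cdv' r'0 d0 e0 tt _ _ hK dx' hd') => y hy; have [h1 h2 h3 h4] := left y hy; last by rewrite sqrrN; exact: ham.
    split; last exact: vp.
    by rewrite opprK distrC; apply: mlip => //; rewrite lerNl; case/andP: hy.
  - have sd : sg * dv x = 0.
      have : t * (t * (sg * dv x)) = 0 by rewrite dx mulr0.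
      by rewrite mulrA -expr2 tt mul1r.
    have := ham x xpq'; rewrite sd expr0n mulr0 mul0r.
    have : d ^+ 2 <= (mu x - (sg * v x) ^+ 2) ^+ 2.
      have tX (X : R) : X ^+ 2 = (t * X) ^+ 2 by rewrite exprMn tt mul1r.
      rewrite (tX (mu x - _)).
      by rewrite lerXn2r ?nnegrE //; [exact: ltW|exact: le_trans (ltW d0) hd].
    by have := exprn_gt0 2 d0; clear - a00 std; lra.
have close : `|mu x - (sg * v x) ^+ 2| <= d.
  rewrite ler_norml; apply/andP; split; rewrite leNgt; apply/negP => h.
    by apply: (main (-1)); rewrite ?sqrrN ?expr1n //; move: h; clear - a00 std; lra.
  by apply: (main 1); rewrite ?expr1n //; move: h; clear - a00 std; lra.
have [mx rx _ _] := Hb x (pc x xpq'); have rp := rho_gt0 mx.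
split.
  have /andP[v0 _] := vp x xpq'.
  rewrite -(ler_pM2r ra0); apply: le_trans (le_trans close d1).
  rewrite -(rho_sqr (ltW mx)) subr_sqr normrM distrC ler_wpM2l //.
  by rewrite ger0_norm; move: rx v0 rp; clear - a00 std; lra.
apply: le_trans (_ : 2 * d <= th); last by move: d2; clear - a00 std; lra.
rewrite -(@ler_pXn2r _ 2) ?nnegrE ?mulr_ge0 ?(ltW d0) // real_normK ?num_real // !exprMn.
have := ham' x xpq'.
have : (mu x - v x ^+ 2) ^+ 2 <= d ^+ 2.
  rewrite -(real_normK (num_real (mu x - _))) lerXn2r ?nnegrE ?(ltW d0) //.
  by move: close; rewrite exprMn ss mul1r.
have := exprn_gt0 2 d0; clear - a00 std; lra.
Qed.

(** In the variable s, v solves the kink equation up to a small term [e] that collects the variation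
    of mu and the forcing; the Hamiltonian supplies the initial slope. *)
Lemma evt_kink_right l sg L th : `|l| < xi -> sg ^+ 2 = 1 -> 0 <= L -> 0 < th ->
  exists2 d : R, 0 < d & evt (fun eps _ v dv => forall z, `|z - l| <= d -> v z = 0 -> 0 <= sg * dv z ->
    forall s, 0 <= s <= L -> `|v (z + s * eps) - kink_profile sg (mu l) s| <= th /\
      `|eps * dv (z + s * eps) - kink_slope sg (mu l) s| <= th).
Proof.
move=> lx ss L0 th0; have sn := sign_norm ss; pose m := mu l.
have m0 : 0 < m by exact: (pr_mu pr).
pose c := (`|l| + xi) / 2.
have [lc cx c0] : [/\ `|l| < c, c < xi & 0 < c] by rewrite /c; have := normr_ge0 l; split; lra.
have [K0 K00 eK] := evt_bound pr a00 c.
pose K := K0 + Num.sqrt m.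
have [K1 K2] : K0 <= K /\ Num.sqrt m <= K by rewrite /K; have := sqrtr_ge0 m; split; lra.
have Kp : 0 < K := lt_le_trans K00 K1.
have [B B0 hB] := continuous_bounded (- c) c cf.
pose E := expR ((2 + 3 * K ^+ 2 + m) * L).
have Ep : 0 < E := expR_gt0 _.
(* Gronwall multiplies errors by E, so T is the available budget: half for the data at z, half for
   [e] through q^2 L. *)
pose T := th ^+ 2 / E.
have T0 : 0 < T by rewrite divr_gt0 // exprn_gt0.
pose q := Num.min 1 (T / (2 * (L + 1))).
have L1 : 0 < L + 1 by lra.
have q0 : 0 < q by rewrite lt_min ltr01 divr_gt0 // mulr_gt0.
have [q1 q2] : q <= 1 /\ q * (2 * (L + 1)) <= T by rewrite -ler_pdivlMr ?mulr_gt0 // !ge_min !lexx orbT.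
pose e' := Num.min 1 (Num.min (q / (2 * K)) (T / (4 * (m + 1)))).
have m1 : 0 < m + 1 by lra.
have e'0 : 0 < e' by rewrite !lt_min ltr01 !divr_gt0 // mulr_gt0.
have [e'1 e'2 e'3] : [/\ e' <= 1, e' * (2 * K) <= q & e' * (4 * (m + 1)) <= T].
  by rewrite -!ler_pdivlMr ?mulr_gt0 // !ge_min !lexx !orbT.
have [d1 d10 near] := continuous_near (@pot_cmu _ _ _ std l) e'0.
pose d := Num.min (d1 / 2) (c - `|l|) / 2.
have [dd1 dd2 d0] : [/\ 2 * d <= d1 / 2, 2 * d <= c - `|l| & 0 < d].
  by rewrite /d mulrC divfK // divr_gt0 ?lt_min ?subr_gt0 ?lc ?divr_gt0 // !ge_min !lexx !orbT.
exists d => //.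
have h0 : 0 < T / 8 by rewrite divr_gt0.
have u1 : 0 < d / (L + 1) by rewrite divr_gt0.
have u2 : 0 < q / (2 * (2 * a0 * B)) by rewrite divr_gt0 // !mulr_gt0.
apply: evt_mp (evt_hamil pr a00 c0 cx h0) (evt_mp eK (evt_mp (evt_small mu f a0 u1) (evt_mp (evt_small mu f a0 u2) (evt_mp (evt_alpha mu f a00) (evt_all _ _))))).
move=> eps alpha v dv lm e0 /andP[al1 al2] [he _] [hd _] vK hH z zd vz dz.
have al0 : 0 <= alpha by apply: le_trans al1; rewrite divr_ge0 // ltW.
have heL : eps * (L + 1) <= d by rewrite -ler_pdivlMr.
have xin s : 0 <= s <= L -> `|z + s * eps - l| <= 2 * d.
  move=> /andP[s0 sL]; rewrite addrAC; apply: le_trans (ler_normD _ _) _.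
  have se : `|s * eps| <= d.
    rewrite ger0_norm ?mulr_ge0 ?(ltW e0) // mulrC; apply: le_trans heL.
    by rewrite ler_wpM2l ?(ltW e0) //; move: sL; clear - a00 std; lra.
  by move: zd se; clear - a00 std; lra.
have inc x : `|x - l| <= 2 * d -> `|x| <= c.
  move=> hx; have -> : x = (x - l) + l by rewrite subrK.
  by apply: le_trans (ler_normD _ _) _; move: hx dd2; clear - a00 std; lra.
have mun x : `|x - l| <= 2 * d -> `|mu x - m| <= e'.
  by move=> hx; apply/ltW/near; apply: le_lt_trans hx _; move: dd1 d10; clear - a00 std; lra.
pose w s := v (z + s * eps); pose dw s := eps * dv (z + s * eps).
pose e s := - (mu (z + s * eps) - m) * w s - eps * alpha * f (z + s * eps).
have Da (s : R) : is_derive s 1 (fun s : R => z + s * eps) eps.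
  have := is_derive_add (is_derive_cst1 z s) (is_derive_mul (is_derive_id1 s) (is_derive_cst1 eps s)).
  by move=> H; apply: is_derive_eq H _; ring.
have D1 (s : R) : is_derive s 1 w (dw s).
  have := @is_derive_comp1 _ v (fun s => z + s * eps) s _ _ (lm_d lm _) (Da s).
  by move=> H; apply: is_derive_eq H _; rewrite /dw mulrC.
have D2 (s : R) : is_derive s 1 dw (w s ^+ 3 - m * w s + e s).
  have := is_derive_mul (is_derive_cst1 eps s) (@is_derive_comp1 _ dv (fun s => z + s * eps) s _ _ (lm_dd lm _) (Da s)).
  by move=> H; apply: is_derive_eq H _; rewrite /e /w; field; rewrite gt_eqF.
have close := @ode_close R w dw (kink_profile sg m) (kink_slope sg m) e m K q L (ltW m0) L0 (ltW q0) D1 D2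
  (is_derive_kink sg m) (fun s => is_derive_kink_slope s ss (ltW m0)).
have hyp s : 0 <= s <= L -> [/\ `|w s| <= K, `|kink_profile sg m s| <= K & `|e s| <= q].
  move=> hs; have hx := xin s hs; have wK : `|w s| <= K by apply: le_trans (vK _ (inc _ hx)) K1.
  split=> //; first exact: le_trans (kink_bound _ _ sn) K2.
  apply: le_trans (ler_normB _ _) _; rewrite normrM normrN.
  have b1 : `|mu (z + s * eps) - m| * `|w s| <= e' * K by apply: ler_pM => //; exact: mun.
  have b2 : `|eps * alpha * f (z + s * eps)| <= eps * (2 * a0 * B).
    rewrite !normrM (gtr0_norm e0) (ger0_norm al0) -mulrA ler_pM2l //; apply: ler_pM => //.
    by apply: hB; rewrite -ler_norml; exact: inc.
  have b3 : eps * (2 * (2 * a0 * B)) <= q by rewrite -ler_pdivlMr // !mulr_gt0.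
  by move: b1 b2 b3 e'2; clear - a00 std; lra.
have zl : `|z - l| <= 2 * d by move: zd d0; clear - a00 std; lra.
(* Since v z = 0, (eps v')^2 equals mu^2 / 2 + 2 H at z. The sign hypothesis selects the root,
   through (a - b)^2 <= |a^2 - b^2| for nonnegative a and b. *)
have N0 : (w 0 - kink_profile sg m 0) ^+ 2 + (dw 0 - kink_slope sg m 0) ^+ 2 <= T / 2.
  rewrite kink_profile0 (kink_slope0 _ (ltW m0)) /w /dw mul0r addr0 vz subrr expr0n add0r.
  pose a := eps * (sg * dv z); pose b := m / Num.sqrt 2.
  have a_ge0 : 0 <= a by rewrite mulr_ge0 // ltW.
  have b_ge0 : 0 <= b by rewrite divr_ge0 ?sqrtr_ge0 // ltW.
  have -> : (eps * dv z - sg * (m / Num.sqrt 2)) ^+ 2 = (a - b) ^+ 2.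
    rewrite -[LHS]mul1r -[X in X * _]ss -exprMn; congr (_ ^+ 2).
    have sb : sg * (sg * b) = b by rewrite mulrA -expr2 ss mul1r.
    by rewrite mulrBr -/b sb /a; ring.
  have s1 : (a - b) ^+ 2 <= `|a ^+ 2 - b ^+ 2|.
    rewrite subr_sqr normrM -(real_normK (num_real (a - b))) expr2 ler_wpM2l //.
    by rewrite [X in _ <= X]ger0_norm ?addr_ge0 // ler_norml; move: a_ge0 b_ge0; clear - a00 std; lra.
  apply: le_trans s1 _.
  have aE : a ^+ 2 = 2 * hamil mu eps v dv z + mu z ^+ 2 / 2.
    by rewrite /a /hamil vz !exprMn ss mul1r expr0n subr0; field.
  have bE : b ^+ 2 = m ^+ 2 / 2 by rewrite /b expr_div_n sqr_sqrtr.
  rewrite aE bE -addrA; apply: le_trans (ler_normD _ _) _.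
  have b1 : `|2 * hamil mu eps v dv z| <= T / 4.
    by rewrite normrM (ger0_norm (ler0n _ 2)); have := hH z (inc z zl); clear - a00 std; lra.
  have b2 : `|mu z ^+ 2 / 2 - m ^+ 2 / 2| <= T / 4.
    rewrite -mulrBl subr_sqr !normrM normfV (ger0_norm (ler0n _ 2)).
    have mz := mun z zl.
    have : `|mu z - m| * `|mu z + m| <= e' * (2 * (m + 1)).
      apply: ler_pM => //; move: mz; rewrite !ler_norml; move: e'1 m0; clear - a00 std => h1 h2 /andP[h3 h4]; lra.
    by move: e'3; clear - a00 std; lra.
  by move: b1 b2; clear - a00 std; lra.
have fin s : 0 <= s <= L -> (w s - kink_profile sg m s) ^+ 2 + (dw s - kink_slope sg m s) ^+ 2 <= th ^+ 2.
  move=> hs; apply: le_trans (close hyp s hs) _; rewrite -/E.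
  rewrite -ler_pdivlMr // -/T.
  have : q ^+ 2 * L <= q * L by rewrite ler_wpM2r // expr2 ler_piMl // ltW.
  by move: N0 q2 q0; clear - a00 std; lra.
move=> s hs; have := fin s hs; rewrite -/(w s) -/(dw s) -/m => h.
have n1 := sqr_ge0 (w s - kink_profile sg m s); have n2 := sqr_ge0 (dw s - kink_slope sg m s).
split; rewrite -(@ler_pXn2r _ 2) ?nnegrE ?(ltW th0) // real_normK ?num_real //; move: h n1 n2; clear - a00 std; lra.
Qed.

(** [hat] sends the zero z to -z with the same slope, so negative s reduces to the preceding lemma
    at -l. *)
Lemma evt_kink l sg L th : `|l| < xi -> sg ^+ 2 = 1 -> 0 <= L -> 0 < th ->
  exists2 d : R, 0 < d & evt (fun eps _ v dv => forall z, `|z - l| <= d -> v z = 0 -> 0 <= sg * dv z ->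
    forall s, `|s| <= L -> `|v (z + s * eps) - kink_profile sg (mu l) s| <= th /\
      `|eps * dv (z + s * eps) - kink_slope sg (mu l) s| <= th).
Proof.
move=> lx ss L0 th0.
have [d1 d10 E1] := evt_kink_right lx ss L0 th0.
have [|d2 d20 E2] := @evt_kink_right (- l) sg L th _ ss L0 th0; first by rewrite normrN.
exists (Num.min d1 d2); first by rewrite lt_min d10.
apply: evt_mp E1 (evt_mp (evt_hat pr E2) (evt_all _ _)) => eps alpha v dv lm e0 h2 h1 z.
rewrite le_min => /andP[z1 z2] vz dz s; rewrite ler_norml => /andP[s1 s2].
have [s0|s0] := leP 0 s; first by apply: h1 => //; rewrite s0.
have [||||g1 g2] := h2 (- z) _ _ _ (- s).
- by rewrite -opprD normrN.
- by rewrite /hat opprK vz oppr0.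
- by rewrite opprK.
- by move: s0 s1; clear - a00 std; lra.
have zs : - (- z + - s * eps) = z + s * eps by ring.
move: g1 g2; rewrite /hat zs (pot_even std) kink_profileN kink_slopeN => g1 g2.
by split=> //; move: g1; rewrite -opprD normrN.
Qed.

End BlowUp.

(** * Convergence *)

Section CompactConvergence.
Context {R : realType} {T : Type} (F : set_system T) {FF : Filter F}.
Implicit Types (h : T -> R -> R) (g dg : R -> R) (L th : R).

Lemma compact_family_cvg h g :
  (forall L th, 0 < L -> 0 < th -> \forall t \near F, forall s, `|s| <= L -> `|h t s - g s| <= th) ->
  {family compact, h @ F --> g}.
Proof.
move=> H; apply/fam_cvgP => K cK U; rewrite uniform_nbhs => -[E [eE EU]].
have [B [Br hB]] := compact_bounded cK.
pose L := Num.max B 0 + 1.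
have L0 : 0 < L by rewrite ltr_wpDl // le_max lexx orbT.
have KL s : K s -> `|s| <= L.
  by move=> Ks; apply: (hB L) => //; rewrite /L ltr_pwDr // le_max lexx.
move: eE; rewrite -entourage_ballE => -[e /= e0 eE].
have : \forall t \near F, forall s, `|s| <= L -> `|h t s - g s| <= e / 2.
  by apply: H => //; rewrite divr_gt0.
apply: filterS => t ht; apply: EU => y Ky; apply: eE => /=.
rewrite -ball_normE /= distrC; apply: le_lt_trans (ht y (KL y Ky)) _.
by rewrite ltr_pdivrMr // ltr_pMr // ltr1n.
Qed.

Lemma cvg_C1loc_intro h g dg : (forall s : R, is_derive s 1 g (dg s)) -> continuous dg ->
  (\forall t \near F, is_C1 (h t)) ->
  (forall L th, 0 < L -> 0 < th -> \forall t \near F, forall s, `|s| <= L ->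
     `|h t s - g s| <= th /\ `|derive1 (h t) s - dg s| <= th) -> cvg_C1loc F h g.
Proof.
move=> Dg cdg C1 H; have dgE := is_derive_derive1 Dg.
split=> //; first by split=> [x|]; [case: (Dg x)|rewrite dgE].
- by apply: compact_family_cvg => L th L0 th0; apply: filterS (H L th L0 th0) => t ht s /ht[].
- rewrite dgE; apply: compact_family_cvg => L th L0 th0.
  by apply: filterS (H L th L0 th0) => t ht s /ht[].
Qed.

End CompactConvergence.

Section Patterns.
Context {R : realType}.
Implicit Types (v : R -> R) (x y zeta : R).

Lemma one_zeroP v y x : one_zero v y -> v x = 0 <-> x = y.
Proof.
move=> [vy neg pos]; split=> [vx|->//].
by have [/neg|/pos|//] := ltgtP x y; rewrite vx ltxx.
Qed.

Lemma three_zerosP zeta v y1 y2 y3 x : three_zeros zeta v y1 y2 y3 ->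
  v x = 0 <-> [\/ x = y1, x = y2 | x = y3].
Proof.
move=> [[y12 y23 _] [v1 v2 v3] [n1 p1] [n2 p2]]; split=> [vx|[]->//].
have [/n1|h1|->] := ltgtP x y1; [by rewrite vx ltxx| |by constructor 1].
have [h2|h2|->] := ltgtP x y2; [| |by constructor 2].
  by have := p1 x; rewrite h1 h2 vx ltxx => /(_ isT).
have [h3|/p2|->] := ltgtP x y3; [|by rewrite vx ltxx|by constructor 3].
by have := n2 x; rewrite h2 h3 vx ltxx => /(_ isT).
Qed.

Lemma three_zeros_unique zeta v x1 x2 x3 y1 y2 y3 :
  three_zeros zeta v x1 x2 x3 -> three_zeros zeta v y1 y2 y3 -> [/\ x1 = y1, x2 = y2 & x3 = y3].
Proof.
move=> tx ty; have [[a1 a2 _] [v1 v2 v3] _ _] := tx; have [[b1 b2 _] _ _ _] := ty.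
have {}v1 := (three_zerosP x1 ty).1 v1; have {}v2 := (three_zerosP x2 ty).1 v2.
have {}v3 := (three_zerosP x3 ty).1 v3.
by move: v1 v2 v3 => [] E1 [] E2 [] E3; subst; split=> //; exfalso; lra.
Qed.

Lemma slope_ge0 v dv y z : is_derive y 1 v dv -> v y = 0 -> y < z ->
  (forall x, y < x < z -> 0 < v x) -> 0 <= dv.
Proof.
move=> D vy yz pos; rewrite leNgt; apply/negP => dn.
have dn' : 0 < - dv by rewrite oppr_gt0.
have [d d0 hd] := derive_pos_near (is_derive_opp D) dn'.
pose t := y + Num.min (d / 2) ((z - y) / 2).
have m0 : 0 < Num.min (d / 2) ((z - y) / 2) by rewrite lt_min !divr_gt0 // subr_gt0.
have m1 : Num.min (d / 2) ((z - y) / 2) <= d / 2 by rewrite ge_min lexx.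
have m2 : Num.min (d / 2) ((z - y) / 2) <= (z - y) / 2 by rewrite ge_min lexx orbT.
have [|h _] := hd t; first by rewrite /t addrAC subrr add0r gtr0_norm //; lra.
by have := h ltac:(rewrite /t; lra); have := pos t ltac:(rewrite /t; lra); rewrite vy; lra.
Qed.

End Patterns.

(** * From uniform estimates to the stated limits *)

Section Assembly.
Context {R : realType} (mu f : R -> R) (zeta xi : R).
Hypothesis pr : profile mu f zeta xi.
Let std := pr_pot pr.
Variable V : R -> R -> R -> R.
Hypothesis lmV : forall eps alpha, 0 < eps -> 0 < alpha ->
  local_minimizer mu f eps alpha (V eps alpha) (derive1 (V eps alpha)) /\ 0 <= V eps alpha 0.
Variable a0 : R.
Hypothesis a00 : 0 < a0.
Local Notation evt := (evt mu f a0).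
Implicit Types (l c d r sg th : R).

Global Instance regime_filter : Filter (regime a0).
Proof. exact: filter_prod_filter. Qed.

(** The condition 0 <= v 0 is the normalisation that chooses between v and its reflection. *)
Definition evt0 (Q : R -> R -> (R -> R) -> (R -> R) -> Prop) : Prop :=
  evt (fun eps alpha v dv => 0 <= v 0 -> Q eps alpha v dv).

Lemma regime_evt0 Q : evt0 Q ->
  \forall p \near regime a0, 0 < p.1 /\ local_minimizer mu f p.1 p.2 (V p.1 p.2) (derive1 (V p.1 p.2)) /\
    Q p.1 p.2 (V p.1 p.2) (derive1 (V p.1 p.2)).
Proof.
move=> [e e0 H].
(* The bound a0 / 2 keeps alpha positive, where local minimality is known. *)
pose e' := Num.min e (a0 / 2).
have e'0 : 0 < e' by rewrite lt_min e0 divr_gt0.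
exists ([set t | 0 < t <= e], [set a | `|a0 - a| < e']).
  split=> /=.
    apply: filterS2 (nbhs_right_gt 0) (nbhs_right_le e0) => t h1 h2 /=.
    by rewrite h1.
  by apply/nbhs_normP; exists e'.
move=> [t a] /= [/andP[t0 te]]; rewrite distrC => ae.
have h1 : `|a - a0| <= e by apply/ltW/(lt_le_trans ae); rewrite ge_min lexx.
have h2 : `|a - a0| <= a0 / 2 by apply/ltW/(lt_le_trans ae); rewrite ge_min lexx orbT.
have a_gt0 : 0 < a by move: h2; rewrite ler_norml; move: a00 => a00'; lra.
have [lm v0] := lmV t0 a_gt0.
by split=> //; split=> //; exact: H.
Qed.

Lemma evt0_mp Q Q' : evt0 Q -> evt0 (fun eps alpha v dv => Q eps alpha v dv -> Q' eps alpha v dv) -> evt0 Q'.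
Proof.
move=> h1 h2; apply: evt_mp h1 (evt_mp h2 (evt_all _ _)) => eps alpha v dv _ _ H2 H1 v0.
by apply: H2 => //; exact: H1.
Qed.

Lemma evt0_evt Q : evt Q -> evt0 Q.
Proof. by move=> h; apply: evt_mp h (evt_all _ _). Qed.

Lemma evt0_pt Q : (forall eps alpha v dv, local_minimizer mu f eps alpha v dv -> 0 < eps -> 0 <= v 0 -> Q eps alpha v dv) -> evt0 Q.
Proof. by move=> h; apply: evt_all. Qed.

Lemma cvg_evt0 (y : R -> R -> R) l :
  (forall d, 0 < d -> \forall p \near regime a0, `|y p.1 p.2 - l| <= d) <->
  y p.1 p.2 @[p --> regime a0] --> l.
Proof.
split=> [H|/cvgrPdist_le H d d0].
  by apply/cvgrPdist_le => d d0; apply: filterS (H d d0) => p; rewrite distrC.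
by apply: filterS (H d d0) => p; rewrite distrC.
Qed.

Lemma rescaled_cvg (y : R -> R -> R) g dg : (forall s : R, is_derive s 1 g (dg s)) -> continuous dg ->
  (forall L th, 0 < L -> 0 < th -> \forall p \near regime a0, forall s, `|s| <= L ->
     `|V p.1 p.2 (y p.1 p.2 + s * p.1) - g s| <= th /\
     `|p.1 * derive1 (V p.1 p.2) (y p.1 p.2 + s * p.1) - dg s| <= th) ->
  cvg_C1loc (regime a0) (fun p => rescale p.1 (y p.1 p.2) (V p.1 p.2)) g.
Proof.
move=> Dg cdg H.
have triv : evt0 (fun _ _ _ _ => True) by apply: evt0_pt.
have D eps alpha z (s : R) : local_minimizer mu f eps alpha (V eps alpha) (derive1 (V eps alpha)) ->
    is_derive s 1 (rescale eps z (V eps alpha)) (eps * derive1 (V eps alpha) (z + s * eps)).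
  move=> lm; have Da : is_derive s 1 (fun s : R => z + s * eps) eps.
    have := is_derive_add (is_derive_cst1 z s) (is_derive_mul (is_derive_id1 s) (is_derive_cst1 eps s)).
    by move=> H'; apply: is_derive_eq H' _; ring.
  have := @is_derive_comp1 _ (V eps alpha) (fun s => z + s * eps) s _ _ (lm_d lm _) Da.
  by move=> H'; apply: is_derive_eq H' _; rewrite mulrC.
apply: (cvg_C1loc_intro Dg cdg).
  apply: filterS (regime_evt0 triv) => p [_ [lm _]].
  split=> [s|]; first by case: (D p.1 p.2 (y p.1 p.2) s lm).
  rewrite (is_derive_derive1 (fun s => D p.1 p.2 (y p.1 p.2) s lm)) => s.
  apply: cts_mul; first exact: cts_cst.
  apply: (@cts_comp _ (derive1 (V p.1 p.2))); last exact: lm_cdv lm _.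
  by apply: cts_add; [exact: cts_cst|apply: cts_mul; [exact: cts_id|exact: cts_cst]].
move=> L th L0 th0; apply: filterS2 (regime_evt0 triv) (H L th L0 th0) => p [_ [lm _]] hp s sL.
by rewrite (is_derive_derive1 (fun s => D p.1 p.2 (y p.1 p.2) s lm)); exact: hp.
Qed.

(** Uniform around x0, so that the centre of the blow-up may move with (eps, alpha); this serves for
    the zero tending to -xi. *)
Definition flat (x0 : R) c : Prop := forall th, 0 < th -> exists2 d : R, 0 < d &
  evt0 (fun eps _ v dv => forall x, `|x - x0| <= d -> `|v x - c| <= th /\ `|eps * dv x| <= th).

Lemma flat_cvg (y : R -> R -> R) x0 c : flat x0 c -> y p.1 p.2 @[p --> regime a0] --> x0 ->
  cvg_C1loc (regime a0) (fun p => rescale p.1 (y p.1 p.2) (V p.1 p.2)) (cst c).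
Proof.
move=> fl /cvg_evt0 yx; apply: (@rescaled_cvg y (cst c) (cst 0) (fun s => is_derive_cst1 c s)) => [|L th L0 th0].
- by move=> s; exact: cts_cst.
have [d d0 H] := fl th th0.
have d20 : 0 < d / 2 by rewrite divr_gt0.
have q0 : 0 < d / 2 / L by rewrite divr_gt0.
have small := evt0_evt (evt_small mu f a0 q0).
apply: filterS3 (regime_evt0 H) (regime_evt0 small) (yx (d / 2) d20) => p [e0 [_ h]] [_ [_ [he _]]] hy s sL.
have [|h1 h2] := h (y p.1 p.2 + s * p.1); last by rewrite subr0.
rewrite addrAC; apply: le_trans (ler_normD _ _) _.
have : `|s * p.1| <= d / 2.
  rewrite normrM (gtr0_norm e0); apply: (@le_trans _ _ (L * (d / 2 / L))); first by apply: ler_pM => //; exact: ltW.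
  by rewrite mulrC divfK // gt_eqF.
by move: hy; lra.
Qed.

Lemma flat_blowup x0 c : flat x0 c -> blowup_limit a0 V x0 c.
Proof. by move=> h; apply: (flat_cvg (y := fun _ _ => x0) h); exact: cvg_cst. Qed.

Lemma flat_outside x0 : mu x0 <= 0 -> flat x0 0.
Proof.
move=> m0 th th0; have [d d0 H] := evt_vanish pr a00 th0 m0; exists d => //.
apply: evt_mp H (evt_all _ _) => eps alpha v dv _ _ h _ x xd.
by rewrite subr0; exact: h.
Qed.

Lemma flat_inside x0 r sg : `|x0| < xi -> 0 < r -> sg ^+ 2 = 1 ->
  evt0 (fun _ _ v _ => forall x, `|x - x0| <= r -> 0 <= sg * v x) -> flat x0 (sg * Num.sqrt (mu x0)).
Proof.
move=> xx r0 ss H th th0; have sn := sign_norm ss.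
pose r' := Num.min r ((xi - `|x0|) / 2).
have r'0 : 0 < r' by rewrite lt_min r0 divr_gt0 // subr_gt0.
have [r1 r2] : r' <= r /\ r' <= (xi - `|x0|) / 2 by rewrite !ge_min !lexx orbT.
have x1 := ler_norm x0; have x2 := ler_norm (- x0); rewrite normrN in x2.
have px : - xi < x0 - r' by lra.
have qx : x0 + r' < xi by lra.
have t20 : 0 < th / 2 by rewrite divr_gt0.
have r20 : 0 < r' / 2 by rewrite divr_gt0.
have E := evt_flat pr a00 px qx r20 t20 ss.
have [d1 d10 near] := continuous_near (@continuous_rho _ _ _ std x0) t20.
exists (Num.min (r' / 2) (d1 / 2)); first by rewrite lt_min r20 divr_gt0.
apply: evt0_mp H (evt0_mp (evt0_evt E) (evt0_pt _)) => eps alpha v dv lm e0 _ h1 h2 x.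
rewrite le_min => /andP[]; rewrite ler_norml => xr xd.
have [||g1 g2] := h1 _ x.
- by move=> y hy; apply: h2; rewrite ler_norml; lra.
- by lra.
split; last by apply: le_trans g2 _; lra.
have : `|rho mu x - rho mu x0| <= th / 2 by apply/ltW/near; apply: le_lt_trans xd _; lra.
have -> : v x - sg * Num.sqrt (mu x0) = sg * (sg * v x - rho mu x0).
  by rewrite mulrBr mulrA -expr2 ss mul1r.
rewrite normrM sn mul1r; have -> : sg * v x - rho mu x0 = (sg * v x - rho mu x) + (rho mu x - rho mu x0) by ring.
by move=> h; apply: le_trans (ler_normD _ _) _; lra.
Qed.

Lemma kink_cvg (y : R -> R -> R) l sg : `|l| < xi -> sg ^+ 2 = 1 -> y p.1 p.2 @[p --> regime a0] --> l ->
  (\forall p \near regime a0, V p.1 p.2 (y p.1 p.2) = 0 /\ 0 <= sg * derive1 (V p.1 p.2) (y p.1 p.2)) ->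
  cvg_C1loc (regime a0) (fun p => rescale p.1 (y p.1 p.2) (V p.1 p.2)) (kink_profile sg (mu l)).
Proof.
move=> lx ss /cvg_evt0 yl hz.
apply: (@rescaled_cvg y _ (kink_slope sg (mu l))) => [s||L th L0 th0].
- exact: is_derive_kink.
- by move=> s; exact: is_derive_cvg (is_derive_kink_slope s ss (ltW (pr_mu pr lx))).
have [d d0 H] := evt_kink pr a00 lx ss (ltW L0) th0.
apply: filterS3 (regime_evt0 (evt0_evt H)) hz (yl d d0) => p [_ [_ h]] [vz dz] hy s sL.
exact: h.
Qed.


Notation s2 := (Num.sqrt (2 : R)).
Let z0 : 0 < zeta. Proof. exact: pr_z0 pr. Qed.
Let zx : zeta < xi. Proof. exact: pr_zx pr. Qed.

(** The default 0 is taken only when v is not of the one-zero pattern, hence never close to the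
    limit in cases (i) and (ii). *)
Definition chosen_zero (eps alpha : R) : R := xget 0 [set y | one_zero (V eps alpha) y].

Lemma chosen_zeroP eps alpha y : one_zero (V eps alpha) y -> chosen_zero eps alpha = y.
Proof.
move=> oz; have := xgetPex 0 (ex_intro (fun y => [set y | one_zero (V eps alpha) y] y) y oz) => /= ozx.
by have [vx _ _] := ozx; apply: (one_zeroP _ oz).1.
Qed.

Definition chosen_zeros (eps alpha : R) : R * R * R :=
  xget (0, 0, 0) [set y | three_zeros zeta (V eps alpha) y.1.1 y.1.2 y.2].

Lemma chosen_zerosP eps alpha y1 y2 y3 : three_zeros zeta (V eps alpha) y1 y2 y3 ->
  [/\ (chosen_zeros eps alpha).1.1 = y1, (chosen_zeros eps alpha).1.2 = y2 & (chosen_zeros eps alpha).2 = y3].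
Proof.
move=> tz; have := xgetPex (0, 0, 0) (ex_intro (fun y => [set y | three_zeros zeta (V eps alpha) y.1.1 y.1.2 y.2] y) (y1, y2, y3) tz) => /= tzx.
exact: three_zeros_unique tzx tz.
Qed.

Lemma kinkE i l : kink mu i l = kink_profile ((-1) ^+ i.+1) (mu l).
Proof. by []. Qed.

Section OneZero.
Variable (l : R).
Hypothesis located : forall d, 0 < d -> evt0 (fun _ _ v _ => exists2 y : R, one_zero v y & `|y - l| <= d).

Lemma chosen_zero_cvg : chosen_zero p.1 p.2 @[p --> regime a0] --> l.
Proof.
apply/cvg_evt0 => d d0; apply: filterS (regime_evt0 (located d0)) => p [_ [_ [y oz hy]]].
by rewrite (chosen_zeroP oz).
Qed.

Lemma chosen_zero_unique :
  \forall p \near regime a0, forall x, V p.1 p.2 x = 0 <-> x = chosen_zero p.1 p.2.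
Proof.
apply: filterS (regime_evt0 (located ltr01)) => p [_ [_ [y oz hy]]] x.
by rewrite (chosen_zeroP oz); exact: one_zeroP.
Qed.

Lemma chosen_zero_kink : `|l| < xi -> zero_limit mu a0 V 1 chosen_zero l.
Proof.
move=> lx; split; first exact: chosen_zero_cvg.
have ss : ((-1) ^+ 2) ^+ 2 = 1 :> R by rewrite sqrrN expr1n expr1n.
rewrite kinkE; apply: (@kink_cvg chosen_zero _ _ lx ss chosen_zero_cvg).
apply: filterS (regime_evt0 (located ltr01)) => p [_ [lm [y oz hy]]].
rewrite (chosen_zeroP oz) sqrrN expr1n mul1r; have [vy _ pos] := oz; split=> //.
have yy : y < y + 1 by lra.
by apply: (slope_ge0 (lm_d lm y) vy yy) => x /andP[/pos].
Qed.

Lemma right_flat x0 : `|x0| < xi -> l < x0 -> flat x0 (Num.sqrt (mu x0)).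
Proof.
move=> xx lx; rewrite -[Num.sqrt _]mul1r.
have d0 : 0 < (x0 - l) / 3 by rewrite divr_gt0 // subr_gt0.
apply: (flat_inside xx d0 (expr1n _ 2)); apply: evt0_mp (located d0) (evt0_pt _).
move=> eps alpha v dv lm e0 _ [y [_ _ pos] hy] x hx; rewrite mul1r; apply/ltW/pos.
by move: hy hx; rewrite !ler_norml; lra.
Qed.

Lemma left_flat x0 : `|x0| < xi -> x0 < l -> flat x0 (- Num.sqrt (mu x0)).
Proof.
move=> xx lx; rewrite -mulN1r.
have d0 : 0 < (l - x0) / 3 by rewrite divr_gt0 // subr_gt0.
have ss : (-1) ^+ 2 = 1 :> R by rewrite sqrrN expr1n.
apply: (flat_inside xx d0 ss); apply: evt0_mp (located d0) (evt0_pt _).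
move=> eps alpha v dv lm e0 _ [y [_ neg _] hy] x hx; rewrite mulN1r oppr_ge0; apply/ltW/neg.
by move: hy hx; rewrite !ler_norml; lra.
Qed.

End OneZero.

Lemma mu_outside x0 : xi <= `|x0| -> mu x0 <= 0.
Proof.
rewrite (mu_abs pr) le_eqVlt => /predU1P[<-|h]; first by rewrite (pr_xi pr).
by apply: ltW; rewrite -(pr_xi pr); apply: (mu_decr pr) h; exact: ltW.
Qed.

Lemma blowup_outside x0 : xi <= `|x0| -> blowup_limit a0 V x0 0.
Proof. by move=> h; apply/flat_blowup/flat_outside/mu_outside. Qed.

(* v 0 >= 0 selects, among the two symmetric positions, the one on the left. *)
Lemma located_left c : 0 < c ->
  (forall d, 0 < d -> evt (fun _ _ v _ => exists2 y : R, one_zero v y & `|y + c| <= d \/ `|y - c| <= d)) ->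
  forall d, 0 < d -> evt0 (fun _ _ v _ => exists2 y : R, one_zero v y & `|y - - c| <= d).
Proof.
(* The margin c / 2 keeps a zero near c positive; then v 0 < 0, against the normalisation. *)
move=> c0 H d d0; have m0 : 0 < Num.min d (c / 2) by rewrite lt_min d0 divr_gt0.
apply: evt_mp (H _ m0) (evt_all _ _) => eps alpha v dv lm e0 [y oz hy] v00.
exists y => //; rewrite opprK; case: hy; rewrite le_min => /andP[h1 h2] //.
have [_ neg _] := oz; have := neg 0 ltac:(by move: h2; rewrite ler_norml; lra).
by lra.
Qed.

Lemma subcritical : a0 < s2 ->
  (exists x1 : R -> R -> R,
     (\forall p \near regime a0, forall x, V p.1 p.2 x = 0 <-> x = x1 p.1 p.2) /\
     zero_limit mu a0 V 1 x1 (- xi)) /\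
  (forall x0, `|x0| < xi -> blowup_limit a0 V x0 (Num.sqrt (mu x0))) /\
  (forall x0, xi <= `|x0| -> blowup_limit a0 V x0 0).
Proof.
move=> as2; have x0 : 0 < xi := lt_trans z0 zx.
have loc := located_left x0 (fun d => locate_subcritical pr a00 as2 (d := d)).
split; last split; last exact: blowup_outside.
  exists chosen_zero; split; first exact: chosen_zero_unique loc.
  split; first exact: chosen_zero_cvg loc.
  (* Since mu vanishes at -xi, the kink degenerates to 0 and the limit comes from flatness outside
     the support of the wells. *)
  have -> : kink mu 1 (- xi) = cst 0.
    by apply/funext => s; rewrite /kink (pot_even std) (pr_xi pr) sqrtr0 mul0r mulr0.
  apply: flat_cvg (chosen_zero_cvg loc); apply/flat_outside/mu_outside.
  by rewrite normrN ger0_norm // ltW.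
move=> x hx; apply/flat_blowup/(right_flat loc hx).
by move: hx; rewrite ltr_norml => /andP[].
Qed.

Lemma middle : s2 < a0 -> 0 < (s2 - a0) * rho mu zeta ^+ 3 + (s2 + a0) * rho mu 0 ^+ 3 ->
  (exists x1 : R -> R -> R,
     (\forall p \near regime a0, forall x, V p.1 p.2 x = 0 <-> x = x1 p.1 p.2) /\
     zero_limit mu a0 V 1 x1 (- zeta)) /\
  (forall x0, - xi < x0 -> x0 < - zeta -> blowup_limit a0 V x0 (- Num.sqrt (mu x0))) /\
  (forall x0, - zeta < x0 -> x0 < xi -> blowup_limit a0 V x0 (Num.sqrt (mu x0))) /\
  (forall x0, xi <= `|x0| -> blowup_limit a0 V x0 0).
Proof.
move=> as2 g0; have z0' := z0; have zx' := zx.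
have loc := located_left z0 (fun d => locate_middle pr a00 as2 g0 (d := d)).
split; last split; last split; last exact: blowup_outside.
- exists chosen_zero; split; first exact: chosen_zero_unique loc.
  by apply: (chosen_zero_kink loc); rewrite normrN gtr0_norm.
- move=> x h1 h2; apply/flat_blowup/(left_flat loc) => //.
  by rewrite ltr_norml; lra.
- move=> x h1 h2; apply/flat_blowup/(right_flat loc) => //.
  by rewrite ltr_norml; lra.
Qed.

Lemma supercritical : (s2 - a0) * rho mu zeta ^+ 3 + (s2 + a0) * rho mu 0 ^+ 3 < 0 ->
  (exists x1 x2 x3 : R -> R -> R,
     [/\ (\forall p \near regime a0,
            [/\ x1 p.1 p.2 < x2 p.1 p.2, x2 p.1 p.2 < x3 p.1 p.2 &
              forall x, V p.1 p.2 x = 0 <-> [\/ x = x1 p.1 p.2, x = x2 p.1 p.2 | x = x3 p.1 p.2]]),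
         zero_limit mu a0 V 1 x1 (- zeta), zero_limit mu a0 V 2 x2 0 & zero_limit mu a0 V 3 x3 zeta]) /\
  (forall x0, (- xi < x0 /\ x0 < - zeta) \/ (0 < x0 /\ x0 < zeta) ->
     blowup_limit a0 V x0 (- Num.sqrt (mu x0))) /\
  (forall x0, (- zeta < x0 /\ x0 < 0) \/ (zeta < x0 /\ x0 < xi) ->
     blowup_limit a0 V x0 (Num.sqrt (mu x0))) /\
  (forall x0, xi <= `|x0| -> blowup_limit a0 V x0 0).
Proof.
move=> g0; have z0' := z0; have zx' := zx.
have loc d : 0 < d -> evt0 (fun _ _ v _ => exists y1 y2 y3, three_zeros zeta v y1 y2 y3 /\
    [/\ `|y1 + zeta| <= d, `|y2| <= d & `|y3 - zeta| <= d]).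
  by move=> d0; exact: evt0_evt (locate_supercritical pr a00 g0 d0).
have [x1 [x2 [x3 E]]] : exists x1 x2 x3 : R -> R -> R, forall eps alpha y1 y2 y3,
    three_zeros zeta (V eps alpha) y1 y2 y3 -> [/\ x1 eps alpha = y1, x2 eps alpha = y2 & x3 eps alpha = y3].
  exists (fun eps alpha => (chosen_zeros eps alpha).1.1), (fun eps alpha => (chosen_zeros eps alpha).1.2),
    (fun eps alpha => (chosen_zeros eps alpha).2).
  by move=> eps alpha y1 y2 y3 /chosen_zerosP.
have c1 : x1 p.1 p.2 @[p --> regime a0] --> - zeta.
  apply/cvg_evt0 => d d0; apply: filterS (regime_evt0 (loc d d0)) => p [_ [_ [y1 [y2 [y3 [tz [h1 h2 h3]]]]]]].
  by rewrite opprK; have [-> _ _] := E _ _ _ _ _ tz.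
have c2 : x2 p.1 p.2 @[p --> regime a0] --> (0 : R).
  apply/cvg_evt0 => d d0; apply: filterS (regime_evt0 (loc d d0)) => p [_ [_ [y1 [y2 [y3 [tz [h1 h2 h3]]]]]]].
  by rewrite subr0; have [_ -> _] := E _ _ _ _ _ tz.
have c3 : x3 p.1 p.2 @[p --> regime a0] --> zeta.
  apply/cvg_evt0 => d d0; apply: filterS (regime_evt0 (loc d d0)) => p [_ [_ [y1 [y2 [y3 [tz [h1 h2 h3]]]]]]].
  by have [_ _ ->] := E _ _ _ _ _ tz.
have s1 : ((-1) ^+ 2) ^+ 2 = 1 :> R by rewrite -exprM -signr_odd.
have s2' : ((-1) ^+ 3) ^+ 2 = 1 :> R by rewrite -exprM -signr_odd.
have s3 : ((-1) ^+ 4) ^+ 2 = 1 :> R by rewrite -exprM -signr_odd.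
have zxi : `|zeta| < xi by rewrite gtr0_norm.
have zxi' : `|- zeta| < xi by rewrite normrN.
have xi0 : `|0 : R| < xi by rewrite normr0; lra.
split; last split; last split; last exact: blowup_outside.
- exists x1, x2, x3; split.
  + apply: filterS (regime_evt0 (loc _ ltr01)) => p [_ [_ [y1 [y2 [y3 [tz _]]]]]].
    have [-> -> ->] := E _ _ _ _ _ tz; have [[y12 y23 _] _ _ _] := tz.
    by split=> // x; exact: three_zerosP tz.
  + split; first exact: c1.
    rewrite kinkE; apply: (@kink_cvg x1 _ _ zxi' s1 c1).
    apply: filterS (regime_evt0 (loc _ ltr01)) => p [_ [lm [y1 [y2 [y3 [tz _]]]]]].
    have [-> _ _] := E _ _ _ _ _ tz; have [[y12 _ _] [v1 _ _] [_ p1] _] := tz.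
    by split=> //; rewrite -signr_odd mul1r; exact: (slope_ge0 (lm_d lm y1) v1 y12 p1).
  + split; first exact: c2.
    rewrite kinkE; apply: (@kink_cvg x2 _ _ xi0 s2' c2).
    apply: filterS (regime_evt0 (loc _ ltr01)) => p [_ [lm [y1 [y2 [y3 [tz _]]]]]].
    have [_ -> _] := E _ _ _ _ _ tz; have [[_ y23 _] [_ v2 _] _ [n2 _]] := tz.
    split=> //; rewrite -signr_odd /= expr1 mulN1r.
    apply: (slope_ge0 (is_derive_opp (lm_d lm y2)) _ y23) => [|x /n2]; first by rewrite v2 oppr0.
    by rewrite oppr_gt0.
  + split; first exact: c3.
    rewrite kinkE; apply: (@kink_cvg x3 _ _ zxi s3 c3).
    apply: filterS (regime_evt0 (loc _ ltr01)) => p [_ [lm [y1 [y2 [y3 [tz _]]]]]].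
    have [_ _ ->] := E _ _ _ _ _ tz; have [_ [_ _ v3] _ [_ p2]] := tz.
    have y34 : y3 < y3 + 1 by lra.
    by split=> //; rewrite -signr_odd mul1r; apply: (slope_ge0 (lm_d lm y3) v3 y34) => x /andP[/p2].
- move=> x hx; apply: flat_blowup; rewrite -mulN1r.
  have ss : (-1) ^+ 2 = 1 :> R by rewrite sqrrN expr1n.
  have xx : `|x| < xi by rewrite ltr_norml; case: hx; lra.
  case: hx => -[h1 h2].
    have d0 : 0 < (- zeta - x) / 3 by lra.
    apply: (flat_inside xx d0 ss); apply: evt0_mp (loc _ d0) (evt0_pt _).
    move=> eps alpha v dv lm e0 _ [y1 [y2 [y3 [[_ _ [n1 _] _] [d1 _ _]]]]] t ht.
    by rewrite mulN1r oppr_ge0; apply/ltW/n1; move: d1 ht; rewrite !ler_norml; lra.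
  have d0 : 0 < Num.min (x / 3) ((zeta - x) / 3) by rewrite lt_min; lra.
  have [m1 m2] : Num.min (x / 3) ((zeta - x) / 3) <= x / 3 /\ Num.min (x / 3) ((zeta - x) / 3) <= (zeta - x) / 3.
    by rewrite !ge_min !lexx orbT.
  apply: (flat_inside xx d0 ss); apply: evt0_mp (loc _ d0) (evt0_pt _).
  move=> eps alpha v dv lm e0 _ [y1 [y2 [y3 [[_ _ _ [n2 _]] [_ d2 d3]]]]] t ht.
  by rewrite mulN1r oppr_ge0; apply/ltW/n2; move: d2 d3 ht; rewrite !ler_norml; lra.
- move=> x hx; apply: flat_blowup; rewrite -[Num.sqrt _]mul1r.
  have xx : `|x| < xi by rewrite ltr_norml; case: hx; lra.
  case: hx => -[h1 h2].
    have d0 : 0 < Num.min (- x / 3) ((zeta + x) / 3) by rewrite lt_min; lra.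
    have [m1 m2] : Num.min (- x / 3) ((zeta + x) / 3) <= - x / 3 /\ Num.min (- x / 3) ((zeta + x) / 3) <= (zeta + x) / 3.
      by rewrite !ge_min !lexx orbT.
    apply: (flat_inside xx d0 (expr1n _ 2)); apply: evt0_mp (loc _ d0) (evt0_pt _).
    move=> eps alpha v dv lm e0 _ [y1 [y2 [y3 [[_ _ [_ p1] _] [d1 d2 _]]]]] t ht.
    by rewrite mul1r; apply/ltW/p1; move: d1 d2 ht; rewrite !ler_norml; lra.
  have d0 : 0 < (x - zeta) / 3 by lra.
  apply: (flat_inside xx d0 (expr1n _ 2)); apply: evt0_mp (loc _ d0) (evt0_pt _).
  move=> eps alpha v dv lm e0 _ [y1 [y2 [y3 [[_ _ _ [_ p2]] [_ _ d3]]]]] t ht.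
  by rewrite mul1r; apply/ltW/p2; move: d3 ht; rewrite !ler_norml; lra.
Qed.

End Assembly.

(** * The threshold [alpha_ss] and the choice of reflection *)

Lemma powR_three_half {R : realType} (x : R) : 0 <= x -> x `^ (3 / 2) = Num.sqrt x ^+ 3.
Proof. by move=> x0; rewrite mulrC powRrM powR12_sqrt // powR_mulrn // sqrtr_ge0. Qed.

Theorem theorem4p1 (R : realType) (mu : R -> R) (zeta xi : R)
  (mu_C1 : is_C1 mu) (mu_Loo : Lp +oo%E mu)
  (mu_even : forall x, mu (- x) = mu x)
  (zeta_gt0 : 0 < zeta)
  (dmu_lt0 : forall x, zeta < x -> derive1 mu x < 0)
  (dmu_gt0 : forall x, 0 < x -> x < zeta -> 0 < derive1 mu x)
  (zeta_lt_xi : zeta < xi) (mu_xi : mu xi = 0)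
  (xi_unique : forall x, zeta < x -> mu x = 0 -> x = xi)
  (f_L43 : Lp (4 / 3)%:E (forcing mu))
  (f_der0 : derivable (forcing mu) 0 1)
  (df0_lt0 : derive1 (forcing mu) 0 < 0)
  (mu_gt0 : forall x, 0 <= x -> x <= zeta -> 0 < mu x)
  (v0 : R -> R -> R -> R)
  (v0_min : forall eps alpha, 0 < eps -> 0 <= alpha ->
     global_minimizer mu eps alpha (v0 eps alpha)) :
  exists v : R -> R -> R -> R,
  [/\ (forall eps alpha, v eps alpha = v0 eps alpha \/
                         v eps alpha = hat (v0 eps alpha)),

  (forall alpha0, 0 < alpha0 -> alpha0 < Num.sqrt 2 ->
     (exists x1 : R -> R -> R,
        (\forall p \near regime alpha0,
           forall x, v p.1 p.2 x = 0 <-> x = x1 p.1 p.2) /\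
        zero_limit mu alpha0 v 1 x1 (- xi)) /\
     (forall x0, `|x0| < xi ->
        blowup_limit alpha0 v x0 (Num.sqrt (mu x0))) /\
     (forall x0, xi <= `|x0| -> blowup_limit alpha0 v x0 0)),

  (forall alpha0, Num.sqrt 2 < alpha0 -> alpha0 < alpha_ss mu zeta ->
     (exists x1 : R -> R -> R,
        (\forall p \near regime alpha0,
           forall x, v p.1 p.2 x = 0 <-> x = x1 p.1 p.2) /\
        zero_limit mu alpha0 v 1 x1 (- zeta)) /\
     (forall x0, - xi < x0 -> x0 < - zeta ->
        blowup_limit alpha0 v x0 (- Num.sqrt (mu x0))) /\
     (forall x0, - zeta < x0 -> x0 < xi ->
        blowup_limit alpha0 v x0 (Num.sqrt (mu x0))) /\
     (forall x0, xi <= `|x0| -> blowup_limit alpha0 v x0 0)) &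

  (forall alpha0, alpha_ss mu zeta < alpha0 ->
     (exists x1 x2 x3 : R -> R -> R,
        [/\ (\forall p \near regime alpha0,
               [/\ x1 p.1 p.2 < x2 p.1 p.2, x2 p.1 p.2 < x3 p.1 p.2 &
                 forall x, v p.1 p.2 x = 0 <->
                   [\/ x = x1 p.1 p.2, x = x2 p.1 p.2 | x = x3 p.1 p.2]]),
            zero_limit mu alpha0 v 1 x1 (- zeta),
            zero_limit mu alpha0 v 2 x2 0 &
            zero_limit mu alpha0 v 3 x3 zeta]) /\
     (forall x0, (- xi < x0 /\ x0 < - zeta) \/ (0 < x0 /\ x0 < zeta) ->
        blowup_limit alpha0 v x0 (- Num.sqrt (mu x0))) /\
     (forall x0, (- zeta < x0 /\ x0 < 0) \/ (zeta < x0 /\ x0 < xi) ->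
        blowup_limit alpha0 v x0 (Num.sqrt (mu x0))) /\
     (forall x0, xi <= `|x0| -> blowup_limit alpha0 v x0 0))].
Proof.
have zx := lt_trans zeta_gt0 zeta_lt_xi.
have Dmu (x : R) : is_derive x 1 mu (-2 * forcing mu x).
  by apply: is_derive_eq (derivable_is_derive (mu_C1.1 x)) _; rewrite /forcing; field.
have Nmu : (fun y => mu (- y)) = mu by apply/funext.
have odd x : derive1 mu (- x) = - derive1 mu x.
  have := is_derive_derive1 (fun x => is_derive_reflect (derivable_is_derive (mu_C1.1 (- x)))).
  rewrite Nmu => E; have Ex : derive1 mu x = - derive1 mu (- x) by exact: (congr1 (fun g => g x) E).
  by rewrite Ex opprK.
have pot : potential mu (forcing mu).
  split=> // [|x]; first exact: continuous_forcing.
  by rewrite /forcing odd; field.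
have mu_pos x : `|x| < xi -> 0 < mu x.
  have -> : mu x = mu `|x|.
    by have [h|h] := leP 0 x; [rewrite ger0_norm|rewrite ltr0_norm // mu_even].
  move=> xx; have [h|h] := leP `|x| zeta; first exact: mu_gt0.
  have [c /andP[c1 c2] E] := mvt xx (fun z _ => derivable_is_derive (mu_C1.1 z)).
  have := dmu_lt0 c (lt_trans h c1); rewrite -subr_gt0 in xx.
  by move: E; rewrite mu_xi sub0r => E h'; rewrite -oppr_lt0 E pmulr_llt0.
have pr : profile mu (forcing mu) zeta xi.
  split=> // x; rewrite /forcing; first by move=> /dmu_lt0; lra.
  by move=> h1 h2; have := dmu_gt0 x h1 h2; lra.
(* The freedom of symmetry is spent on making v nonnegative at 0. *)
pose v eps alpha := if v0 eps alpha 0 < 0 then hat (v0 eps alpha) else v0 eps alpha.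
have lmV eps alpha : 0 < eps -> 0 < alpha ->
    local_minimizer mu (forcing mu) eps alpha (v eps alpha) (derive1 (v eps alpha)) /\ 0 <= v eps alpha 0.
  move=> e0 al0; have lm := global_minimizer_local mu_C1 mu_Loo f_L43 e0 al0 (v0_min eps alpha e0 (ltW al0)).
  rewrite /v; case: ltP => h; last by split; [exact: lm|exact: h].
  split; last by rewrite /hat oppr0 oppr_ge0 ltW.
  have lmh := local_minimizer_hat mu_even (pot_odd pot) lm.
  by rewrite (is_derive_derive1 (lm_d lmh)).
have z_pos := mu_pos zeta ltac:(by rewrite gtr0_norm).
have o_pos := mu_pos 0 ltac:(by rewrite normr0).
have s0 := sqrtr_ge0 (2 : R).
pose A := rho mu zeta ^+ 3; pose B := rho mu 0 ^+ 3.
have AB : B < A.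
  apply: (M_smono (ltW o_pos)); exact: (mu_incr pr (lexx 0) zeta_gt0 (lexx _)).
have ssE : alpha_ss mu zeta = Num.sqrt 2 * (A + B) / (A - B).
  by rewrite /alpha_ss !powR_three_half // ltW.
have AB0 : 0 < A - B by rewrite subr_gt0.
have B0 : 0 < B by rewrite exprn_gt0 // rho_gt0.
(* After clearing the denominator A - B, the position of a relative to [alpha_ss] is the sign of the
   energy added by passing from one zero to three. *)
have mid a : a < alpha_ss mu zeta -> 0 < (Num.sqrt 2 - a) * A + (Num.sqrt 2 + a) * B.
  by rewrite ssE ltr_pdivlMr // => ass; move: ass; clear; lra.
have sup a : alpha_ss mu zeta < a -> 0 < a /\ (Num.sqrt 2 - a) * A + (Num.sqrt 2 + a) * B < 0.
  rewrite ssE ltr_pdivrMr // => ass; split; last by move: ass; clear; lra.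
  rewrite -(pmulr_lgt0 _ AB0); apply: le_lt_trans ass; apply: mulr_ge0 => //.
  by move: AB0 B0; clear; lra.
exists v; split.
- by move=> eps alpha; rewrite /v; case: ifP; [right|left].
- move=> a0 a00 as2; exact: (subcritical pr lmV a00 as2).
- move=> a0 as2 /mid ass; exact: (middle pr lmV (le_lt_trans s0 as2) as2 ass).
- move=> a0 /sup[a00 ass]; exact: (supercritical pr lmV a00 ass).
Qed.
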